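(* Let $M=\mathbb{R}^4\times S^3$, with the coclosed $G_2$-structure given by $A_1,A_2,A_3$ and $b_0>0$ as described in the context, and let $S^3\subset M$ be the singular orbit. There is a 3-parameter family of $\mathrm{SU}(2)^2$-invariant $G_2$-instantons with gauge group $\mathrm{SU}(2)$ in a neighbourhood of $S^3$ which smoothly extend over $S^3$ on $P_1$. Writing connections as $$\theta=\sum_{i=1}^3A_if_i^+\,T_i\otimes\eta_i^++\sum_{i=1}^3B_if_i^-\,T_i\otimes\eta_i^-,$$ these instantons have $f_i^-=0$, $i=1,2,3$, and $f_1^+,f_2^+,f_3^+$, defined for small $t>0$, solve the ODEs $$\dot f_1^++\Big(\tfrac{\dot A_1}{A_1}+\tfrac{A_1}{B_2B_3}-\tfrac{A_1}{A_2A_3}\Big)f_1^+=-f_2^+f_3^+,$$ $$\dot f_2^++\Big(\tfrac{\dot A_2}{A_2}+\tfrac{A_2}{B_1B_3}-\tfrac{A_2}{A_1A_3}\Big)f_2^+=-f_1^+f_3^+,$$ $$\dot f_3^++\Big(\tfrac{\dot A_3}{A_3}+\tfrac{A_3}{B_1B_2}-\tfrac{A_3}{A_1A_2}\Big)f_3^+=-f_1^+f_2^+,$$ subject to $f_i^+=f_{i,1}^+t+t^3u_i(t)$, $i=1,2,3$, where $f_{1,1}^+,f_{2,1}^+,f_{3,1}^+\in\mathbb{R}$ are the parameters and the $u_i$ are real analytic functions such that $$u_1(0)=-\Big(\tfrac1{4b_0^2}+2a_{2,3}+2a_{3,3}\Big)f_{1,1}^+-\tfrac12f_{2,1}^+f_{3,1}^+,$$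 $$u_2(0)=-\Big(\tfrac1{4b_0^2}+2a_{1,3}+2a_{3,3}\Big)f_{2,1}^+-\tfrac12f_{1,1}^+f_{3,1}^+,$$ $$u_3(0)=-\Big(\tfrac1{4b_0^2}+2a_{1,3}+2a_{2,3}\Big)f_{3,1}^+-\tfrac12f_{1,1}^+f_{2,1}^+ .$$
   Context: Manifold. View $M=\mathbb{R}^4\times S^3\subset\mathbb{H}\times\mathbb{H}$ with $\mathrm{SU}(2)^2$ (pairs of unit quaternions) acting by $(a_1,a_2)\cdot(p,q)=(a_1p,a_1q\bar a_2)$. The singular orbit is $S^3=\{0\}\times S^3\cong \mathrm{SU}(2)^2/\Delta\mathrm{SU}(2)$, and its complement is identified with $(0,\infty)\times\mathrm{SU}(2)^2$ by $(t,(a_1,a_2))\mapsto(a_1t,a_1\bar a_2)$. Let $\{T_i\}_{i=1}^3$ be a basis of $\mathfrak{su}(2)$ with $[T_i,T_j]=2\epsilon_{ijk}T_k$ (a ''standard basis''), $T_i^{+}=(T_i,T_i)$, $T_i^-=(T_i,-T_i)$, and let $\eta_i^\pm$ be the dual left-invariant 1-forms on $\mathrm{SU}(2)^2$. A dot denotes $d/dt$. A function on $[0,\infty)$ is called odd (even) if its Taylor expansion at $0$ has only odd (even) powers. $G_2$-structure. Let $A_1,A_2,A_3:[0,\infty)\to\mathbb{R}$ be smooth, positive on $(0,\infty)$, odd at $0$, with $\dot A_i(0)=1/2$; write $A_i(t)=\frac t2+a_{i,3}t^3+O(t^5)$. Let $b_0>0$. Let $B_1,B_2,B_3$ be the positive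 smooth functions on $[0,\infty)$, even at $0$, with $B_i(0)=b_0$, determined by the coclosedness equations $\frac{d}{dt}(A_jB_jA_kB_k)=A_1A_2A_3-A_iB_jB_k+A_jB_kB_i+A_kB_iB_j$ for every cyclic permutation $(i,j,k)$ of $(1,2,3)$. On $(0,\infty)\times \mathrm{SU}(2)^2$ set $\omega=4\sum_iA_iB_i\,\eta_i^-\wedge\eta_i^+$, $\Omega_1=8B_1B_2B_3\,\eta_1^-\wedge\eta_2^-\wedge\eta_3^- -8\sum_{cyc}A_iA_jB_k\,\eta_i^+\wedge\eta_j^+\wedge\eta_k^-$, $\Omega_2=-8A_1A_2A_3\,\eta_1^+\wedge\eta_2^+\wedge\eta_3^+ +8\sum_{cyc}B_iB_jA_k\,\eta_i^-\wedge\eta_j^-\wedge\eta_k^+$ (sums over cyclic permutations). The $G_2$-structure is $\varphi=dt\wedge\omega+\Omega_1$, with $\psi={*_\varphi}\varphi=\frac12\omega^2-dt\wedge\Omega_2$ and metric $dt^2+\sum_i(2A_i)^2\eta_i^+\otimes\eta_i^++\sum_i(2B_i)^2\eta_i^-\otimes\eta_i^-$; it is $\mathrm{SU}(2)^2$-invariant, extends smoothly to $M$, and $d\psi=0$. Instantons and bundles. A connection $A$ is a $G_2$-instanton if $F_A\wedge\psi=0$. $P_1=\mathrm{SU}(2)^2\times_{(\Delta\mathrm{SU}(2),1)}\mathrm{SU}(2)$ is the homogeneous $\mathrm{SU}(2)$-bundle over the singular orbit with trivial isotropy homomorphism, pulled back to $M$ via the projection to the singular orbit. Away from the singular orbit it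 is equivariantly identified (via $(h,g)\mapsto[h,g]$) with the trivial bundle $(0,\infty)\times\mathrm{SU}(2)^2\times\mathrm{SU}(2)$, so invariant connections there are $\mathfrak{su}(2)$-valued 1-forms; ''smoothly extends on $P_1$'' means extending to a smooth connection on $P_1$ over a neighbourhood of the singular orbit.
   Formalization: The u_i are claimed real analytic only when all A_i are real analytic on [0,∞); for merely smooth A_i, where analyticity can fail (e.g. A_i = t/2 plus flat bumps accumulating at 0), the u_i are claimed smooth up to t = 0. *)

(* Defs.v *)
From HB Require Import structures.
From mathcomp Require Import all_boot all_order all_algebra.
From mathcomp Require Import ring.
From mathcomp Require Import all_classical all_reals all_analysis.

Set Implicit Arguments.
Unset Strict Implicit.
Unset Printing Implicit Defensive.

Import Order.TTheory GRing.Theory Num.Theory.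
Import numFieldNormedType.Exports.

Local Open Scope ring_scope.

Section Smoothness.
Local Open Scope classical_set_scope.
Local Open Scope ring_scope.
Context {R : realType}.

(* For finite-dimensional [V] and open [U], [forall k, Ck k U f] is the usual
   C^infinity condition on [U]. *)
Fixpoint Ck (V W : normedModType R) (k : nat) (U : set V) (f : V -> W) : Prop :=
  match k with
  | 0%N => forall x, U x -> {for x, continuous f}
  | k'.+1 => (forall x v, U x -> derivable f x v) /\
             (forall v, Ck k' U (fun x => 'D_v f x))
  end.

Definition smooth (V W : normedModType R) (U : set V) (f : V -> W) : Prop :=
  forall k, Ck k U f.

(* Smoothness on an arbitrary subset: restriction of a smooth function defined
   on an open neighbourhood. *)
Definition smooth_on (V W : normedModType R) (D : set V) (f : V -> W) : Prop :=
  exists (U : set V) (g : V -> W),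
    [/\ open U, D `<=` U, smooth U g & forall x, D x -> g x = f x].

(* Smooth functions on [0, +oo) whose Taylor expansion at 0 has only odd
   ([b = true]) or only even ([b = false]) powers. Values at negative arguments
   are irrelevant; the Taylor coefficients do not depend on the extension [g]. *)
Definition smooth_parity (b : bool) (f : R -> R) : Prop :=
  exists g : R -> R,
    [/\ smooth (setT : set R) g, forall t, 0 <= t -> g t = f t
      & forall n, odd n != b -> derive1n n g 0 = 0].

Definition smooth_odd := smooth_parity true.
Definition smooth_even := smooth_parity false.

(* Locally, on [D], [f] is the sum of a power series. *)
Definition real_analytic_on (D : set R) (f : R -> R) : Prop :=
  forall x, D x -> exists2 r : R, 0 < r &
    exists c : nat -> R, forall t, D t -> `|t - x| < r ->
      pseries c (t - x) @ \oo --> f t.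

End Smoothness.

Section Quaternions.
Local Open Scope classical_set_scope.
Local Open Scope ring_scope.
Context {R : realType}.

(* x0 + x1 i + x2 j + x3 k *)
Definition quat := 'rV[R]_4.

Definition mkquat (a b c d : R) : quat :=
  \row_(l < 4) nth 0 [:: a; b; c; d] l.

Definition qmul (x y : quat) : quat :=
  let x0 := x 0 0 in let x1 := x 0 1 in
  let x2 := x 0 2%:R in let x3 := x 0 3%:R in
  let y0 := y 0 0 in let y1 := y 0 1 in
  let y2 := y 0 2%:R in let y3 := y 0 3%:R in
  mkquat (x0 * y0 - x1 * y1 - x2 * y2 - x3 * y3)
         (x0 * y1 + x1 * y0 + x2 * y3 - x3 * y2)
         (x0 * y2 - x1 * y3 + x2 * y0 + x3 * y1)
         (x0 * y3 + x1 * y2 - x2 * y1 + x3 * y0).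

Definition qconj (x : quat) : quat :=
  mkquat (x 0 0) (- x 0 1) (- x 0 2%:R) (- x 0 3%:R).

Definition qcomm (x y : quat) : quat := qmul x y - qmul y x.

(* SU(2) is the group of unit quaternions, su(2) the imaginary quaternions. *)
Definition SU2 : set quat := [set x | \sum_(l < 4) x 0 l ^+ 2 = 1].
Definition su2 : set quat := [set x | x 0 0 = 0].

(* Indices 1, 2, 3 are represented by 0, 1, 2 in 'I_3, whose addition is
   modulo 3: the cyclic permutations of (1, 2, 3) are (i, i + 1, i + 2). *)
Definition levi_civita (i j k : 'I_3) : R :=
  if (j == i + 1) && (k == i + 2%:R) then 1
  else if (j == i + 2%:R) && (k == i + 1) then -1 else 0.

Definition standard_basis (T : 'I_3 -> quat) : Prop :=
  [/\ forall i, su2 (T i), row_free (\matrix_(i < 3) T i) &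
      forall i j, qcomm (T i) (T j) = \sum_k (2 * levi_civita i j k) *: T k].

End Quaternions.
Arguments quat R : clear implicits.

(* Left-invariant frame of (0, oo) x SU(2)^2: [None] is d/dt, [Some (true, i)]
   is T_i^+ and [Some (false, i)] is T_i^-. *)
Definition frame := option (bool * 'I_3).

Definition frame_rank (a : frame) : nat :=
  match a with
  | None => 0
  | Some (true, i) => 1 + i
  | Some (false, i) => 4 + i
  end.

Section InvariantForms.
Context {R : realType}.

(* Invariant [W]-valued forms at a fixed t, by their coefficients on the basis
   of the exterior algebra indexed by increasing (w.r.t. [frame_rank]) subsets
   of the coframe (dt, eta_i^+, eta_i^-). *)
Definition form (W : lmodType R) := {ffun {set frame} -> W}.

Definition shuffle_sign (I J : {set frame}) : R :=
  (-1) ^+ #|[pred x : frame * frame |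
    [&& x.1 \in I, x.2 \in J & (frame_rank x.2 < frame_rank x.1)%N]]|.

Definition wedge (W : lmodType R) (al : form W) (be : form R^o) : form W :=
  [ffun K : {set frame} => \sum_(I : {set frame} | I \subset K)
     (shuffle_sign I (K :\: I) * be (K :\: I)) *: al I].

Definition coframe (a : frame) : form R^o :=
  [ffun I : {set frame} => (I == [set a])%:R].

(* Value of a 1-form on the frame vector X_a. *)
Definition on_frame (W : lmodType R) (al : form W) (a : frame) : W :=
  al [set a].

Definition dt : form R^o := coframe None.
Definition etap (i : 'I_3) : form R^o := coframe (Some (true, i)).
Definition etam (i : 'I_3) : form R^o := coframe (Some (false, i)).

Definition tensor (W : lmodType R) (x : W) (al : form R^o) : form W :=
  [ffun I : {set frame} => al I *: x].

(* [X_a, X_b] = sum_c bracket a b c X_c; see [frame_bracketP] below. *)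
Definition bracket (a b c : frame) : R :=
  match a, b, c with
  | Some (s, i), Some (s', j), Some (s'', k) =>
      if s'' == (s == s') then 2 * levi_civita i j k else 0
  | _, _, _ => 0
  end.

(* T_i^+ = (T_i, T_i) and T_i^- = (T_i, - T_i) in su(2)^2. *)
Definition Tp (T : 'I_3 -> quat R) (i : 'I_3) : quat R * quat R := (T i, T i).
Definition Tm (T : 'I_3 -> quat R) (i : 'I_3) : quat R * quat R := (T i, - T i).

Definition su2sq_frame (T : 'I_3 -> quat R) (a : frame) : quat R * quat R :=
  match a with
  | None => 0
  | Some (true, i) => Tp T i
  | Some (false, i) => Tm T i
  end.

Lemma frame_bracketP (T : 'I_3 -> quat R) (a b : frame) : standard_basis T ->
  let X := su2sq_frame T in
  (qcomm (X a).1 (X b).1, qcomm (X a).2 (X b).2) =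
  \sum_(c : frame) bracket a b c *: X c.
Proof.
move=> [_ _ hT] X; rewrite {}/X.
have sumE (s : bool) (x : 'I_3 -> R) :
    \sum_(c : frame) (if c is Some (s', k) then
       if s' == s then x k else 0 else 0) *: su2sq_frame T c =
    (\sum_k x k *: T k, (if s then 1 else -1) *: \sum_k x k *: T k).
  transitivity (\sum_(p : bool * 'I_3)
      (if p.1 == s then x p.2 else 0) *: su2sq_frame T (Some (p.1, p.2))).
    rewrite (bigD1 None) //= scale0r add0r.
    rewrite (reindex_omap (Some : bool * 'I_3 -> frame) id) /=; last by case.
    by apply: eq_big => [p|[s' k] _] //=; rewrite eqxx.
  rewrite -(pair_bigA _ (fun s' k => (if s' == s then x k else 0) *:
    su2sq_frame T (Some (s', k)))) big_bool /=.
  have sum0 (y : 'I_3 -> quat R * quat R) : \sum_k (0 : R) *: y k = 0.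
    by rewrite big1// => k _; rewrite scale0r.
  have pairE (y z : 'I_3 -> quat R) :
      \sum_k x k *: (y k, z k) = (\sum_k x k *: y k, \sum_k x k *: z k).
    elim/big_ind3 : _ => // ? ? ? ? ? ? -> -> //.
  case: s => /=; rewrite sum0 ?addr0 ?add0r.
    by rewrite /Tp pairE scale1r.
  rewrite /Tm pairE scaleN1r -sumrN; congr (_, _).
  by apply: eq_bigr => k _; rewrite scalerN.
have qN1 (x y : quat R) : qcomm (- x) y = - qcomm x y.
  by apply/rowP => l; case: l => -[|[|[|[|//]]]] lt_l; rewrite !mxE /= ?mxE; ring.
have qN2 (x y : quat R) : qcomm x (- y) = - qcomm x y.
  by apply/rowP => l; case: l => -[|[|[|[|//]]]] lt_l; rewrite !mxE /= ?mxE; ring.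
have q0l (x : quat R) : qcomm 0 x = 0.
  by apply/rowP => l; case: l => -[|[|[|[|//]]]] lt_l; rewrite !mxE /= ?mxE; ring.
have q0r (x : quat R) : qcomm x 0 = 0.
  by apply/rowP => l; case: l => -[|[|[|[|//]]]] lt_l; rewrite !mxE /= ?mxE; ring.
case: a => [[s i]|]; last first.
  by rewrite /= !q0l big1// => c _; rewrite scale0r.
case: b => [[s' j]|]; last first.
  by rewrite /= !q0r big1// => c _; case: s; rewrite scale0r.
rewrite /bracket (sumE (s == s') (fun k => 2 * levi_civita i j k)) -hT.
by case: s; case: s' => /=; rewrite ?qN1 ?qN2 ?opprK ?scale1r ?scaleN1r.
Qed.

(* Frame derivative of a t-dependent invariant quantity. *)
Definition frame_derive (a : frame) (g : R -> quat R) (t : R) : quat R :=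
  if a is None then derive1 g t else 0.

(* Curvature F = d theta + [theta /\ theta] / 2 of an invariant su(2)-valued
   1-form theta, evaluated on a pair of frame vectors. *)
Definition curvature_at (theta : R -> form (quat R)) (t : R) (a b : frame) :
    quat R :=
  frame_derive a (fun s => on_frame (theta s) b) t
  - frame_derive b (fun s => on_frame (theta s) a) t
  - \sum_(c : frame) bracket a b c *: on_frame (theta t) c
  + qcomm (on_frame (theta t) a) (on_frame (theta t) b).

Definition curvature (theta : R -> form (quat R)) (t : R) : form (quat R) :=
  \sum_(a : frame) \sum_(b : frame | (frame_rank a < frame_rank b)%N)
    tensor (curvature_at theta t a b) (wedge (coframe a) (coframe b)).

Section G2Structure.
Variables A B : 'I_3 -> R -> R.

Definition omega (t : R) : form R^o :=
  4 *: \sum_i (A i t * B i t) *: wedge (etam i) (etap i).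

Definition Omega2 (t : R) : form R^o :=
  - (8 * (A 0 t * A 1 t * A 2%:R t))
      *: wedge (wedge (etap 0) (etap 1)) (etap 2%:R)
  + 8 *: \sum_i (B i t * B (i + 1) t * A (i + 2%:R) t)
      *: wedge (wedge (etam i) (etam (i + 1))) (etap (i + 2%:R)).

(* psi is the Hodge dual of the 3-form of the G_2-structure. *)
Definition psi (t : R) : form R^o :=
  2^-1 *: wedge (omega t) (omega t) - wedge dt (Omega2 t).

Definition coclosed_equations : Prop :=
  forall (i : 'I_3) (t : R), 0 < t ->
    let j := i + 1 in let k := i + 2%:R in
    derive1 (fun s => A j s * B j s * A k s * B k s) t
    = A 0 t * A 1 t * A 2%:R t - A i t * B j t * B k t
      + A j t * B k t * B i t + A k t * B i t * B j t.

Definition is_G2_instanton (e : R) (theta : R -> form (quat R)) : Prop :=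
  forall t, 0 < t < e -> wedge (curvature theta t) (psi t) = 0.

Definition theta_of (T : 'I_3 -> quat R) (fp fm : 'I_3 -> R -> R) (t : R) :
    form (quat R) :=
  \sum_i (A i t * fp i t) *: tensor (T i) (etap i)
  + \sum_i (B i t * fm i t) *: tensor (T i) (etam i).

End G2Structure.
End InvariantForms.

Section BundleP1.
Local Open Scope classical_set_scope.
Local Open Scope ring_scope.
Context {R : realType}.
Let H : normedModType R := quat R.

(* The isotropy homomorphism of P_1 is trivial, so [h, g] |-> (h Delta, g)
   identifies P_1 with S^3 x SU(2), and its pullback to M with
   {(p, q, g) | q and g unit quaternions} in H x H x H, where SU(2) acts on the
   right of the last factor. [chart] is (t, (a1, a2), g) |-> [(a1, a2), g]
   over the point (a1 t, a1 conj a2) of M. *)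
Definition chart (x : R * H * H * H) : H * H * H :=
  let: (t, a1, a2, g) := x in (t *: a1, qmul a1 (qconj a2), g).

(* The left-invariant frame field at (t, a1, a2, g), with no component along
   the fibre. *)
Definition frame_field (T : 'I_3 -> quat R) (a : frame)
    (x : R * H * H * H) : R * H * H * H :=
  let: (t, a1, a2, g) := x in
  let: (X1, X2) := su2sq_frame T a in
  ((a == None)%:R, qmul a1 X1, qmul a2 X2, 0).

Definition total_space : set (H * H * H) := [set x | SU2 x.1.2 /\ SU2 x.2].

Definition tangent (x v : H * H * H) : Prop :=
  su2 (qmul (qconj x.1.2) v.1.2) /\ su2 (qmul (qconj x.2) v.2).

(* [w] restricts to a smooth connection 1-form on the part of the total space
   lying in the open set [U]. *)
Definition smooth_connection (U : set (H * H * H))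
    (w : H * H * H -> H * H * H -> H) : Prop :=
  [/\ forall v, smooth U (fun x => w x v),
      forall x, U x -> linear (w x),
      forall x v, U x -> total_space x -> tangent x v -> su2 (w x v),
      forall p q g xi, U (p, q, g) -> total_space (p, q, g) -> su2 xi ->
        w (p, q, g) (0, 0, qmul g xi) = xi
    & forall p q g v1 v2 v3 k, U (p, q, g) -> U (p, q, qmul g k) -> SU2 k ->
        total_space (p, q, g) -> tangent (p, q, g) (v1, v2, v3) ->
        w (p, q, qmul g k) (v1, v2, qmul v3 k)
        = qmul (qmul (qconj k) (w (p, q, g) (v1, v2, v3))) k].

(* The connection Ad(g^-1) theta + g^-1 dg over 0 < t < e agrees, through
   [chart], with a smooth connection on P_1 near the singular orbit p = 0. *)
Definition extends_on_P1 (T : 'I_3 -> quat R) (e : R)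
    (theta : R -> form (quat R)) : Prop :=
  exists (U : set (H * H * H)) (w : H * H * H -> H * H * H -> H),
    [/\ open U,
        forall q g, SU2 q -> SU2 g -> U (0, q, g),
        smooth_connection U w
      & forall t a1 a2 g, 0 < t < e -> SU2 a1 -> SU2 a2 -> SU2 g ->
          let x := (t, a1, a2, g) in
          U (chart x) -> forall a : frame,
          w (chart x) ('D_(frame_field T a x) chart x)
          = qmul (qmul (qconj g) (on_frame (theta t) a)) g].

End BundleP1.

Section Instantons.
Local Open Scope classical_set_scope.
Local Open Scope ring_scope.
Context {R : realType}.
Variables (A B : 'I_3 -> R -> R).

(* The connection of [theta_of] is a G_2-instanton over 0 < t < e which
   smoothly extends over the singular orbit on P_1. *)
Definition instanton_on_P1 (T : 'I_3 -> quat R) (e : R)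
    (fp fm : 'I_3 -> R -> R) : Prop :=
  let theta := theta_of A B T fp fm in
  [/\ forall i, smooth (`]0, e[%classic : set R) (fp i)
                /\ smooth (`]0, e[%classic : set R) (fm i),
      is_G2_instanton A B e theta
    & extends_on_P1 T e theta].

Definition instanton_ODE (e : R) (fp : 'I_3 -> R -> R) : Prop :=
  forall (i : 'I_3) (t : R), 0 < t < e ->
    let j := i + 1 in let k := i + 2%:R in
    derive1 (fp i) t
    + (derive1 (A i) t / A i t + A i t / (B j t * B k t) - A i t / (A j t * A k t))
      * fp i t
    = - (fp j t * fp k t).

(* Member of the family with parameters [c i] (= f_{i,1}^+). The functions
   [A i] being only assumed smooth, analyticity of the [u i] is asserted when
   the [A i] are real analytic. *)
Definition family_member (b0 : R) (a3 : 'I_3 -> R) (e : R) (c : 'I_3 -> R)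
    (fp : 'I_3 -> R -> R) : Prop :=
  instanton_ODE e fp /\
  exists u : 'I_3 -> R -> R,
    [/\ forall i t, 0 < t < e -> fp i t = c i * t + t ^+ 3 * u i t,
        forall i, smooth_on (`[0, e[%classic : set R) (u i),
        (forall i, real_analytic_on `[0, +oo[%classic (A i)) ->
        forall i, real_analytic_on `[0, e[%classic (u i)
      & forall i : 'I_3, let j := i + 1 in let k := i + 2%:R in
        u i 0 = - ((4 * b0 ^+ 2)^-1 + 2 * a3 j + 2 * a3 k) * c i
                - 2^-1 * (c j * c k)].

End Instantons.

(* Main.v *)
(* Write [A_i = t a_i] and [f_i^+ = t V_i] with [a_i] even. The coclosedness
   equations make the coefficient of the [i]-th equation equal to
   [- 1 / t + t alpha_i] with [alpha_i] smooth and even, so the singular ODEs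
   become the regular system [V_i' = - t (alpha_i V_i + V_j V_k)], whose
   solutions are even and determined by [V_i 0 = f_{i,1}^+]. Then
   [u_i = (V_i - V_i 0) / t ^+ 2], and [u_i 0] is read off the system at [t = 0].
   When the [A_i] are analytic, so are the products [B_j B_k], which solve a
   linear equation with a regular singular point: a maximum principle for its
   [n]-th derivative bounds the growth of the Taylor coefficients. Analyticity
   then passes to [alpha_i], [V_i] and [u_i] by the same kind of bounds.

   Contracting the curvature with [psi] gives the equations for [f_i^+] and
   [f_i^-]. Restricting a smooth extension to the path [p = t], [q = g = 1] shows
   that [A_i f_i^+ = t chi_i] with [chi_i] smooth, and comparing with the point
   [p = - t] of the same orbit shows that [chi_i] is odd; hence [f_i^+ / t] is
   even and smooth. It also shows that [B_i f_i^-] is bounded; the equations for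
   [f_i^-] are linear with leading coefficient [4 / t], so that
   [t ^+ 2 * sum_i (B_i f_i^-) ^+ 2] satisfies a Gronwall inequality and vanishes.
   Conversely the connection with [f_i^- = 0] extends, being the 1-form
   [sum_i h_i(|p|) lambda_i T_i] with [h_i = a_i V_i] even and [lambda_i] the
   coordinates of the imaginary part of
   [conj p dp - 1/2 (conj p dq) (conj q p)]. *)

(* The data are known only on [[0, +oo)], but the calculus is done on open sets: odd and even
   functions are continued by parity, so that the singular time 0 becomes an interior point and
   division by [t] is an operation between smooth functions. The poles come from [A_i' (0) = 1/2]:
   near 0, [A_i' / A_i] contributes [1 / t] and [- A_i / (A_j A_k)] contributes [- 2 / t], which
   leaves exactly the pole removed by the substitution [f_i^+ = t V_i]. Since the [A_i] are merely
   smooth, power series give neither existence nor regularity; these come from Picard iteration and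
   from the equation itself. Analyticity is expressed by real bounds [C * rho ^+ n / (n + 1) ^+ 2]
   on normalised derivatives, uniform near a point of the half-line, a form that passes through
   products, inverses, quotients by [t] and ODEs. The products [B_j B_k] are studied instead of the
   [B_i] because the coclosedness equations are linear in them; their residue matrix at 0 has rows
   [(-4, 2, 2)], whose zero sum lets the maximum principle work from the first derivative on. *)
Require Import Defs.
From mathcomp Require Import all_boot all_order all_algebra.
From mathcomp Require Import ring lra.
From mathcomp Require Import all_classical all_reals all_analysis.

Import Order.TTheory GRing.Theory Num.Theory.
Import numFieldNormedType.Exports.

Set Implicit Arguments.
Unset Strict Implicit.
Unset Printing Implicit Defensive.

Local Open Scope classical_set_scope.
Local Open Scope ring_scope.

(** * Smooth functions *)

Section Smooth.
Context {R : realType}.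
Implicit Types V W : normedModType R.

Lemma derive_ext_open V W (U : set V) (f g : V -> W) x v : open U -> U x ->
  (forall y, U y -> f y = g y) -> 'D_v f x = 'D_v g x.
Proof.
move=> oU Ux fg; have [->|v0] := eqVneq v 0; first by rewrite !derive0.
apply: near_eq_derive => //; near=> y; apply: fg; near: y.
exact: open_nbhs_nbhs.
Unshelve. all: by end_near. Qed.

Lemma derivable_ext_open V W (U : set V) (f g : V -> W) x v : open U -> U x ->
  (forall y, U y -> f y = g y) -> derivable f x v -> derivable g x v.
Proof.
move=> oU Ux fg; have [->|v0] := eqVneq v 0; first by move=> _; apply: derivable0.
apply: near_eq_derivable => //; near=> y; apply: fg; near: y.
exact: open_nbhs_nbhs.
Unshelve. all: by end_near. Qed.

Lemma is_derive_ext_open V W (U : set V) (f g : V -> W) x v d : open U -> U x ->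
  (forall y, U y -> f y = g y) -> is_derive x v f d -> is_derive x v g d.
Proof.
move=> oU Ux fg [df <-]; split; first exact: derivable_ext_open fg df.
by apply/esym; exact: derive_ext_open fg.
Qed.

Lemma continuous_ext_open V W (U : set V) (f g : V -> W) x : open U -> U x ->
  (forall y, U y -> f y = g y) -> {for x, continuous f} -> {for x, continuous g}.
Proof.
move=> oU Ux fg fx; rewrite /prop_for /continuous_at -(fg x Ux).
apply: cvg_trans fx; apply: near_eq_cvg; near=> y; apply: fg; near: y.
exact: open_nbhs_nbhs.
Unshelve. all: by end_near. Qed.

Lemma Ck_ext_open V W k (U : set V) (f g : V -> W) : open U ->
  (forall x, U x -> f x = g x) -> Ck k U f -> Ck k U g.
Proof.
move=> oU; elim: k f g => [|k IH] f g fg /=.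
  by move=> h x Ux; apply: continuous_ext_open fg (h x Ux).
move=> [h1 h2]; split=> [x v Ux|v]; first exact: derivable_ext_open fg (h1 x v Ux).
apply: IH (h2 v) => x Ux; exact: derive_ext_open fg.
Qed.

Lemma smooth_ext_open V W (U : set V) (f g : V -> W) : open U ->
  (forall x, U x -> f x = g x) -> smooth U f -> smooth U g.
Proof. by move=> oU fg h k; apply: Ck_ext_open (h k). Qed.

(* Coinduction principle: a class of functions closed under directional
   derivatives consists of smooth functions. *)
Lemma smooth_coind V W (U : set V) (S : (V -> W) -> Prop) : open U ->
  (forall f, S f -> (forall x, U x -> {for x, continuous f}) /\
    forall v, (forall x, U x -> derivable f x v) /\
      exists2 g, S g & forall x, U x -> 'D_v f x = g x) ->
  forall f, S f -> smooth U f.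
Proof.
move=> oU HS f Sf k; elim: k f Sf => [|k IH] f Sf; first by have [] := HS f Sf.
have [_ h] := HS f Sf; split=> [x v|v]; first by have [+ _] := h v; apply.
have [_ [g Sg fg]] := h v.
by apply: (@Ck_ext_open _ _ _ _ g) => //; [move=> x Ux; rewrite fg|exact: IH].
Qed.

Lemma smooth_derivable V W (U : set V) (f : V -> W) x v :
  smooth U f -> U x -> derivable f x v.
Proof. by move=> /(_ 1%N) [h _]; apply: h. Qed.

Lemma smooth_derive V W (U : set V) (f : V -> W) v :
  smooth U f -> smooth U (fun x => 'D_v f x).
Proof. by move=> h k; have [_] := h k.+1; apply. Qed.

Lemma smooth_continuous V W (U : set V) (f : V -> W) x :
  smooth U f -> U x -> {for x, continuous f}.
Proof. by move=> /(_ 0%N); apply. Qed.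

Lemma Ck_sub V W k (U U' : set V) (f : V -> W) : U' `<=` U -> Ck k U f -> Ck k U' f.
Proof.
move=> sU; elim: k f => [|k IH] f /=; first by move=> h x /sU; apply: h.
by move=> [h1 h2]; split=> [x v /sU|v]; [apply: h1|apply: IH].
Qed.

Lemma smooth_sub V W (U U' : set V) (f : V -> W) : U' `<=` U -> smooth U f -> smooth U' f.
Proof. by move=> sU h k; apply: Ck_sub (h k). Qed.

(* The functions obtained from a family [X] and the smooth functions by sums
   and products. *)
Inductive salg V (U : set V) (X : (V -> R) -> Prop) : (V -> R) -> Prop :=
| SalgBase f : X f -> salg U X f
| SalgSmooth f : smooth U f -> salg U X f
| SalgD f g : salg U X f -> salg U X g -> salg U X (fun x => f x + g x)
| SalgM f g : salg U X f -> salg U X g -> salg U X (fun x => f x * g x)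
| SalgExt f g : salg U X f -> (forall x, U x -> f x = g x) -> salg U X g.

(** The Leibniz rules keep the derivatives of sums and products in [salg], so the coinduction only
    asks for the derivatives of the generators [X]. Inverses, solutions of ODEs and radial functions
    all enter this way: their derivatives are polynomials in generators with smooth coefficients. *)
Lemma salg_smooth V (U : set V) (X : (V -> R) -> Prop) : open U ->
  (forall f, X f -> (forall x, U x -> {for x, continuous f}) /\
    forall v, (forall x, U x -> derivable f x v) /\
      salg U X (fun x => 'D_v f x)) ->
  forall f, salg U X f -> smooth U f.
Proof.
move=> oU HX; apply: smooth_coind => // f Sf.
suff H : (forall x, U x -> {for x, continuous f}) /\
    forall v, (forall x, U x -> derivable f x v) /\ salg U X (fun x => 'D_v f x).
  by split; [exact: H.1|move=> v; split; [exact: (H.2 v).1|eexists; [exact: (H.2 v).2|]]].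
elim: Sf => {f} [f /HX//|f sf|f g _ [cf df] _ [cg dg]|f g hf [cf df] hg [cg dg]|f g hf [cf df] fg].
- split=> [x|v]; first exact: smooth_continuous.
  split=> [x|]; first exact: smooth_derivable.
  by apply: SalgSmooth; apply: smooth_derive.
- split=> [x Ux|v]; first exact: cvgD (cf x Ux) (cg x Ux).
  split=> [x Ux|]; first exact: derivableD ((df v).1 x Ux) ((dg v).1 x Ux).
  apply: (SalgExt (SalgD (df v).2 (dg v).2)) => x Ux.
  by rewrite -(deriveD ((df v).1 x Ux) ((dg v).1 x Ux)).
- split=> [x Ux|v]; first exact: cvgM (cf x Ux) (cg x Ux).
  split=> [x Ux|]; first exact: derivableM ((df v).1 x Ux) ((dg v).1 x Ux).
  apply: (SalgExt (SalgD (SalgM hf (dg v).2) (SalgM hg (df v).2))) => x Ux.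
  by rewrite -(deriveM ((df v).1 x Ux) ((dg v).1 x Ux)).
- split=> [x Ux|v]; first exact: continuous_ext_open fg (cf x Ux).
  split=> [x Ux|]; first exact: derivable_ext_open fg ((df v).1 x Ux).
  by apply: (SalgExt (df v).2) => x Ux; apply: derive_ext_open fg.
Qed.

Lemma salg_smooth0 V (U : set V) f : open U -> salg U (fun _ => False) f -> smooth U f.
Proof. by move=> oU; apply: salg_smooth. Qed.

Section Closure.
Variables (V : normedModType R) (U : set V).
Hypothesis oU : open U.
Implicit Types f g : V -> R.

Lemma smoothD f g : smooth U f -> smooth U g -> smooth U (fun x => f x + g x).
Proof. by move=> sf sg; apply: salg_smooth0 => //; apply: SalgD; apply: SalgSmooth. Qed.

Lemma smoothM f g : smooth U f -> smooth U g -> smooth U (fun x => f x * g x).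
Proof. by move=> sf sg; apply: salg_smooth0 => //; apply: SalgM; apply: SalgSmooth. Qed.

Lemma smooth_cst W (c : W) : smooth U (fun _ => c).
Proof.
suff: forall f : V -> W, (exists c, f = cst c) -> smooth U f by apply; exists c.
apply: smooth_coind => //.
move=> _ [{}c ->]; split=> [x _|v]; first exact: cvg_cst.
split=> [x _|]; first exact: derivable_cst.
by exists (cst 0); [exists 0|move=> x _; rewrite derive_cst].
Qed.

Lemma smoothZ k f : smooth U f -> smooth U (fun x => k * f x).
Proof. by move=> sf; apply: smoothM => //; exact: smooth_cst. Qed.

Lemma smoothN f : smooth U f -> smooth U (fun x => - f x).
Proof.
by move=> sf; apply: (smooth_ext_open oU _ (smoothZ (-1) sf)) => x _; rewrite mulN1r.
Qed.

Lemma smoothB f g : smooth U f -> smooth U g -> smooth U (fun x => f x - g x).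
Proof. by move=> sf sg; apply: smoothD => //; apply: smoothN. Qed.

Lemma smoothX f n : smooth U f -> smooth U (fun x => f x ^+ n).
Proof.
move=> sf; elim: n => [|n IH].
  by apply: (smooth_ext_open oU _ (smooth_cst (1 : R))) => x _; rewrite expr0.
by apply: (smooth_ext_open oU _ (smoothM sf IH)) => x _; rewrite exprS.
Qed.

Lemma smooth_sum I (r : seq I) (F : I -> V -> R) :
  (forall i, smooth U (F i)) -> smooth U (fun x => \sum_(i <- r) F i x).
Proof.
move=> sF; elim: r => [|i r IH].
  by apply: (smooth_ext_open oU _ (smooth_cst (0 : R))) => x _; rewrite big_nil.
by apply: (smooth_ext_open oU _ (smoothD (sF i) IH)) => x _; rewrite big_cons.
Qed.

Lemma smoothV f : (forall x, U x -> f x != 0) -> smooth U f ->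
  smooth U (fun x => (f x)^-1).
Proof.
(* One generator suffices: the derivative of [1 / f] is [- f' (1 / f) ^+ 2]. *)
move=> f0 sf; pose X g := g = (fun x => (f x)^-1).
apply: (@salg_smooth _ _ X) => //; last exact: SalgBase.
move=> _ ->; split=> [x Ux|v].
  by apply: cvgV; [exact: f0|exact: smooth_continuous sf Ux].
have df x : U x -> derivable f x v by apply: smooth_derivable.
split=> [x Ux|]; first by apply: derivableV; [exact: f0|exact: df].
have XV : salg U X (fun x => (f x)^-1) by exact: SalgBase.
have D : salg U X (fun x => - 'D_v f x) by apply/SalgSmooth/smoothN/smooth_derive.
apply: (SalgExt (SalgM (SalgM XV XV) D)) => x Ux.
rewrite (deriveV (f0 x Ux) (df x Ux)) /GRing.scale /= mulrN mulNr -exprVn expr2.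
by [].
Qed.

End Closure.
End Smooth.

Lemma is_derive_scale (R : realType) (V W : normedModType R) (f : V -> R) (e : W) x v :
  derivable f x v -> is_derive x v (fun x => f x *: e) ('D_v f x *: e).
Proof.
move=> df; have H : (fun h : R => h^-1 *: (((fun x => f x *: e) \o shift x) (h *: v) - f x *: e)) @ 0^'
    --> 'D_v f x *: e.
  under eq_fun do rewrite /= -scalerBl scalerA.
  by apply: cvgZr_tmp; exact: df.
by split; [apply/cvg_ex; eexists; exact: H|apply: cvg_lim].
Qed.

(** * Parity and division by [t] *)

Section Smooth1.
Context {R : realType}.
Implicit Types (U : set R) (f g : R -> R).

Lemma derivable1_dir (W : normedModType R) (f : R -> W) x v : derivable f x 1 ->
  derivable f x v /\ 'D_v f x = v *: derive1 f x.
Proof.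
move=> /derivable1_diffP df; split; first exact: diff_derivable.
by rewrite deriveE // derive1E' // -[in LHS](mulr1 v) -[v * 1]/(v *: 1) linearZ.
Qed.

Lemma is_derive1P (W : normedModType R) (f : R -> W) (x : R) (d : W) :
  is_derive x 1 f d -> derive1 f x = d.
Proof. by rewrite derive1E => -[]. Qed.

Lemma smooth1_coind U (S : (R -> R) -> Prop) : open U ->
  (forall f, S f -> (forall x, U x -> derivable f x 1) /\
      exists2 g, S g & forall x, U x -> derive1 f x = g x) ->
  forall f, S f -> smooth U f.
Proof.
move=> oU HS f0 Sf0.
(* The derivative in direction [v] is [v] times [derive1], so the class has to be closed under
   scalar multiples before [smooth_coind] applies. *)
suff: forall f, (exists k, exists2 g, S g & f = fun x => k * g x) -> smooth U f.
  apply; exists 1, f0 => //; apply/funext => x; exact/esym/mul1r.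
apply: smooth_coind => // _ [k [f Sf ->]].
have [df [g Sg fg]] := HS f Sf.
have dkf x : U x -> derivable (fun x => k * f x) x 1.
  by move=> Ux; apply: derivableM; [exact: derivable_cst|exact: df].
split=> [x Ux|v].
  by apply/differentiable_continuous/derivable1_diffP/dkf.
split=> [x Ux|]; first by have [] := derivable1_dir v (dkf x Ux).
exists (fun x => v * k * g x); first by exists (v * k), g.
move=> x Ux; have [_ ->] := derivable1_dir v (dkf x Ux).
by rewrite derive1Ml ?fg //; [rewrite /GRing.scale /= mulrA|exact: df].
Qed.

Lemma smooth1_derive U f : open U -> smooth U f -> smooth U (derive1 f).
Proof.
move=> oU sf; have := @smooth_derive _ _ _ U f 1 sf.
apply: smooth_ext_open => // x _.
by rewrite derive1E.
Qed.

Lemma smooth1_derivable U f x : smooth U f -> U x -> derivable f x 1.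
Proof. exact: smooth_derivable. Qed.

Lemma smooth1_deriven U f n : open U -> smooth U f -> smooth U (derive1n n f).
Proof.
by move=> oU sf; elim: n => [//|n IH]; rewrite derive1nS; apply: smooth1_derive.
Qed.

Lemma derive1_ext_open U f g x : open U -> U x ->
  (forall y, U y -> f y = g y) -> derive1 f x = derive1 g x.
Proof. by move=> oU Ux fg; rewrite !derive1E; apply: derive_ext_open fg. Qed.

Lemma derive1n_ext_open U f g n x : open U -> U x ->
  (forall y, U y -> f y = g y) -> (derive1n n f) x = (derive1n n g) x.
Proof.
move=> oU Ux fg; elim: n x Ux => [|n IH] x Ux; first exact: fg.
by rewrite !derive1nS; apply: derive1_ext_open oU Ux IH.
Qed.

Lemma salg_smooth1 U (X : (R -> R) -> Prop) : open U ->
  (forall f, X f -> (forall x, U x -> derivable f x 1) /\ salg U X (derive1 f)) ->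
  forall f, salg U X f -> smooth U f.
Proof.
move=> oU HX; apply: salg_smooth => // f /HX [df sf].
split=> [x Ux|v]; first exact/differentiable_continuous/derivable1_diffP/df.
split=> [x Ux|]; first by have [] := derivable1_dir v (df x Ux).
have cv : salg U X (fun=> v) by apply: SalgSmooth; apply: smooth_cst.
apply: (SalgExt (SalgM cv sf)) => x Ux.
by have [_ ->] := derivable1_dir v (df x Ux).
Qed.

Lemma smooth_id U : open U -> smooth U (fun x : R => x).
Proof.
move=> oU; suff: forall f : R -> R, (f = id \/ exists c, f = cst c) -> smooth U f.
  by apply; left.
apply: smooth1_coind => // f [->|[c ->]].
  split=> [x _|]; first exact: derivable_id.
  by exists (cst 1); [right; exists 1|move=> x _; rewrite derive1_id].
split=> [x _|]; first exact: derivable_cst.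
by exists (cst 0); [right; exists 0|move=> x _; rewrite derive1_cst].
Qed.

Lemma mvt_bound f a b M :
  (forall x, Num.min a b <= x <= Num.max a b -> derivable f x 1 /\ `|derive1 f x| <= M) ->
  `|f b - f a| <= M * `|b - a|.
Proof.
wlog ab : a b / a <= b => [H h|].
  have [ab|] := boolP (a <= b); first exact: H.
  rewrite -ltNge => /ltW ba.
  rewrite distrC (distrC b a); apply: H => // x.
  by rewrite minC maxC; apply: h.
rewrite min_l // max_r // => h.
have H1 x : x \in `]a, b[ -> is_derive x 1 f (derive1 f x).
  rewrite in_itv /= => /andP[/ltW ax /ltW xb]; rewrite derive1E.
  by apply: derivableP; have [] := h x; rewrite ?ax.
have H2 : {within `[a, b], continuous f}.
  apply: derivable_within_continuous => x; rewrite in_itv /= => xab.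
  by have [] := h x xab.
have [c] := MVT_segment ab H1 H2.
rewrite in_itv /= => cab ->.
rewrite normrM ler_wpM2r //.
by have [] := h c cab.
Qed.



Lemma between0_norm (s t : R) : Num.min 0 t <= s <= Num.max 0 t -> `|s| <= `|t|.
Proof. by rewrite ler_norml; case: ltrgt0P => t0 /andP[]; lra. Qed.

Lemma smooth1_is_derive U f x : smooth U f -> U x -> is_derive x 1 f (derive1 f x).
Proof. by move=> sf Ux; rewrite derive1E; exact: derivableP (smooth1_derivable sf Ux). Qed.

(** An epsilon form suited to functions glued at 0 from separate formulas, where no identity on a
    neighbourhood gives the derivative. *)
Lemma is_derive_near_bound (f : R -> R) (x d : R) : is_derive x 1 f d <->
  forall e : R, 0 < e -> exists2 r : R, 0 < r & forall h : R, `|h| < r ->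
    `|f (x + h) - f x - d * h| <= e * `|h|.
Proof.
split.
  move=> [df <-] e e0.
  have /cvgrPdist_le /(_ e e0) : (fun h : R => h^-1 *: ((f \o shift x) (h *: 1) - f x)) @ 0^'
    --> 'D_1 f x by exact: df.
  rewrite near_withinE => /nbhs_norm0P[r /= r0 H]; exists r => // h hr.
  have [->|h0] := eqVneq h 0; first by rewrite addr0 subrr mulr0 subrr normr0 mulr0.
  have := H h hr h0; rewrite /= /GRing.scale /= mulr1 (addrC h x) => H1.
  have -> : f (x + h) - f x - 'D_1 f x * h = - (h * ('D_1 f x - h^-1 * (f (x + h) - f x))).
    by rewrite mulrBr mulrA divff // mul1r opprB mulrC.
  by rewrite normrN normrM mulrC ler_wpM2r.
move=> H.
have K : (fun h : R => h^-1 *: ((f \o shift x) (h *: 1) - f x)) @ 0^' --> d.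
  apply/cvgrPdist_le => e e0; have [r r0 {}H] := H e e0.
  near=> h.
  have hr : `|h| < r by near: h; exact: dnbhs0_lt.
  have h0 : h != 0 by near: h; exact: nbhs_dnbhs_neq.
  rewrite /GRing.scale /= mulr1 (addrC h x).
  have -> : d - h^-1 * (f (x + h) - f x) = - (h^-1 * (f (x + h) - f x - d * h)).
    by rewrite [in RHS]mulrBr mulrCA mulVf // mulr1 opprB.
  rewrite normrN normrM normfV ler_pdivrMl ?normr_gt0 //.
  by rewrite (mulrC _ e); exact: H.
by split; [apply/cvg_ex; exists d|exact: cvg_lim K].
Unshelve. all: by end_near. Qed.

Section DeriveRules.
Implicit Types (x : R) (a b : R).

Lemma isd_eq f x a b : is_derive x 1 f a -> a = b -> is_derive x 1 f b.
Proof. by move=> h <-. Qed.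

Lemma isd_cst x a : is_derive x 1 (fun _ : R => a) 0.
Proof. exact: is_derive_cst. Qed.

Lemma isd_id x : is_derive x 1 (fun y : R => y) 1.
Proof. exact: is_derive_id. Qed.

Lemma isdD f g x a b : is_derive x 1 f a -> is_derive x 1 g b ->
  is_derive x 1 (fun y => f y + g y) (a + b).
Proof. by move=> fa gb; apply: (is_deriveD (f := f) (g := g)). Qed.

Lemma isdN f x a : is_derive x 1 f a -> is_derive x 1 (fun y => - f y) (- a).
Proof. by move=> fa; apply: (is_deriveN (f := f)). Qed.

Lemma isdB f g x a b : is_derive x 1 f a -> is_derive x 1 g b ->
  is_derive x 1 (fun y => f y - g y) (a - b).
Proof. by move=> fa gb; apply: (is_deriveB (f := f) (g := g)). Qed.

Lemma isdM f g x a b : is_derive x 1 f a -> is_derive x 1 g b ->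
  is_derive x 1 (fun y => f y * g y) (a * g x + f x * b).
Proof.
move=> fa gb; apply: isd_eq (is_deriveM (f := f) (g := g) fa gb) _.
by rewrite /GRing.scale /= addrC (mulrC a).
Qed.

Lemma isdZ f x a b : is_derive x 1 f a -> is_derive x 1 (fun y => b * f y) (b * a).
Proof.
by move=> fa; apply: isd_eq (isdM (isd_cst x b) fa) _; rewrite mul0r add0r.
Qed.

Lemma isdX n x : is_derive x 1 (fun y : R => y ^+ n.+1) (n.+1%:R * x ^+ n).
Proof.
elim: n => [|n IH]; first by apply: isd_eq (isd_id x) _; rewrite expr0 mulr1.
apply: isd_eq (isdM (isd_id x) IH) _.
by rewrite mul1r mulrCA -exprS -[in RHS]natr1 mulrDl mul1r addrC.
Qed.

Lemma isdV f x a : f x != 0 -> is_derive x 1 f a ->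
  is_derive x 1 (fun y => (f y)^-1) (- a / f x ^+ 2).
Proof.
move=> fx fa; apply: isd_eq (is_deriveV (f := f) fx fa) _.
by rewrite /GRing.scale /= mulNr mulNr mulrC.
Qed.

Lemma isd_comp f g x a b : is_derive (g x) 1 f a -> is_derive x 1 g b ->
  is_derive x 1 (fun y => f (g y)) (a * b).
Proof. by move=> fa gb; apply: (@is_derive1_comp _ f g). Qed.

End DeriveRules.

Section Parity.

Definition parity_ext (b : bool) f t : R :=
  if 0 <= t then f t else (if b then - f (- t) else f (- t)).

Lemma parity_ext_opp (b : bool) f t : (b -> f 0 = 0) ->
  parity_ext b f (- t) = if b then - parity_ext b f t else parity_ext b f t.
Proof.
move=> f0; rewrite /parity_ext oppr_ge0 opprK; case: (ltrgt0P t) => t0.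
- by case: b f0.
- by case: b f0 => f0; rewrite ?opprK.
- by rewrite t0 oppr0; case: b f0 => // /(_ isT) ->; rewrite oppr0.
Qed.

(** The two halves meet at 0 to first order exactly under the stated condition: equal values for an
    odd reflection, equal slopes for an even one. The derivative is again a parity extension, of the
    other parity, which is what the coinduction needs. *)
Lemma is_derive_parity_ext (b : bool) f d : (forall t : R, is_derive t 1 f (d t)) ->
  (if b then f 0 = 0 else d 0 = 0) ->
  forall t : R, is_derive t 1 (parity_ext b f) (parity_ext (~~ b) d t).
Proof.
move=> fd f0 t; have [t0|t0|->] := ltrgt0P t.
- have oU : open [set x : R | 0 < x] by exact: open_gt.
  rewrite {2}/parity_ext (ltW t0); apply: (is_derive_ext_open oU) (fd t) => //= y y0.
  by rewrite /parity_ext (ltW y0).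
- have oU : open [set x : R | x < 0] by exact: open_lt.
  rewrite {2}/parity_ext leNgt t0 /=.
  apply: (@is_derive_ext_open _ _ _ _ (fun t => if b then - f (- t) else f (- t)) _ _ _ _ oU) => //=.
    by move=> y y0; rewrite /parity_ext leNgt y0.
  have H : is_derive t 1 (fun t => f (- t)) (- d (- t)).
    by rewrite -mulrN1; apply: (@is_derive1_comp _ f -%R).
  by case: b {f0} => //=; rewrite -[d (- t)]opprK; apply: is_deriveN.
rewrite /parity_ext lexx; apply/is_derive_near_bound => e e0.
have /is_derive_near_bound /(_ e e0) [r r0 H] := fd 0.
exists r => // h hr; rewrite add0r; case: ifPn => h0.
  by rewrite lexx; have := H h hr; rewrite add0r.
rewrite lexx; have := H (- h); rewrite normrN add0r => /(_ hr).
by case: b f0 => f0 Hh; rewrite f0 ?(subr0,mul0r,mulrN,opprK) in Hh *; rewrite // -normrN opprD !opprK.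
Qed.

Lemma smooth_parity_ext (b : bool) f : smooth (setT : set R) f ->
  (forall n, odd n != b -> derive1n n f 0 = 0) -> smooth (setT : set R) (parity_ext b f).
Proof.
move=> sf pf; pose S g := exists (c : bool) (h : R -> R), [/\ smooth (setT : set R) h,
  forall n, odd n != c -> derive1n n h 0 = 0 & g = parity_ext c h].
apply: (@smooth1_coind _ S openT) => [_ [c [h [sh ph ->]]]|]; last by exists b, f.
have dh (t : R) : is_derive t 1 h (derive1 h t) by apply: smooth1_is_derive sh _.
have H : forall t : R, is_derive t 1 (parity_ext c h) (parity_ext (~~ c) (derive1 h) t).
  apply: is_derive_parity_ext => //.
  by case: c ph => ph; [apply: (ph 0%N)|apply: (ph 1%N)].
split=> [x _|]; first by have [] := H x.
exists (parity_ext (~~ c) (derive1 h)) => [|x _]; last exact: is_derive1P.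
exists (~~ c), (derive1 h); split => //; first exact: smooth1_derive openT sh.
by move=> n nc; rewrite -derive1Sn; apply: ph => /=; move: nc; case: (odd n); case: (c).
Qed.

End Parity.

(* [hadamard_num f k t / t ^+ k.+1] is the [k]-th derivative of [f t / t]. *)
Section Hadamard.

Fixpoint hadamard_num f (k : nat) (t : R) : R :=
  if k is k'.+1 then t ^+ k * derive1n k f t - k%:R * hadamard_num f k' t
  else f t.

(** For [f 0 = 0] the value at 0 is the limit: [hadamard_num f k] vanishes at 0 and has derivative
    [t ^+ k * f^(k+1)(t)], so its quotient by [t^(k+1)] tends to [f^(k+1)(0) / (k+1)]. *)
Definition hadamard_quo f (k : nat) (t : R) : R :=
  if t == 0 then derive1n k.+1 f 0 / k.+1%:R else hadamard_num f k t / t ^+ k.+1.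

Definition quo f := hadamard_quo f 0.

Lemma quoE f t : t != 0 -> quo f t = f t / t.
Proof. by rewrite /quo /hadamard_quo => /negbTE ->. Qed.

Lemma quo0 f : quo f 0 = derive1 f 0.
Proof. by rewrite /quo /hadamard_quo eqxx divr1. Qed.

Lemma mul_quo f t : f 0 = 0 -> t * quo f t = f t.
Proof.
move=> f0; have [->|t0] := eqVneq t 0; first by rewrite mul0r.
by rewrite quoE // mulrCA divff // mulr1.
Qed.

Variables (U : set R) (f : R -> R).
Hypotheses (oU : open U) (sf : smooth U f) (f0 : f 0 = 0).
Hypothesis bU : forall t s, U t -> `|s| <= `|t| -> U s.

Lemma is_derive_deriven n (t : R) : U t ->
  is_derive t 1 (derive1n n f) (derive1n n.+1 f t).
Proof. by move=> Ut; rewrite derive1nS; apply: smooth1_is_derive Ut; apply: smooth1_deriven. Qed.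

(** The terms in [f^(k)] cancel: [hadamard_num f k t] is the integral of [s ^+ k * f^(k+1)(s)] from
    0 to [t]. The estimates at 0 below all follow from this. *)
Lemma is_derive_hadamard_num k (t : R) : U t ->
  is_derive t 1 (hadamard_num f k) (t ^+ k * derive1n k.+1 f t).
Proof.
elim: k => [|k IH] Ut; first by rewrite expr0 mul1r; exact: (is_derive_deriven 0 Ut).
have H1 := is_derive_deriven k.+1 Ut; have H2 := IH Ut.
apply: isd_eq (isdB (isdM (isdX k t) H1) (isdZ _ H2)) _.
by rewrite mulrA addrC addKr.
Qed.

Lemma hadamard_num0 k : hadamard_num f k 0 = 0.
Proof. by elim: k => [//|k IH] /=; rewrite IH expr0n mul0r mulr0 subrr. Qed.

Lemma is_derive_hadamard_quo k (t : R) : U t ->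
  is_derive t 1 (hadamard_quo f k) (hadamard_quo f k.+1 t).
Proof.
move=> Ut; have [t0|t0] := eqVneq t 0; last first.
  have oN0 : open [set x : R | x != 0] by exact: open_neq.
  rewrite {2}/hadamard_quo (negbTE t0).
  apply: (@is_derive_ext_open _ _ _ _ (fun t => hadamard_num f k t * (t ^+ k.+1)^-1) _ _ _ _ oN0) => //=.
    by move=> y y0; rewrite /hadamard_quo (negbTE y0).
  have H1 := is_derive_hadamard_num k Ut.
  have H2 := isdV (f := fun y => y ^+ k.+1) (expf_neq0 k.+1 t0) (isdX k t).
  apply: isd_eq (isdM H1 H2) _.
  rewrite -derive1nS; set a := derive1n _ f t; rewrite /= !exprS; field.
  by rewrite t0 expf_neq0.
rewrite t0 in Ut *.
rewrite {2}/hadamard_quo eqxx; apply/is_derive_near_bound => e e0.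
have := is_derive_deriven k.+1 Ut; move=> /is_derive_near_bound /(_ e e0) [r r0 H].
have /nbhs_ballP[r' /= r'0 HU] : nbhs (0 : R) U by exact: open_nbhs_nbhs.
exists (Num.min r r') => [|h]; first by rewrite lt_min r0.
rewrite lt_min => /andP[hr hr']; have Uh : U h by apply: HU; rewrite /ball /= sub0r normrN.
rewrite add0r.
have [->|h0] := eqVneq h 0; first by rewrite subrr mulr0 subrr normr0 mulr0.
rewrite /hadamard_quo eqxx (negbTE h0) -?derive1nS.
set a := derive1n k.+1 f 0; set b := derive1n k.+2 f 0.
(* [K] removes the two leading Taylor terms; its derivative [s ^+ k * (f^(k+1)(s) - a - b s)] is
   small because [b] is the derivative of [f^(k+1)] at 0. *)
pose K := fun s : R => hadamard_num f k s - (a / k.+1%:R) * s ^+ k.+1 - (b / k.+2%:R) * s ^+ k.+2.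
have Kd (s : R) : `|s| <= `|h| -> is_derive s 1 K (s ^+ k * (derive1n k.+1 f s - a - b * s)).
  move=> sh; have Us := bU Uh sh; have H1 := is_derive_hadamard_num k Us.
  apply: isd_eq (isdB (isdB H1 (isdZ _ (isdX k s))) (isdZ _ (isdX k.+1 s))) _.
  rewrite -/a -/b exprS; field.
  by rewrite -natrD nat1r !pnatr_eq0.
have : `|K h - K 0| <= (e * `|h| ^+ k.+1) * `|h - 0|.
  apply: mvt_bound => s sh.
  have {}sh := between0_norm sh.
  have KD := Kd s sh; split; first by case: KD.
  rewrite (is_derive1P KD) normrM normrX exprSr mulrA (mulrC e) -mulrA.
  apply: ler_pM; [exact: exprn_ge0|exact: normr_ge0|by rewrite lerXn2r ?nnegrE|].
  have := H s (le_lt_trans sh hr); rewrite add0r => /le_trans; apply.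
  by rewrite ler_pM2l.
have -> : K 0 = 0.
  by rewrite /K hadamard_num0 !expr0n /= !mulr0 !subr0.
rewrite !subr0 -mulrA -exprSr => HK.
have -> : hadamard_num f k h / h ^+ k.+1 - a / k.+1%:R - b / k.+2%:R * h = K h / h ^+ k.+1.
  rewrite /K !exprS; field.
  by rewrite expf_neq0 // h0 /= -natrD nat1r !pnatr_eq0.
rewrite normrM normfV normrX ler_pdivrMr ?exprn_gt0 ?normr_gt0 //.
by rewrite -mulrA -exprS.
Qed.

Lemma smooth_quo : smooth U (quo f).
Proof.
apply: (@smooth1_coind _ (fun q => exists k, q = hadamard_quo f k) oU); last by exists 0%N.
move=> _ [k ->]; split=> [x Ux|]; first by have [] := is_derive_hadamard_quo k Ux.
by exists (hadamard_quo f k.+1) => [|x Ux]; [exists k.+1|exact/is_derive1P/is_derive_hadamard_quo].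
Qed.

Lemma derive1n_quo n t : U t -> derive1n n (quo f) t = hadamard_quo f n t.
Proof.
elim: n t => [//|n IH] t Ut; rewrite derive1nS (derive1_ext_open oU Ut IH).
exact/is_derive1P/is_derive_hadamard_quo.
Qed.

(** By the integral form, the [n]-th derivative of [f / t] is [t^-(n+1)] times the integral of
    [s ^+ n * f^(n+1)(s)]; a factor [1 / (n + 1)] is given away. Division by [t] thus costs one
    derivative and no constant. *)
Lemma derive1n_quo_bound n t M : U t ->
  (forall s : R, Num.min 0 t <= s <= Num.max 0 t -> `|derive1n n.+1 f s| <= M) ->
  `|derive1n n (quo f) t| <= M.
Proof.
move=> Ut HM; rewrite derive1n_quo // /hadamard_quo.
have [t0|t0] := eqVneq t 0.
  have := HM 0; rewrite t0 minxx maxxx lexx => /(_ isT) h.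
  rewrite normrM normfV (@ger0_norm _ n.+1%:R) //; apply: le_trans h.
  by rewrite ler_pdivrMr // ler_peMr // ler1n.
rewrite normrM normfV normrX ler_pdivrMr ?exprn_gt0 ?normr_gt0 //.
have -> : `|hadamard_num f n t| = `|hadamard_num f n t - hadamard_num f n 0| by rewrite hadamard_num0 subr0.
rewrite exprSr mulrA -[X in _ * X](_ : `|t - 0| = _); last by rewrite subr0.
apply: mvt_bound => s sh.
have st := between0_norm sh.
have D := is_derive_hadamard_num n (bU Ut st); split; first by case: D.
rewrite (is_derive1P D) normrM normrX mulrC.
by apply: ler_pM; [exact: normr_ge0|exact: exprn_ge0|exact: HM|rewrite lerXn2r ?nnegrE].
Qed.

End Hadamard.

End Smooth1.

(** * Growth of Taylor coefficients *)

Section Jets.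
Context {R : realType}.
Implicit Types (U I : set R) (f g : R -> R).

(** Normalised by [n!] so that the Leibniz rule becomes a plain convolution, without binomial
    coefficients. *)
Definition jet f (n : nat) (t : R) : R := derive1n n f t / n`!%:R.

Lemma jet0 f t : jet f 0 t = f t.
Proof. by rewrite /jet fact0 divr1. Qed.

Lemma fact_neq0 n : n`!%:R != 0 :> R.
Proof. by rewrite pnatr_eq0 -lt0n fact_gt0. Qed.

Lemma natr_neq0 n : n.+1%:R != 0 :> R.
Proof. by rewrite pnatr_eq0. Qed.

Lemma jet_derive f n t : jet (derive1 f) n t = n.+1%:R * jet f n.+1 t.
Proof.
rewrite /jet derive1Sn factS natrM; field.
by rewrite fact_neq0 nat1r natr_neq0.
Qed.

Lemma jet_ext_open U f g n t : open U -> U t -> (forall y, U y -> f y = g y) ->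
  jet f n t = jet g n t.
Proof. by move=> oU Ut fg; rewrite /jet (derive1n_ext_open n oU Ut fg). Qed.

Section Leibniz.
Variable U : set R.
Hypothesis oU : open U.

Lemma jetD f g n t : smooth U f -> smooth U g -> U t ->
  jet (fun x => f x + g x) n t = jet f n t + jet g n t.
Proof.
elim: n f g => [|n IH] f g sf sg Ut; first by rewrite !jet0.
apply: (mulfI (natr_neq0 n)); rewrite -jet_derive mulrDr -!jet_derive.
rewrite -(IH _ _ (smooth1_derive oU sf) (smooth1_derive oU sg) Ut).
apply: jet_ext_open oU Ut _ => y Uy.
exact/is_derive1P/isdD/smooth1_is_derive/Uy/sg/smooth1_is_derive/Uy.
Qed.

Lemma jetM f g n t : smooth U f -> smooth U g -> U t ->
  jet (fun x => f x * g x) n t = \sum_(i < n.+1) jet f i t * jet g (n - i) t.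
Proof.
elim: n f g => [|n IH] f g sf sg Ut.
  by rewrite big_ord1 !jet0.
have sf' := smooth1_derive oU sf; have sg' := smooth1_derive oU sg.
apply: (mulfI (natr_neq0 n)); rewrite -jet_derive.
have -> : jet (derive1 (fun x => f x * g x)) n t =
    jet (fun x => derive1 f x * g x + f x * derive1 g x) n t.
  apply: jet_ext_open oU Ut _ => y Uy; apply: is_derive1P.
  by apply: isdM; [exact: smooth1_is_derive sf _|exact: smooth1_is_derive sg _].
rewrite jetD //; [|exact: smoothM|exact: smoothM].
rewrite !IH // mulr_sumr.
(* Differentiating either factor gives the same products with weights [i] and [n.+1 - i], which add
   up to [n.+1]. *)
transitivity (\sum_(i < n.+2) i%:R * (jet f i t * jet g (n.+1 - i) t) +
              \sum_(i < n.+2) (n.+1 - i)%:R * (jet f i t * jet g (n.+1 - i) t)).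
  congr (_ + _).
    rewrite [RHS]big_ord_recl mul0r add0r; apply: eq_bigr => i _.
    by rewrite jet_derive lift0 subSS mulrA.
  rewrite [RHS]big_ord_recr /= subnn mul0r addr0; apply: eq_bigr => i _.
  have E : (n.+1 - i)%N = (n - i).+1 by rewrite subSn // -ltnS.
  by rewrite jet_derive E mulrCA.
rewrite -big_split /=; apply: eq_bigr => i _.
by rewrite -mulrDl -natrD subnKC // -ltnS.
Qed.

End Leibniz.

Section Weights.

(* The convolution of these weights with themselves is bounded by a multiple of
   them, which makes the bounds [jbnd] stable under products. *)
Definition wgt n : R := (n.+1%:R ^+ 2)^-1.

Lemma wgt_gt0 n : 0 < wgt n.
Proof. by rewrite invr_gt0 exprn_gt0. Qed.

Lemma wgt_le1 n : wgt n <= 1.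
Proof. by rewrite invf_le1 ?exprn_gt0 // exprn_ege1 // ler1n. Qed.

Lemma wgtS n : wgt n <= 4 * wgt n.+1.
Proof.
rewrite /wgt -[leRHS]invf_div -[leLHS]mul1r -[_ / _]invf_div divr1 lef_pV2 ?posrE ?divr_gt0 ?exprn_gt0 //.
rewrite ler_pdivrMr // -[n.+2%:R]nat1r; have : 1 <= n.+1%:R :> R by rewrite ler1n.
by nra.
Qed.

Lemma wgt_decr n : wgt n.+1 <= wgt n.
Proof.
by rewrite lef_pV2 ?posrE ?exprn_gt0 // lerXn2r ?nnegrE // ler_nat.
Qed.

Lemma sum_wgt n : \sum_(i < n.+1) wgt i <= 2 - n.+1%:R^-1.
Proof.
elim: n => [|n IH]; first by rewrite big_ord1 /wgt expr1n invr1; lra.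
rewrite big_ord_recr /=; apply: le_trans (lerD IH (lexx _)) _.
rewrite /wgt; set a : R := n.+1%:R; have -> : n.+2%:R = a + 1 by rewrite natr1.
have a0 : 0 < a by rewrite ltr0n.
have -> : 2 - a^-1 + ((a + 1) ^+ 2)^-1 = 2 - (a + 1)^-1 - (a * (a + 1) ^+ 2)^-1.
  by field; rewrite !gt_eqF // ltr_wpDr.
by rewrite gerBl invr_ge0 mulr_ge0 ?exprn_ge0 ?addr_ge0 ?ltW.
Qed.

(** With [a = i + 1] and [b = n - i + 1] one has [n + 1 <= a + b] and [(a + b)^2 <= 2 (a^2 + b^2)],
    so [1 / (a^2 b^2)] is at most [2 / (n+1)^2] times [1 / a^2 + 1 / b^2]. The weights have total
    mass below 2, which gives the constant [2 * (2 + 2)]. *)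
Lemma wgt_conv n : \sum_(i < n.+1) wgt i * wgt (n - i) <= 8 * wgt n.
Proof.
have H (i : 'I_n.+1) : wgt i * wgt (n - i) <= 2 * wgt n * (wgt i + wgt (n - i)).
  rewrite /wgt; set a : R := i.+1%:R; set b : R := (n - i).+1%:R.
  have ab : n.+1%:R <= a + b.
    rewrite /a /b -natrD ler_nat addSn addnS subnKC; first by rewrite ltnW.
    by rewrite -ltnS.
  have a0 : 0 < a by rewrite ltr0n.
  have b0 : 0 < b by rewrite ltr0n.
  have n0 : (0 : R) < n.+1%:R by rewrite ltr0n.
  have -> : a ^- 2 + b ^- 2 = (a ^+ 2 + b ^+ 2) * (a ^+ 2 * b ^+ 2)^-1.
    by field; rewrite !gt_eqF.
  rewrite -invfM -[leLHS]mul1r [leRHS]mulrA ler_pM2r ?invr_gt0 ?mulr_gt0 ?exprn_gt0 //.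
  rewrite mulrAC ler_pdivlMr ?exprn_gt0 // mul1r.
  apply: (@le_trans _ _ ((a + b) ^+ 2)).
    by rewrite lerXn2r ?nnegrE ?(ltW n0) ?(le_trans (ltW n0) ab).
  rewrite -subr_ge0 (_ : _ - _ = (a - b) ^+ 2) ?sqr_ge0 //; ring.
apply: (le_trans (ler_sum _ (fun i _ => H i))).
rewrite -mulr_sumr big_split /=.
have -> : \sum_(i < n.+1) wgt (n - i) = \sum_(i < n.+1) wgt i.
  rewrite [RHS](reindex_inj rev_ord_inj) /=; apply: eq_bigr => i _.
  by rewrite subSS.
have := sum_wgt n; have := wgt_gt0 n.
have : (0 : R) < n.+1%:R^-1 by rewrite invr_gt0 ltr0n.
move: (\sum_(i < _) _) (wgt n) (n.+1%:R^-1) => s w v; nra.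
Qed.

End Weights.

Section Bounds.
Variables (U I : set R).
Hypotheses (oU : open U) (IU : I `<=` U).

(** The order is cut at [N] so that an induction on [N] can bootstrap the bound through a
    differential equation. *)
Definition jbnd (N : nat) (C rho : R) f := forall n t, (n <= N)%N -> I t ->
  `|jet f n t| <= C * rho ^+ n * wgt n.

Lemma jbndW N C C' rho rho' f : 0 <= C <= C' -> 0 <= rho <= rho' ->
  jbnd N C rho f -> jbnd N C' rho' f.
Proof.
move=> /andP[C0 CC'] /andP[r0 rr'] h n t nN It; apply: le_trans (h n t nN It) _.
rewrite ler_pM2r ?wgt_gt0 //; apply: ler_pM => //; first exact: exprn_ge0.
by rewrite lerXn2r ?nnegrE // (le_trans r0).
Qed.

Lemma jbnd_ge0 N C rho f t : I t -> jbnd N C rho f -> 0 <= C.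
Proof.
move=> It /(_ 0%N t (leq0n _) It); rewrite expr0 mulr1 /wgt expr1n invr1 mulr1.
exact: le_trans.
Qed.

Lemma jbndD N C C' rho f g : smooth U f -> smooth U g ->
  jbnd N C rho f -> jbnd N C' rho g -> jbnd N (C + C') rho (fun x => f x + g x).
Proof.
move=> sf sg hf hg n t nN It; rewrite (jetD oU) //; last exact: IU.
by rewrite !mulrDl (le_trans (ler_normD _ _)) // lerD ?hf ?hg.
Qed.

Lemma jetZ (k : R) f n t : smooth U f -> U t ->
  jet (fun x => k * f x) n t = k * jet f n t.
Proof.
elim: n f => [|n IH] f sf Ut; first by rewrite !jet0.
apply: (mulfI (natr_neq0 n)); rewrite [RHS]mulrCA -!jet_derive -IH //; last exact: smooth1_derive.
apply: jet_ext_open oU Ut _ => y Uy.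
exact/is_derive1P/isdZ/smooth1_is_derive/Uy.
Qed.

Lemma jbndZ N C k rho f : smooth U f ->
  jbnd N C rho f -> jbnd N (`|k| * C) rho (fun x => k * f x).
Proof.
move=> sf hf n t nN It; rewrite jetZ //; last exact: IU.
by rewrite normrM -!mulrA ler_wpM2l // mulrA hf.
Qed.

Lemma jbndM N C C' rho f g : 0 <= rho -> smooth U f -> smooth U g ->
  jbnd N C rho f -> jbnd N C' rho g -> jbnd N (8 * C * C') rho (fun x => f x * g x).
Proof.
move=> r0 sf sg hf hg n t nN It; rewrite (jetM oU) //; last exact: IU.
have C0 := jbnd_ge0 It hf; have C'0 := jbnd_ge0 It hg.
apply: (le_trans (ler_norm_sum _ _ _)).
apply: (@le_trans _ _ (\sum_(i < n.+1) C * C' * rho ^+ n * (wgt i * wgt (n - i)))).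
  apply: ler_sum => i _; rewrite normrM.
  have iN : (i <= n)%N by rewrite -ltnS.
  apply: (le_trans (ler_pM (normr_ge0 _) (normr_ge0 _)
     (hf i t (leq_trans iN nN) It) (hg (n - i)%N t (leq_trans (leq_subr _ _) nN) It))).
  have -> : rho ^+ n = rho ^+ i * rho ^+ (n - i) by rewrite -exprD subnKC.
  by rewrite le_eqVlt; apply/orP; left; apply/eqP; ring.
rewrite -mulr_sumr; have := wgt_conv n.
move=> /(ler_wpM2l (_ : 0 <= C * C' * rho ^+ n)) h.
apply: le_trans (h _) _; first by rewrite !mulr_ge0 // exprn_ge0.
by rewrite le_eqVlt; apply/orP; left; apply/eqP; ring.
Qed.

Lemma jbnd_cst N (c rho : R) : 0 <= rho -> jbnd N `|c| rho (fun _ => c).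
Proof.
move=> r0 [|n] t _ It; first by rewrite jet0 /wgt expr1n invr1 !mulr1.
have -> : jet (fun _ : R => c) n.+1 t = 0.
  rewrite /jet derive1Sn; have -> : derive1 (fun _ : R => c) = (fun _ => 0).
    by apply/funext => y; rewrite derive1_cst.
  elim: n {It} => [|n IH]; first by rewrite mul0r.
  apply/eqP; rewrite mulf_eq0; apply/orP; left; move: IH.
  rewrite derive1Sn; have -> : derive1 (fun _ : R => 0) = (fun _ : R => 0 : R).
    by apply/funext => y; rewrite derive1_cst.
  by move=> /eqP; rewrite mulf_eq0 invr_eq0 (negbTE (fact_neq0 _)) orbF.
by rewrite normr0 !mulr_ge0 // ?exprn_ge0 // ltW // wgt_gt0.
Qed.

End Bounds.
End Jets.

(** * Taylor remainders and analyticity *)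

Section Gevrey.
Context {R : realType}.
Implicit Types (U I D : set R) (f g : R -> R).

Lemma isdXn g n (x b : R) : is_derive x 1 g b ->
  is_derive x 1 (fun y => g y ^+ n.+1) (n.+1%:R * g x ^+ n * b).
Proof. by move=> gb; exact: (isd_comp (f := fun z => z ^+ n.+1) (isdX n (g x)) gb). Qed.

(** Both [k - h] and [k + h] are monotone. Unlike in [mvt_bound], the majorant of the derivative may
    vary, as the powers in Taylor remainders require. *)
Lemma mvt_compare (h k dk : R -> R) (a b : R) : a <= b ->
  (forall x, a <= x <= b -> is_derive x 1 k (dk x)) ->
  (forall x, a <= x <= b -> derivable h x 1 /\ `|derive1 h x| <= dk x) ->
  `|h b - h a| <= k b - k a.
Proof.
move=> ab kd hd.
have itvE x : x \in `[a, b]%R -> a <= x <= b by rewrite in_itv.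
have ooE x : x \in `]a, b[%R -> a <= x <= b.
  by rewrite in_itv /= => /andP[/ltW -> /ltW].
have mono (g dg : R -> R) : (forall x, a <= x <= b -> is_derive x 1 g (dg x)) ->
    (forall x, a <= x <= b -> 0 <= dg x) -> g a <= g b.
  move=> gd dg0; apply: (@ger0_derive1_le_cc R g a b).
  - by move=> x /ooE xab; have [] := gd x xab.
  - by move=> x /ooE xab; rewrite (is_derive1P (gd x xab)); exact: dg0.
  - by apply: derivable_within_continuous => x /itvE xab; have [] := gd x xab.
  - by rewrite in_itv /= lexx.
  - by rewrite in_itv /= lexx andbT.
  - exact: ab.
have hd' x : a <= x <= b -> is_derive x 1 h (derive1 h x).
  by move=> /hd [dh _]; rewrite derive1E; exact: derivableP.
have H1 : k a - h a <= k b - h b.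
  apply: (mono (fun x => k x - h x) (fun x => dk x - derive1 h x)) => x xab.
    by apply: isdB; [exact: kd|exact: hd'].
  by have [_] := hd x xab; rewrite ler_norml => /andP[]; lra.
have H2 : k a + h a <= k b + h b.
  apply: (mono (fun x => k x + h x) (fun x => dk x + derive1 h x)) => x xab.
    by apply: isdD; [exact: kd|exact: hd'].
  by have [_] := hd x xab; rewrite ler_norml => /andP[]; lra.
by rewrite ler_norml; lra.
Qed.

Definition taylor f (x : R) n t := \sum_(k < n) jet f k x * (t - x) ^+ k.

Lemma is_derive_taylor f (x : R) n (t : R) :
  is_derive t 1 (taylor f x n.+1) (taylor (derive1 f) x n t).
Proof.
elim: n => [|n IH].
  have -> : taylor f x 1 = (fun=> jet f 0 x).
    by apply/funext => y; rewrite /taylor big_ord1 expr0 mulr1.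
  by rewrite /taylor big_ord0; exact: isd_cst.
have -> : taylor f x n.+2 = (fun y => taylor f x n.+1 y + jet f n.+1 x * (y - x) ^+ n.+1).
  by apply/funext => y; rewrite /taylor big_ord_recr.
have Hx : is_derive t 1 (fun y : R => y - x) 1.
  by apply: isd_eq (isdB (isd_id t) (isd_cst t x)) _; rewrite subr0.
apply: isd_eq (isdD IH (isdZ _ (isdXn n Hx))) _.
by rewrite [in RHS]/taylor big_ord_recr /= jet_derive; congr (_ + _); ring.
Qed.

Lemma mulr_fact_cancel n (a p : R) : a / n.+1`!%:R * (n.+1%:R * p) = a / n`!%:R * p.
Proof.
rewrite factS natrM invfM -!mulrA; congr (_ * _); rewrite mulrCA; congr (_ * _).
by rewrite mulrA mulVf ?mul1r // natr_neq0.
Qed.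

(** Induction on [n]: the derivative of the remainder of [f] is the remainder of [f'] one order
    lower, and its bound is integrated from [x]. The two sides of [x] are treated apart to avoid
    differentiating [|t - x|]. *)
Lemma taylor_bound U f (x t : R) n M : open U -> smooth U f ->
  (forall s, Num.min x t <= s <= Num.max x t -> U s /\ `|derive1n n f s| <= M) ->
  `|f t - taylor f x n t| <= M / n`!%:R * `|t - x| ^+ n.
Proof.
move=> oU; elim: n f t => [|n IH] f t sf H.
  rewrite /taylor big_ord0 subr0 expr0 mulr1 fact0 divr1.
  by have [|_] := H t; rewrite // ge_min le_max !lexx !orbT.
have sf' := smooth1_derive oU sf.
pose h s := f s - taylor f x n.+1 s.
have hx : h x = 0.
  rewrite /h /taylor big_ord_recl /= expr0 mulr1 jet0 big1 ?addr0 ?subrr // => i _.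
  by rewrite expr0n /= mulr0.
have step s : Num.min x t <= s <= Num.max x t ->
    is_derive s 1 h (derive1 f s - taylor (derive1 f) x n s) /\
    `|derive1 f s - taylor (derive1 f) x n s| <= M / n`!%:R * `|s - x| ^+ n.
  move=> sxt; split.
    by apply: isdB (is_derive_taylor _ _ _ _); apply: smooth1_is_derive sf _; have [] := H s sxt.
  apply: IH => // y yxs; rewrite -derive1Sn; apply: H.
  move: sxt yxs => /andP[s1 s2] /andP[y1 y2]; apply/andP; split.
    by apply: le_trans y1; rewrite le_min s1 ge_min lexx.
  by apply: (le_trans y2); rewrite ge_max s2 le_max lexx.
have -> : f t - taylor f x n.+1 t = h t - h x by rewrite hx subr0.
have [xt|tx'] := leP x t.
  rewrite min_l // max_r // in step.
  pose k s := M / n.+1`!%:R * (s - x) ^+ n.+1.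
  have -> : M / n.+1`!%:R * `|t - x| ^+ n.+1 = k t - k x.
    by rewrite /k subrr expr0n mulr0 subr0 ger0_norm // subr_ge0.
  apply: (@mvt_compare _ k (fun s => M / n`!%:R * (s - x) ^+ n) _ _ xt) => s sxt.
    have Hx : is_derive s 1 (fun y : R => y - x) 1.
      by apply: isd_eq (isdB (isd_id s) (isd_cst s x)) _; rewrite subr0.
    apply: isd_eq (isdZ _ (isdXn n Hx)) _.
    by rewrite ?mulrN1 ?mulrN ?opprK ?mulr1 mulr_fact_cancel.
  have [hd hb] := step s sxt; split; first by case: hd.
  rewrite (is_derive1P hd); apply: le_trans hb _.
  by rewrite ger0_norm // subr_ge0; case/andP: sxt.
have tx := ltW tx'; rewrite min_r // max_l // in step.
pose k s := - (M / n.+1`!%:R * (x - s) ^+ n.+1).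
have -> : M / n.+1`!%:R * `|t - x| ^+ n.+1 = k x - k t.
  by rewrite /k subrr expr0n mulr0 opprK oppr0 add0r distrC ger0_norm // subr_ge0.
rewrite distrC; apply: (@mvt_compare _ k (fun s => M / n`!%:R * (x - s) ^+ n) _ _ tx) => s sxt.
  have Hx : is_derive s 1 (fun y : R => x - y) (-1).
    by apply: isd_eq (isdB (isd_cst s x) (isd_id s)) _; rewrite sub0r.
  apply: isd_eq (isdN (isdZ _ (isdXn n Hx))) _.
  by rewrite ?mulrN1 ?mulrN ?opprK ?mulr1 mulr_fact_cancel.
have [hd hb] := step s sxt; split; first by case: hd.
rewrite (is_derive1P hd); apply: le_trans hb _.
by rewrite distrC ger0_norm // subr_ge0; case/andP: sxt.
Qed.

Definition near_in D (x r : R) : set R := [set t | D t /\ `|t - x| < r].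

(* For smooth functions this amounts to analyticity at [x] relative to [D]. *)
Definition gevrey D (x : R) f := exists (r C rho : R), [/\ 0 < r, 0 <= C, 1 <= rho &
  forall N, jbnd (near_in D x r) N C rho f].

(* Factors [n.+1] are absorbed by doubling [rho]. *)
Lemma leqS_exp2 n : n.+1%:R <= 2 ^+ n :> R.
Proof. by rewrite -natrX ler_nat ltn_expl. Qed.

Lemma jbnd_near D (x r r' C rho : R) N f : r' <= r ->
  jbnd (near_in D x r) N C rho f -> jbnd (near_in D x r') N C rho f.
Proof. by move=> rr h n t nN [Dt tx]; apply: h nN _; split=> //; exact: lt_le_trans rr. Qed.

Lemma gevrey_analytic U D (x : R) f : open U -> D `<=` U -> smooth U f ->
  (forall s t u, D s -> D t -> s <= u <= t -> D u) -> D x -> gevrey D x f ->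
  exists2 r : R, 0 < r & exists c : nat -> R, forall t, D t -> `|t - x| < r ->
      pseries c (t - x) @ \oo --> f t.
Proof.
move=> oU DU sf cD Dx [r [C [rho [r0 C0 rho1 H]]]].
have rho0 : 0 < rho by apply: lt_le_trans rho1.
(* Within this radius [|t - x| * rho <= 2^-1], so the [n]-th Taylor remainder is at most
   [C * 2^-1 ^+ n]. *)
pose r' := Num.min r (2 * rho)^-1.
exists r'; first by rewrite lt_min r0 invr_gt0 mulr_gt0.
exists (fun n => jet f n x) => t Dt; rewrite lt_min => /andP[tr trho].
have B n : `|f t - taylor f x n t| <= C * 2^-1 ^+ n.
  apply: le_trans (_ : C * rho ^+ n * wgt n * `|t - x| ^+ n <= _); last first.
    rewrite -!mulrA ler_wpM2l // mulrCA mulrC.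
    apply: le_trans (_ : 1 * (`|t - x| * rho) ^+ n <= _).
      rewrite exprMn (mulrC (rho ^+ n)) mulrC; apply: ler_pM => //.
      - exact/ltW/wgt_gt0.
      - by rewrite mulr_ge0 // exprn_ge0 // ltW.
      - exact: wgt_le1.
    rewrite mul1r lerXn2r ?nnegrE ?mulr_ge0 ?(ltW rho0) //.
    rewrite -ler_pdivlMr //; apply: le_trans (ltW trho) _.
    by rewrite invfM.
  have := @taylor_bound U f x t n (C * rho ^+ n * wgt n * n`!%:R) oU sf.
  rewrite mulfK ?fact_neq0 //; apply=> s sxt.
  have Ds : D s.
    by move: sxt; have [_|_] := leP x t; apply: cD.
  have sx : `|s - x| < r.
    apply: le_lt_trans tr; move: sxt; have [xt|tx] := leP x t => /andP[s1 s2].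
      by rewrite !ger0_norm ?subr_ge0 //; lra.
    by rewrite !ler0_norm ?subr_le0 // ?(ltW tx) //; lra.
  split; first exact: DU.
  have fp : 0 < n`!%:R :> R by rewrite ltr0n fact_gt0.
  by have := H n n s (leqnn n) (conj Ds sx); rewrite /jet normrM normfV (gtr0_norm fp) ler_pdivrMr.
apply/cvgrPdist_le => e e0.
have : C * 2^-1 ^+ n @[n --> \oo] --> C * 0.
  by apply: cvgM; [exact: cvg_cst|apply: cvg_expr; rewrite ger0_norm; lra].
rewrite mulr0 => /cvgrPdist_le /(_ e e0); apply: filterS => n.
rewrite sub0r normrN ger0_norm ?mulr_ge0 ?exprn_ge0 // => hn.
by apply: le_trans hn; have := B n; rewrite /taylor /pseries /series /= big_mkord.
Qed.

End Gevrey.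

(** * Stability of the derivative bounds *)

Section GevreyClosure.
Context {R : realType}.
Implicit Types (f g : R -> R).

Lemma continuous_ball (f : R -> R) (x e : R) : {for x, continuous f} -> 0 < e ->
  exists2 r : R, 0 < r & forall t, `|t - x| < r -> `|f t - f x| < e.
Proof.
move=> fx e0; have /cvgrPdist_lt /(_ e e0) := fx.
move=> /nbhs_ballP[r /= r0 H]; exists r => // t tx.
by rewrite distrC; apply: H; rewrite /ball /= distrC.
Qed.

Variables (U D : set R) (x : R).
Hypotheses (oU : open U) (DU : D `<=` U) (Dx : D x).
Local Notation near r := (near_in D x r).

Let nearU r : near r `<=` U.
Proof. by move=> t [/DU]. Qed.

(** The constant [C] survives any smaller radius and any larger rate, so finitely many functions can
    be brought to a common radius, constant and rate before being combined. *)
Lemma gevreyP f : gevrey D x f <-> exists (r0 C rho0 : R), [/\ 0 < r0, 0 < C, 1 <= rho0 &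
  forall r rho N, r <= r0 -> rho0 <= rho -> jbnd (near r) N C rho f].
Proof.
split=> [[r [C [rho [r0 C0 rho1 H]]]]|[r [C [rho [r0 C0 rho1 H]]]]].
  exists r, (C + 1), rho; split => //; first by rewrite ltr_wpDl.
  move=> r' rho' N rr rr'; apply: jbnd_near rr _; apply: jbndW (H N).
    by rewrite C0 lerDl ler01.
  by rewrite rr' (le_trans _ rho1).
by exists r, C, rho; split => // [|N]; [exact: ltW|exact: H].
Qed.

Lemma gevrey_ext f g : (forall y, U y -> f y = g y) -> gevrey D x f -> gevrey D x g.
Proof.
move=> fg [r [C [rho [r0 C0 rho1 H]]]]; exists r, C, rho; split => // N n t nN It.
by rewrite -(jet_ext_open n oU (nearU It) fg); exact: H It.
Qed.

Lemma gevrey2 f g : gevrey D x f -> gevrey D x g ->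
  exists (r0 C rho0 : R), [/\ 0 < r0, 0 < C, 1 <= rho0 &
  forall r rho N, r <= r0 -> rho0 <= rho ->
    jbnd (near r) N C rho f /\ jbnd (near r) N C rho g].
Proof.
move=> /gevreyP[r [C [rho [r0 C0 rho1 H]]]] /gevreyP[r' [C' [rho' [r0' C0' rho1' H']]]].
exists (Num.min r r'), (C + C'), (Num.max rho rho'); split.
- by rewrite lt_min r0.
- exact: addr_gt0.
- by rewrite le_max rho1.
move=> s rh N; rewrite le_min ge_max => /andP[s1 s2] /andP[h1 h2].
split.
  by apply: jbndW (H s rh N s1 h1); apply/andP; split; lra.
by apply: jbndW (H' s rh N s2 h2); apply/andP; split; lra.
Qed.

Lemma gevreyD f g : smooth U f -> smooth U g -> gevrey D x f -> gevrey D x g ->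
  gevrey D x (fun y => f y + g y).
Proof.
move=> sf sg gf gg; have [r [C [rho [r0 C0 rho1 H]]]] := gevrey2 gf gg.
have C0' := ltW C0; exists r, (C + C), rho; split=> // [|N]; first by rewrite addr_ge0.
have [h1 h2] := H r rho N (lexx _) (lexx _).
exact: (jbndD oU (@nearU r)).
Qed.

Lemma gevreyM f g : smooth U f -> smooth U g -> gevrey D x f -> gevrey D x g ->
  gevrey D x (fun y => f y * g y).
Proof.
move=> sf sg gf gg; have [r [C [rho [r0 C0 rho1 H]]]] := gevrey2 gf gg.
have C0' := ltW C0; exists r, (8 * C * C), rho; split=> // [|N]; first by rewrite !mulr_ge0.
have [h1 h2] := H r rho N (lexx _) (lexx _).
by apply: (jbndM oU (@nearU r)) => //; apply: le_trans rho1.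
Qed.

Lemma gevrey_cst (c : R) : gevrey D x (fun _ => c).
Proof.
by exists 1, `|c|, 1; split=> // N; apply: jbnd_cst.
Qed.

Lemma gevreyZ k f : smooth U f -> gevrey D x f -> gevrey D x (fun y => k * f y).
Proof.
by move=> sf gf; apply: gevreyM => //; [exact: smooth_cst|exact: gevrey_cst].
Qed.

Lemma gevreyN f : smooth U f -> gevrey D x f -> gevrey D x (fun y => - f y).
Proof.
by move=> sf gf; apply: (gevrey_ext (f := fun y => -1 * f y)) => [y _|]; [rewrite mulN1r|exact: gevreyZ].
Qed.

Lemma gevreyB f g : smooth U f -> smooth U g -> gevrey D x f -> gevrey D x g ->
  gevrey D x (fun y => f y - g y).
Proof.
by move=> sf sg gf gg; apply: gevreyD => //; [exact: smoothN|exact: gevreyN].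
Qed.

(* Shared by differentiation and division by [t]: both shift the derivatives by one. *)
Lemma gevrey_shift f g (r0 : R) : 0 < r0 -> gevrey D x f ->
  (forall n t (r M : R), r <= r0 -> near r t ->
     (forall s, near r s -> `|derive1n n.+1 f s| <= M) -> `|derive1n n g t| <= M) ->
  gevrey D x g.
Proof.
move=> r00 /gevreyP [r [C [rho [r_gt0 C0 rho1 H]]]] fg.
have rho0 : 0 <= rho by apply: le_trans rho1.
pose r1 := Num.min r r0.
exists r1, (C * rho), (2 * rho); split.
- by rewrite lt_min r_gt0.
- by rewrite mulr_ge0 // ltW.
- by lra.
move=> N n t nN tr.
have r1r : r1 <= r by rewrite ge_min lexx.
have fp m : 0 < m`!%:R :> R by rewrite ltr0n fact_gt0.
have := @fg n t r1 (C * rho ^+ n.+1 * wgt n.+1 * n.+1`!%:R).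
have -> : r1 <= r0 by rewrite ge_min lexx orbT.
move=> /(_ isT tr); rewrite /jet normrM normfV (gtr0_norm (fp n)) ler_pdivrMr // => h.
apply: (le_trans (h _)).
  move=> s sr; have := H r1 rho n.+1 r1r (lexx _) n.+1 s (leqnn _) sr.
  by rewrite /jet normrM normfV (gtr0_norm (fp _)) ler_pdivrMr.
rewrite factS natrM exprS exprMn mulrA ler_pM2r //.
have C0' := ltW C0; have p0 := exprn_ge0 n rho0.
have -> : C * (rho * rho ^+ n) * wgt n.+1 * n.+1%:R = C * rho * rho ^+ n * (n.+1%:R * wgt n.+1) by ring.
have -> : C * rho * (2 ^+ n * rho ^+ n) * wgt n = C * rho * rho ^+ n * (2 ^+ n * wgt n) by ring.
rewrite ler_wpM2l ?mulr_ge0 //; apply: ler_pM => //.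
- exact/ltW/wgt_gt0.
- exact: leqS_exp2.
- exact: wgt_decr.
Qed.

Lemma gevrey_derive f : gevrey D x f -> gevrey D x (derive1 f).
Proof.
move=> gf; apply: (gevrey_shift (@ltr01 R) gf) => n t r M _ tr H.
by rewrite -derive1Sn; exact: H.
Qed.

(** Bootstrap in [N]: a bound [M] on the derivatives [y'] at order [N] gives, by
    [wgt N <= 4 * wgt N.+1], the constant [4 * M / rho] for [y] at order [N.+1], which is at most
    [C] once [rho >= 4 * M / C]. It is essential that [M] depends on neither [rho] nor [N]. *)
Lemma gevrey_ode (K : Type) (y : K -> R -> R) (r C M rho0 : R) :
  0 < r -> 0 < C -> 0 <= M -> 1 <= rho0 ->
  (forall k t, near r t -> `|y k t| <= C) ->
  (forall rho N, rho0 <= rho -> (forall k, jbnd (near r) N C rho (y k)) ->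
     forall k, jbnd (near r) N M rho (derive1 (y k))) ->
  forall k, gevrey D x (y k).
Proof.
move=> r0 C0 M0 rho1 yC H.
pose rho := Num.max rho0 (4 * M / C).
have rr : rho0 <= rho by rewrite le_max lexx.
have rho_ge0 : 0 <= rho by apply: le_trans rr; apply: le_trans rho1.
have MC : 4 * M <= C * rho by rewrite (mulrC C) -ler_pdivrMr // /rho le_max lexx orbT.
have HN N : forall k, jbnd (near r) N C rho (y k).
  elim: N => [|N IH] k n t.
    rewrite leqn0 => /eqP -> tr; rewrite jet0 expr0 mulr1 /wgt expr1n invr1 mulr1.
    exact: yC.
  rewrite leq_eqVlt => /orP[/eqP ->|] tr; last exact: IH.
  have := H rho N rr IH k N t (leqnn N) tr.
  rewrite jet_derive normrM ger0_norm // => h.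
  rewrite -(ler_pM2l (_ : 0 < N.+1%:R)) ?ltr0n //; apply: (le_trans h).
  apply: (@le_trans _ _ (4 * M * rho ^+ N * wgt N.+1)).
    rewrite -!mulrA (mulrCA 4) ler_wpM2l // (mulrCA 4) ler_wpM2l ?exprn_ge0 //.
    exact: wgtS.
  rewrite exprS !mulrA ler_pM2r ?wgt_gt0 // ler_wpM2r ?exprn_ge0 //.
  apply: (le_trans MC); by rewrite -mulrA ler_peMl ?(ler1n R) // mulr_ge0 // ltW.
by move=> k; exists r, C, rho; split; [|exact: ltW|exact: le_trans rr|move=> N; exact: HN].
Qed.

(** The inverse [g] solves [g' = - f' g^2], so [gevrey_ode] applies, with the products estimated by
    [jbndM]. *)
Lemma gevreyV f : smooth U f -> (forall y, U y -> f y != 0) -> gevrey D x f ->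
  gevrey D x (fun y => (f y)^-1).
Proof.
move=> sf f0 gf; have sV := smoothV oU f0 sf.
have cV := smooth_continuous sV (DU Dx).
have [r [C [rho [r0 C0 rho1 H]]]] := (gevreyP _).1 (gevrey_derive gf).
have [r' r'0 H'] := continuous_ball cV ltr01.
pose r1 := Num.min r r'; pose C1 := `|(f x)^-1| + 1.
have r1r : r1 <= r by rewrite ge_min lexx.
have C10 : 0 < C1 by rewrite ltr_wpDl.
have r10 : 0 < r1 by rewrite lt_min r0.
have C00 := ltW C0; have C100 := ltW C10.
apply: (@gevrey_ode unit (fun _ y => (f y)^-1) r1 C1 (8 * C * (8 * C1 * C1)) rho _ _ _ _ _ _ tt) => //.
- by rewrite !mulr_ge0.
- move=> _ t [Dt]; rewrite lt_min => /andP[_ tr'].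
  rewrite -[(f t)^-1](subrK (f x)^-1); apply: (le_trans (ler_normD _ _)).
  by rewrite addrC lerD2l ltW // H'.
- move=> rh N hrh hy _; have {}hy := hy tt.
  have rh0 : 0 <= rh by apply: le_trans hrh; apply: le_trans rho1.
  have sf' := smooth1_derive oU sf.
  have E y : U y -> - 1 * (derive1 f y * ((f y)^-1 * (f y)^-1)) = derive1 (fun y => (f y)^-1) y.
    move=> Uy; rewrite (is_derive1P (isdV (f0 y Uy) (smooth1_is_derive sf Uy))).
    by rewrite mulN1r -mulNr -invfM expr2.
  move=> n t nN It; rewrite -(jet_ext_open n oU (nearU It) E).
  have b1 := H r1 rh N r1r hrh.
  have b2 := jbndM oU (@nearU r1) rh0 sV sV hy hy.
  have b3 := jbndM oU (@nearU r1) rh0 sf' (smoothM oU sV sV) b1 b2.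
  have b4 := jbndZ oU (@nearU r1) (-1) (smoothM oU sf' (smoothM oU sV sV)) b3.
  by have := b4 n t nN It; rewrite normrN1 mul1r.
Qed.

Lemma gevrey_id : gevrey D x (fun y => y).
Proof.
have [r r0 H] := continuous_ball (smooth_continuous (smooth_id openT) (I : [set: R] x)) ltr01.
apply: (@gevrey_ode unit (fun _ y => y) r (`|x| + 1) 1 1 _ _ _ _ _ _ tt) => //.
- move=> _ t [_ tr]; rewrite -[t](subrK x); apply: (le_trans (ler_normD _ _)).
  by rewrite addrC lerD2l ltW // H.
- move=> rho N rho1 _ _.
  have -> : derive1 (fun y : R => y) = (fun _ => 1) by apply/funext => y; exact: derive1_id.
  by rewrite -[X in jbnd _ _ X](@normr1 R); apply: jbnd_cst; apply: le_trans rho1.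
Qed.

End GevreyClosure.

Section GevreyQuo.
Context {R : realType}.
Variables (U D : set R) (f : R -> R).
Hypotheses (oU : open U) (DU : D `<=` U) (sf : smooth U f) (f0 : f 0 = 0).
Hypothesis bU : forall t s : R, U t -> `|s| <= `|t| -> U s.
Hypothesis D0 : D 0.
Hypothesis cD : forall s t u : R, D s -> D t -> s <= u <= t -> D u.

(** At [x = 0] the derivatives of the quotient are means of those of [f], a shift by one order.
    Elsewhere [1 / t] satisfies the bounds, and the radius is cut to [|x|] to keep away from 0. *)
Lemma gevrey_quo (x : R) : D x -> gevrey D x f -> gevrey D x (quo f).
Proof.
move=> Dx gf; have [x0|x0] := eqVneq x 0.
  rewrite x0 in gf *; apply: (gevrey_shift (@ltr01 R) gf) => n t r M _ [Dt tr] H.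
  apply: (derive1n_quo_bound oU sf f0 bU (DU Dt)) => s st; apply: H; split.
    by move: st; have [_|_] := leP 0 t; apply: cD.
  by rewrite subr0 (le_lt_trans (between0_norm st)) // -[t]subr0.
pose U' := U `&` [set t : R | t != 0].
have oU' : open U' by apply: openI => //; exact: open_neq.
pose D' := D `&` [set t : R | t != 0].
have D'U' : D' `<=` U' by move=> t [/DU Ut].
have DD (g : R -> R) : gevrey D' x g -> gevrey D x g.
  move=> [r [C [rho [r0 C0 rho1 H]]]].
  exists (Num.min r `|x|), C, rho; split => //; first by rewrite lt_min r0 normr_gt0.
  move=> N n t nN [Dt]; rewrite lt_min => /andP[tr tx]; apply: (H N) => //; split => //; split => //=.
  by apply/eqP => t0; move: tx; rewrite t0 sub0r normrN ltxx.
have DD' (g : R -> R) : gevrey D x g -> gevrey D' x g.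
  move=> [r [C [rho [r0 C0 rho1 H]]]].
  by exists r, C, rho; split => // N n t nN [[Dt _] tr]; apply: (H N).
have UU' : U' `<=` U by move=> t [].
apply: DD; apply: (gevrey_ext oU' D'U' (f := fun t => f t * t^-1)).
  by move=> y [_ y0]; rewrite quoE.
have sid : smooth U' (fun y : R => y) by exact: smooth_id.
apply: (gevreyM oU' D'U') => //.
- exact: smooth_sub sf.
- by apply: smoothV => // y [].
- exact: DD'.
- by apply: (gevreyV oU' D'U') => //; [move=> y []|exact: gevrey_id].
Qed.

End GevreyQuo.

(** * Analytic solutions of ODEs *)

Section AnalyticGevrey.
Context {R : realType}.

Lemma bin_le_exp2 n m : ('C(n, m) <= 2 ^ n)%N.
Proof.
elim: n m => [|n IH] [|m] //; first by rewrite bin0 expn_gt0.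
by rewrite binS expnS mul2n -addnn leq_add.
Qed.

Lemma fact_add_le m n : (m + n)`!%:R <= 2 ^+ (m + n) * (m`!%:R * n`!%:R) :> R.
Proof.
rewrite -natrX -!natrM ler_nat -(bin_fact (leq_addl m n)) addnK [(n`! * _)%N]mulnC.
by rewrite leq_mul2r bin_le_exp2 orbT.
Qed.

Lemma pseries_geometric_bound (d : nat -> R) (L b y : R) : 0 <= b ->
  (forall m, `|d m| <= L * b ^+ m) -> b * `|y| <= 2^-1 ->
  cvgn (pseries d y) /\ `|limn (pseries d y)| <= 2 * L.
Proof.
move=> b0 H by2.
have L0 : 0 <= L by have := H 0%N; rewrite expr0 mulr1; apply: le_trans.
have h1 : `|2^-1 : R| < 1 by rewrite ger0_norm; lra.
have G := @cvg_geometric_series _ L _ h1.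
have le n : `|d n * y ^+ n| <= geometric L 2^-1 n.
  rewrite normrM normrX /geometric /=.
  apply: (@le_trans _ _ (L * b ^+ n * `|y| ^+ n)); first by rewrite ler_wpM2r ?exprn_ge0.
  rewrite -mulrA -exprMn ler_wpM2l // lerXn2r // ?nnegrE ?mulr_ge0 //.
have cG : cvgn (series (geometric L 2^-1)) by apply/cvg_ex; eexists; exact: G.
have cN : cvgn [normed pseries d y].
  apply: series_le_cvg cG => //= n; apply: le_trans (le n); exact: normr_ge0.
split; first exact: normed_cvg.
apply: (le_trans (lim_series_norm cN)).
apply: (le_trans (lim_series_le cN cG le)).
rewrite (cvg_lim _ G) // (_ : 1 - 2^-1 = 2^-1 :> R); last by lra.
by rewrite invrK mulrC.
Qed.

(** Convergence to [f] is assumed only for [t >= 0], so the derivatives of [f] are identified with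
    the termwise differentiated series at [t > 0], and the bounds are then extended to 0 by
    continuity. *)
Lemma analytic_gevrey (f : R -> R) (x r : R) (c : nat -> R) :
  smooth (setT : set R) f -> 0 <= x -> 0 < r ->
  (forall t, 0 <= t -> `|t - x| < r -> pseries c (t - x) @ \oo --> f t) ->
  gevrey [set t | 0 <= t] x f.
Proof.
move=> sf x0 r0 Hc.
(* Convergence at distance [s], strictly inside [r], bounds the coefficients by a geometric sequence
   of ratio [a = 1 / s]. *)
pose s := r / 2; have s0 : 0 < s by rewrite divr_gt0.
pose a := s^-1; have a0 : 0 < a by rewrite invr_gt0.
have [K K0 cK] : exists2 K : R, 0 < K & forall m, `|c m| <= K * a ^+ m.
  have : cvgn (pseries c s).
    apply/cvg_ex; exists (f (x + s)).
    rewrite -[X in pseries c X](_ : x + s - x = s); last by rewrite addrAC subrr add0r.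
    apply: Hc; first by rewrite addr_ge0 // ltW.
    by rewrite addrAC subrr add0r gtr0_norm // /s; lra.
  move=> /cvg_series_bounded [M [_ HM]].
  exists (Num.max M 0 + 1); first by rewrite ltr_wpDl // le_max lexx orbT.
  move=> m; have /= := HM (Num.max M 0 + 1) _ m I.
  rewrite normrM normrX (gtr0_norm s0) => h.
  rewrite /a exprVn ler_pdivlMr ?exprn_gt0 //; apply: h.
  by rewrite (@le_lt_trans _ _ (Num.max M 0)) ?ltrDl // le_max lexx.
pose cn n := iter n (@pseries_diffs R) c.
have cnE n m : cn n m * m`!%:R = c (m + n)%N * (m + n)`!%:R.
  elim: n m => [|n IH] m; first by rewrite addn0.
  have -> : cn n.+1 m = m.+1%:R * cn n m.+1 by [].
  rewrite addnS -addSn -IH factS natrM.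
  by rewrite [RHS]mulrCA mulrA.
have cnK n m : `|cn n m| <= (K * n`!%:R * (2 * a) ^+ n) * (2 * a) ^+ m.
  have fm : 0 < m`!%:R :> R by rewrite ltr0n fact_gt0.
  rewrite -(ler_pM2r fm) -{1}(gtr0_norm fm) -normrM cnE normrM [X in _ * X]ger0_norm //.
  apply: (le_trans (ler_pM (normr_ge0 _) (ler0n _ _) (cK _) (fact_add_le _ _))).
  rewrite !exprMn !exprD le_eqVlt; apply/orP; left; apply/eqP; ring.
pose y0 := (4 * a)^-1; have y00 : 0 < y0 by rewrite invr_gt0 mulr_gt0.
have a20 : 0 <= 2 * a by rewrite mulr_ge0 // ltW.
have y0E : 2 * a * y0 = 2^-1 by rewrite /y0; field; rewrite gt_eqF.
have HS n y : `|y| <= y0 -> cvgn (pseries (cn n) y) /\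
    `|limn (pseries (cn n) y)| <= 2 * (K * n`!%:R * (2 * a) ^+ n).
  move=> yy0; apply: (pseries_geometric_bound a20 (cnK n)).
  by rewrite -y0E ler_wpM2l.
pose S n (t : R) : R := limn (pseries (cn n) (t - x)).
have dS n (t : R) : `|t - x| < y0 -> is_derive t 1 (S n) (S n.+1 t).
  move=> ty; have hy : `|y0| <= y0 by rewrite gtr0_norm.
  have H : is_derive (t - x) (1 : R) (fun z => limn (pseries (cn n) z)) (S n.+1 t).
    apply: (@pseries_snd_diffs _ _ y0); last by rewrite (gtr0_norm y00).
    - exact: (HS n y0 hy).1.
    - exact: (HS n.+1 y0 hy).1.
    - exact: (HS n.+2 y0 hy).1.
  have Hx : is_derive t 1 (fun y : R => y - x) 1.
    by apply: isd_eq (isdB (isd_id t) (isd_cst t x)) _; rewrite subr0.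
  have HH := isd_comp (f := fun z => limn (pseries (cn n) z)) (g := fun y => y - x) H Hx.
  by apply: isd_eq HH _; rewrite mulr1.
pose r1 := Num.min r y0; have r10 : 0 < r1 by rewrite lt_min r0.
pose O := [set t : R | 0 < t] `&` ball x r1.
have oO : open O by apply: openI; [exact: open_gt|exact: ball_open].
have fS n t : O t -> derive1n n f t = S n t.
  elim: n t => [|n IH] t [t0].
    rewrite /ball /= distrC lt_min => /andP[tr ty].
    by apply/esym/cvg_lim => //; apply: Hc; rewrite // ltW.
  move=> tx; rewrite derive1nS (derive1_ext_open oO (conj t0 tx) IH).
  by apply/is_derive1P/dS; move: tx; rewrite /ball /= distrC lt_min => /andP[].
have B n t : 0 < t -> `|t - x| < r1 -> `|derive1n n f t| <= 2 * (K * n`!%:R * (2 * a) ^+ n).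
  move=> t0 tr; rewrite fS; last by split => //; rewrite /ball /= distrC.
  by apply: (HS _ _ _).2; move: tr; rewrite lt_min => /andP[_ /ltW].
have B0 n t : 0 <= t -> `|t - x| < r1 -> `|derive1n n f t| <= 2 * (K * n`!%:R * (2 * a) ^+ n).
  rewrite le_eqVlt => /orP[/eqP <-|]; last exact: B.
  rewrite sub0r normrN => xr; rewrite leNgt; apply/negP => h.
  (* A failure at 0 would persist at some small [t1 > 0], against [B]. *)
  set M := 2 * _ in h; have e0 : 0 < `|derive1n n f 0| - M by rewrite subr_gt0.
  have c0 : {for (0 : R), continuous (derive1n n f)}.
    exact: smooth_continuous (smooth1_deriven n openT sf) (I : [set: R] 0).
  have [r2 r20 Hr2] := continuous_ball c0 e0.
  pose t1 := Num.min (r2 / 2) ((r1 - `|x|) / 2).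
  have t10 : 0 < t1 by rewrite lt_min !divr_gt0 // subr_gt0.
  have t1r : t1 <= r2 / 2 by rewrite ge_min lexx.
  have t1x : t1 <= (r1 - `|x|) / 2 by rewrite ge_min lexx orbT.
  have h1 : `|t1 - x| < r1.
    by apply: (le_lt_trans (ler_normB _ _)); rewrite gtr0_norm //; lra.
  have h2 := B n t1 t10 h1; rewrite -/M in h2.
  have := Hr2 t1; rewrite subr0 gtr0_norm // => /(_ _) h3.
  have {}h3 : `|derive1n n f t1 - derive1n n f 0| < `|derive1n n f 0| - M by apply: h3; lra.
  have := ler_normB (derive1n n f t1) (derive1n n f t1 - derive1n n f 0).
  by rewrite opprB addrC subrK; lra.
(* The rate [8 * a] is [4 * (2 * a)]: the factor [4 ^+ n] pays for the weight, since
   [(n + 1)^2 <= 4 ^+ n]. *)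
exists r1, (2 * K), (Num.max 1 (8 * a)); split => //.
- by rewrite mulr_ge0 // ltW.
- by rewrite le_max lexx.
move=> N n t nN [t0 tx]; have fn : 0 < n`!%:R :> R by rewrite ltr0n fact_gt0.
rewrite /jet normrM normfV (gtr0_norm fn) ler_pdivrMr //; apply: (le_trans (B0 n t t0 tx)).
have K0' := ltW K0; have a0' := ltW a0.
have -> : 2 * (K * n`!%:R * (2 * a) ^+ n) = 2 * K * (2 * a) ^+ n * n`!%:R by ring.
rewrite ler_pM2r // -!mulrA ler_wpM2l // ler_wpM2l //.
apply: (@le_trans _ _ ((8 * a) ^+ n * wgt n)); last first.
  by rewrite ler_wpM2r ?(ltW (wgt_gt0 n)) // lerXn2r ?nnegrE ?le_max ?lexx ?orbT ?ler01 ?mulr_ge0.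
have -> : 8 * a = 4 * (2 * a) by ring.
rewrite [in leRHS]exprMn mulrAC ler_peMl ?exprn_ge0 //.
rewrite /wgt ler_pdivlMr ?exprn_gt0 // mul1r (_ : 4 = 2 ^+ 2); last by ring.
rewrite -exprM mulnC exprM lerXn2r ?nnegrE ?exprn_ge0 //; exact: leqS_exp2.
Qed.

End AnalyticGevrey.

(** * Derivative bounds at a singular point *)

Section SingularODE.
Context {R : realType}.

Lemma max_left_derive (z : R -> R) (t d : R) : 0 < t -> is_derive t 1 z d ->
  (forall s, 0 <= s <= t -> z s <= z t) -> 0 <= d.
Proof.
move=> t0 /is_derive_near_bound H zt; rewrite leNgt; apply/negP => d0.
have [r r0 {}H] := H (- d / 2) ltac:(lra).
pose h := Num.min t (r / 2); have h0 : 0 < h by rewrite lt_min t0 divr_gt0.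
have ht : h <= t by rewrite ge_min lexx.
have hr : h <= r / 2 by rewrite ge_min lexx orbT.
have := H (- h); rewrite normrN gtr0_norm // => /(_ ltac:(lra)).
rewrite ler_norml => /andP[h1 _].
have := zt (t - h) ltac:(lra).
nra.
Qed.

Lemma derive1n_mul_id (f : R -> R) n (t : R) : smooth (setT : set R) f ->
  derive1n n (fun s => s * f s) t = t * derive1n n f t + n%:R * derive1n n.-1 f t.
Proof.
elim: n f t => [|n IH] f t sf; first by rewrite mul0r addr0.
rewrite derive1nS (_ : derive1n n _ = fun s => s * derive1n n f s + n%:R * derive1n n.-1 f s); last first.
  by apply/funext => s; exact: IH.
have D m : is_derive t 1 (derive1n m f) (derive1n m.+1 f t).
  rewrite derive1nS; exact: smooth1_is_derive (smooth1_deriven m openT sf) (I : [set: R] t).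
rewrite (is_derive1P (isdD (isdM (isd_id t) (D n)) (isdZ n%:R (D n.-1)))) mul1r.
case: n {IH} => [|n] /=; first by rewrite !mul0r mul1r addr0 addrC.
by rewrite -[in RHS]natr1 mulrDl mul1r addrC addrA addrC; congr (_ + _); rewrite addrC.
Qed.

Lemma jet_mul_id (f : R -> R) n (t : R) : smooth (setT : set R) f ->
  jet (fun s => s * f s) n.+1 t = t * jet f n.+1 t + jet f n t.
Proof.
move=> sf; rewrite /jet derive1n_mul_id // mulrDl mulrA; congr (_ + _).
by have := mulr_fact_cancel n (derive1n n f t) 1; rewrite !mulr1 => <-; rewrite [RHS]mulrC mulrA.
Qed.

Lemma is_derive_jet (f : R -> R) n (t : R) : smooth (setT : set R) f ->
  is_derive t 1 (jet f n) (n.+1%:R * jet f n.+1 t).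
Proof.
move=> sf.
have H : is_derive t 1 (derive1n n f) (derive1n n.+1 f t).
  rewrite derive1nS; exact: smooth1_is_derive (smooth1_deriven n openT sf) (I : [set: R] t).
have -> : jet f n = fun s => n`!%:R^-1 * derive1n n f s.
  by apply/funext => s; rewrite /jet mulrC.
apply: isd_eq (isdZ _ H) _.
have := mulr_fact_cancel n (derive1n n.+1 f t) 1; rewrite !mulr1 => E.
by rewrite mulrC -E /jet mulrC.
Qed.

Lemma ex_argmax3 (Z : 'I_3 -> R) : exists i, forall j, Z j <= Z i.
Proof.
case: (@Order.TotalTheory.arg_maxP _ _ 'I_3 ord0 xpredT Z isT) => i _ H.
by exists i => j; exact: H.
Qed.

(** The neighbours give at most [2 * Z + 2 * Z], compensated by [- 4 * Z], so [n1 * Z] is at most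
    the contribution of the two forcing terms, which is [Z / 2]; this contradicts [1 <= n1]. *)
Let max_principle_arith (c r1 n2 n1 a2 a1 b1 b2 f1 f0 sg Z K : R) :
  c * (n2 * a2) + n1 * a1 = 2 * b1 + 2 * b2 + -4 * a1 + (c * f1 + f0) ->
  sg * a1 = Z -> 0 <= c * (sg * (n2 * a2)) -> sg * b1 <= Z -> sg * b2 <= Z ->
  sg * f1 <= K * Z -> sg * f0 <= Z / 4 -> 1 <= n1 -> 0 < Z ->
  0 <= c -> c <= r1 -> 0 < K -> K * r1 <= 4^-1 -> False.
Proof.
move=> E sa h2 h3 h4 h5 h6 h7 h8 c0 cr K0 Kr.
have E' : c * (sg * (n2 * a2)) + n1 * (sg * a1) =
    2 * (sg * b1) + 2 * (sg * b2) + -4 * (sg * a1) + (c * (sg * f1) + sg * f0).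
  have := congr1 (fun v => sg * v) E; rewrite /= => e.
  transitivity (sg * (c * (n2 * a2) + n1 * a1)); first by ring.
  by rewrite e; ring.
have Kc : c * K <= 4^-1 by rewrite mulrC; apply: le_trans Kr; rewrite ler_pM2l.
have F : c * (sg * f1) <= Z / 4.
  apply: (le_trans (ler_wpM2l c0 h5)); rewrite mulrA mulrC; rewrite ler_pM2l //.
have n1Z : Z <= n1 * Z by rewrite ler_peMl // ltW.
by rewrite sa in E'; lra.
Qed.

(* Maximum principle: at a maximum over [0, r] of the [n]-th derivatives the
   singular operator bounds [n] times the maximum by the regular terms. *)
Lemma gevrey_singular_ode (D : set R) (y F : 'I_3 -> R -> R) (r0 C rho0 K : R) :
  D = [set t | 0 <= t] ->
  (forall i, smooth (setT : set R) (y i)) -> (forall i, smooth (setT : set R) (F i)) ->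
  (forall i t, t * derive1 (y i) t =
     2 * y (i + 1) t + 2 * y (i + 2%:R) t + -4 * y i t + t * F i t) ->
  0 < r0 -> 0 < C -> 1 <= rho0 -> 0 < K ->
  (forall i t, near_in D 0 r0 t -> `|y i t| <= C) ->
  (forall (I : set R), I `<=` near_in D 0 r0 -> forall rho C' N, rho0 <= rho -> C <= C' ->
     (forall i, jbnd I N C' rho (y i)) ->
     forall i, jbnd I N (K * C') rho (F i)) ->
  forall i, gevrey D 0 (y i).
Proof.
move=> DE sy sF ode r00 C0 rho1 K0 yC HF.
(* A small [r1] absorbs the forcing term that carries the factor [t], a large [rho] the one of lower
   order; each is then at most a quarter of the maximum. *)
pose r1 := Num.min (r0 / 2) (4 * K)^-1.
have r10 : 0 < r1 by rewrite lt_min divr_gt0 // invr_gt0 mulr_gt0.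
have r1r : r1 <= r0 / 2 by rewrite ge_min lexx.
have r1K : K * r1 <= 4^-1.
  rewrite mulrC -ler_pdivlMr //; apply: le_trans (_ : (4 * K)^-1 <= _); last by rewrite invfM.
  by rewrite ge_min lexx orbT.
pose rho := Num.max rho0 (16 * K).
have rr : rho0 <= rho by rewrite le_max lexx.
have rhoK : 16 * K <= rho by rewrite le_max lexx orbT.
have rho0' : 0 < rho by apply: lt_le_trans rr; apply: lt_le_trans rho1.
pose I := [set t : R | 0 <= t <= r1].
have In : I `<=` near_in D 0 r0.
  move=> t /= /andP[t0 tr]; split; first by rewrite DE.
  by rewrite subr0 ger0_norm //; lra.
suff HN N i : jbnd I N C rho (y i).
  move=> i; exists r1, C, rho; split => //; [exact: ltW|exact: le_trans rr|].
  move=> N n t nN [Dt]; rewrite subr0 => tr; apply: HN nN _.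
  by move: Dt tr; rewrite DE /= => t0; rewrite ger0_norm // /I /= t0 => /ltW ->.
elim: N i => [|N IH] i n t.
  rewrite leqn0 => /eqP -> tr; rewrite jet0 expr0 mulr1 /wgt expr1n invr1 mulr1.
  exact/yC/In.
rewrite leq_eqVlt => /orP[/eqP -> It|]; last exact: IH.
have /choice[c Hc] : forall j : 'I_3, exists c : R, I c /\
    forall s, I s -> `|jet (y j) N.+1 s| <= `|jet (y j) N.+1 c|.
  move=> j; have [|c] := @EVT_max R (fun s => `|jet (y j) N.+1 s|) 0 r1 (ltW r10).
    apply: continuous_subspaceT => s; apply: cvg_norm.
    have [dj _] := is_derive_jet N.+1 s (sy j).
    exact/differentiable_continuous/derivable1_diffP.
  rewrite in_itv /= => Ic H; exists c; split => // s Is; exact: H.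
have [k Hk] := ex_argmax3 (fun j => `|jet (y j) N.+1 (c j)|).
have [Ick _] := Hc k.
have {Hc}Hk j s : I s -> `|jet (y j) N.+1 s| <= `|jet (y k) N.+1 (c k)|.
  by move=> Is; apply: le_trans (Hk j); have [_] := Hc j; apply.
move: (c k) Ick Hk => {c} c Ic Hk; set Z := `|jet (y k) N.+1 c| in Hk.
apply: (le_trans (Hk i t It)).
set w := rho ^+ N.+1 * wgt N.+1; have w0 : 0 < w by rewrite mulr_gt0 ?exprn_gt0 ?wgt_gt0.
rewrite -mulrA -/w leNgt; apply/negP => CZ.
have Z0 : 0 < Z by apply: le_lt_trans CZ; rewrite mulr_ge0 // ltW.
(* If the bound fails, [Z / w] is an admissible constant above [C], so the hypothesis on [F] applies
   with the maximum itself as scale. *)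
have CC' : C <= Z / w by rewrite ler_pdivlMr // ltW.
have yb j : jbnd I N.+1 (Z / w) rho (y j).
  move=> n' s; rewrite leq_eqVlt => /orP[/eqP ->|nN] Is.
    by rewrite -mulrA -/w divfK ?gt_eqF //; exact: Hk.
  apply: (le_trans (IH j n' s nN Is)).
  by rewrite !ler_pM2r ?wgt_gt0 ?exprn_gt0.
have Fb := HF I In rho (Z / w) N.+1 rr CC' yb k.
have F1 : `|jet (F k) N.+1 c| <= K * Z.
  have := Fb N.+1 c (leqnn _) Ic; rewrite -!mulrA -/w.
  by rewrite mulVf ?gt_eqF // mulr1.
have F2 : `|jet (F k) N c| <= Z / 4.
  apply: (le_trans (Fb N c (leqnSn _) Ic)).
  apply: (@le_trans _ _ (K * (Z / w) * rho ^+ N * (4 * wgt N.+1))).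
    by rewrite ler_wpM2l ?wgtS // !mulr_ge0 ?exprn_ge0 ?invr_ge0 ?ltW.
  have -> : K * (Z / w) * rho ^+ N * (4 * wgt N.+1) = 4 * K * Z / rho.
    rewrite /w exprS; field.
    by rewrite !gt_eqF ?wgt_gt0 ?exprn_gt0.
  by rewrite ler_pdivrMr //; nra.
have sZ (m : R) (f : R -> R) : smooth (setT : set R) f -> smooth (setT : set R) (fun s => m * f s).
  exact: smoothZ openT _ _.
have eqn : c * (N.+2%:R * jet (y k) N.+2 c) + N.+1%:R * jet (y k) N.+1 c =
  2 * jet (y (k + 1)) N.+1 c + 2 * jet (y (k + 2%:R)) N.+1 c + -4 * jet (y k) N.+1 c +
  (c * jet (F k) N.+1 c + jet (F k) N c).
  have sy' := smooth1_derive openT (sy k).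
  have E1 := jet_mul_id N c sy'; rewrite !jet_derive in E1; rewrite -E1.
  have -> : (fun s => s * derive1 (y k) s) = (fun t => 2 * y (k + 1) t + 2 * y (k + 2%:R) t + -4 * y k t + t * F k t).
    by apply/funext => s; exact: ode.
  have T : [set: R] c by [].
  have oT : open [set: R] by exact: openT.
  have s1 := smoothM oT (smooth_id oT) (sF k).
  have s2 := smoothD oT (sZ 2 _ (sy (k + 1))) (sZ 2 _ (sy (k + 2%:R))).
  have s3 := smoothD oT s2 (sZ (-4) _ (sy k)).
  rewrite (jetD oT _ s3 s1 T) (jetD oT _ s2 (sZ (-4) _ (sy k)) T).
  rewrite (jetD oT _ (sZ 2 _ (sy (k + 1))) (sZ 2 _ (sy (k + 2%:R))) T).
  rewrite (jetZ oT 2 _ (sy (k + 1)) T) (jetZ oT 2 _ (sy (k + 2%:R)) T).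
  by rewrite (jetZ oT (-4) _ (sy k) T) (jet_mul_id _ _ (sF k)).
have [c0 cr] := andP Ic.
have [sg [sg1 sgZ]] : exists sg : R, `|sg| = 1 /\ sg * jet (y k) N.+1 c = Z.
  rewrite /Z; have [h|h] := leP 0 (jet (y k) N.+1 c).
    by exists 1; rewrite normr1 mul1r ger0_norm.
  by exists (-1); rewrite normrN1 mulN1r ltr0_norm.
have sgle v : sg * v <= `|v| by rewrite -[leRHS]mul1r -sg1 -normrM ler_norm.
(* At [c = 0] the factor [c] kills the term; elsewhere, including the endpoint [r1], a maximum has
   nonnegative left derivative. *)
have dpos : 0 <= c * (sg * (N.+2%:R * jet (y k) N.+2 c)).
  move: c0; rewrite le_eqVlt => /orP[/eqP <-|c0]; first by rewrite mul0r.
  rewrite mulr_ge0 ?(ltW c0) //.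
  apply: (@max_left_derive (fun s => sg * jet (y k) N.+1 s) c) => //.
    by apply: isdZ; exact: is_derive_jet.
  move=> s /andP[s0 sc]; rewrite sgZ; apply: (le_trans (sgle _)); apply: Hk.
  by rewrite /I /= s0 (le_trans sc).
have N1 : 1 <= N.+1%:R :> R by rewrite ler1n.
have b1 := le_trans (sgle _) (Hk (k + 1) c Ic).
have b2 := le_trans (sgle _) (Hk (k + 2%:R) c Ic).
have b3 := le_trans (sgle _) F1.
have b4 := le_trans (sgle _) F2.
exact: (max_principle_arith eqn sgZ dpos b1 b2 b3 b4 N1 Z0 c0 cr K0 r1K).
Qed.

End SingularODE.

(** * Picard iteration *)

Section Picard.
Context {R : realType}.
Notation mu := (@lebesgue_measure R).

Lemma open_norm_lt (e : R) : open [set s : R | `|s| < e].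
Proof.
rewrite (_ : [set _ | _] = ball (0 : R) e); first exact: ball_open.
by apply/seteqP; split=> s; rewrite /ball /= sub0r normrN.
Qed.

Lemma between_norm (s t u : R) : Num.min t u <= s <= Num.max t u -> `|s - t| <= `|u - t|.
Proof.
have := ler_norm (u - t); have := ler_norm (t - u); rewrite distrC ler_norml.
by case: (leP t u) => tu h1 h2 /andP[h3 h4]; apply/andP; split; lra.
Qed.

Lemma le_geometric_eps (x y K : R) : (forall n, x <= y + K * 2^-1 ^+ n) -> x <= y.
Proof.
move=> H; rewrite leNgt; apply/negP => yx.
have h1 : `|2^-1 : R| < 1 by rewrite ger0_norm; lra.
have : K * 2^-1 ^+ n @[n --> \oo] --> K * 0.
  by apply: cvgM; [exact: cvg_cst|exact: cvg_expr].
rewrite mulr0 => /cvgrPdist_lt /(_ (x - y)); rewrite subr_gt0 => /(_ yx) [n _ Hn].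
have := Hn n (leqnn n); rewrite /= sub0r normrN => h.
by have := H n; have := ler_norm (K * 2^-1 ^+ n); lra.
Qed.

(** A signed integral from 0 to [t]: starting both integrals at [-1] covers either sign of [t] as
    long as [|t| < 1]. *)
Definition prim (g : R -> R) (t : R) : R :=
  (\int[mu]_(s in `[(-1), t]) g s)%R - (\int[mu]_(s in `[(-1), 0%R]) g s)%R.

Lemma prim0 g : prim g 0 = 0.
Proof. exact: subrr. Qed.

Lemma is_derive_prim (g : R -> R) (t : R) : continuous g -> `|t| < 1 ->
  is_derive t 1 (prim g) (g t).
Proof.
move=> cg; rewrite ltr_norml => /andP[t1 t2].
have H : mu.-integrable `[(-1), 1] (EFin \o g).
  by apply: continuous_compact_integrable; [exact: segment_compact|exact: continuous_subspaceT].
have [|d e] := @continuous_FTC1 R g (BLeft (-1)) t 1 t2 H _ (cg t).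
  by [].
have D := derivableP d; rewrite -derive1E e in D.
exact: isd_eq (isdB D (isd_cst t _)) (subr0 _).
Qed.

(* Truncating the time variable makes the Picard integrands globally continuous. *)
Definition clamp (t : R) : R := Num.max (- 2^-1) (Num.min t 2^-1).

Lemma clamp_continuous : continuous clamp.
Proof.
move=> t; apply: (@continuous_max R R (cst (- 2^-1)) (fun t => Num.min t 2^-1)).
  exact: cvg_cst.
by apply: (@continuous_min R R id (cst 2^-1)); [exact: cvg_id|exact: cvg_cst].
Qed.

Lemma clamp_lt1 t : `|clamp t| < 1.
Proof.
rewrite /clamp ltr_norml lt_max gt_max; apply/andP; split; first by apply/orP; left; lra.
by rewrite gt_min; apply/andP; split; [lra|apply/orP; right; lra].
Qed.

Lemma clamp_id t : `|t| < 2^-1 -> clamp t = t.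
Proof.
by rewrite ltr_norml => /andP[t1 t2]; rewrite /clamp min_l ?ltW // max_r // ltW.
Qed.

(** The bound and the Lipschitz constant of [Phi] are normalised to 1; the contraction comes from
    [delta <= 4^-1] alone, which more than halves differences at each step. *)
Variables (Phi : 'I_3 -> R -> ('I_3 -> R) -> R) (c : 'I_3 -> R) (delta : R).
Hypotheses (delta0 : 0 < delta) (delta4 : delta <= 4^-1).
Hypothesis Phi_cont : forall (v : 'I_3 -> R -> R) (t : R),
  (forall j, {for t, continuous (v j)}) ->
  forall i, {for t, continuous (fun s => Phi i s (v^~ s))}.
Hypothesis Phi_le1 : forall i t v, `|t| <= delta ->
  (forall j, `|v j - c j| <= 1) -> `|Phi i t v| <= 1.
Hypothesis Phi_lip : forall i t v w (d : R), `|t| <= delta ->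
  (forall j, `|v j - c j| <= 1) -> (forall j, `|w j - c j| <= 1) ->
  (forall j, `|v j - w j| <= d) -> `|Phi i t v - Phi i t w| <= d.

Fixpoint picard_iter n i (t : R) : R :=
  if n is n'.+1 then c i + prim (fun s => Phi i s ((picard_iter n')^~ s)) (clamp t)
  else c i.

Local Notation P := picard_iter.

Lemma picard_continuous n i : continuous (P n i).
Proof.
elim: n i => [|n IH] i t; first exact: cvg_cst.
rewrite /=; apply: cvgD; first exact: cvg_cst.
apply: continuous_comp; first exact: clamp_continuous.
have cP : continuous (fun s => Phi i s ((P n)^~ s)).
  by move=> s; apply: Phi_cont => j; exact: IH.
have [d _] := is_derive_prim cP (clamp_lt1 t).
exact/differentiable_continuous/derivable1_diffP.
Qed.

Lemma is_derive_picard n i (t : R) : `|t| <= delta ->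
  is_derive t 1 (P n.+1 i) (Phi i t ((P n)^~ t)).
Proof.
move=> td; have t2 : `|t| < 2^-1 by apply: le_lt_trans td _; apply: le_lt_trans delta4 _; lra.
have oU : open [set s : R | `|s| < 2^-1].
  exact: open_norm_lt.
have cP : continuous (fun s => Phi i s ((P n)^~ s)).
  by move=> s; apply: Phi_cont => j; exact: picard_continuous.
apply: (is_derive_ext_open oU t2 (f := fun s => c i + prim (fun s => Phi i s ((P n)^~ s)) s)).
  by move=> s s2; rewrite /= clamp_id.
have t1 : `|t| < 1 by apply: lt_trans t2 _; lra.
exact: isd_eq (isdD (isd_cst t (c i)) (is_derive_prim cP t1)) (add0r _).
Qed.

Lemma picard_0 n i : P n i 0 = c i.
Proof.
case: n => [//|n] /=; rewrite clamp_id; first by rewrite prim0 addr0.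
by rewrite normr0; lra.
Qed.

Lemma between_delta s t : `|t| <= delta -> Num.min 0 t <= s <= Num.max 0 t -> `|s| <= delta.
Proof. by move=> td /between0_norm st; apply: le_trans td. Qed.

Lemma picard_near n i (t : R) : `|t| <= delta -> `|P n i t - c i| <= 1.
Proof.
elim: n i t => [|n IH] i t td; first by rewrite subrr normr0.
rewrite -[X in _ - X](picard_0 n.+1 i); apply: (@le_trans _ _ (1 * `|t - 0|)); last first.
  by rewrite subr0 mul1r (le_trans td) // (le_trans delta4) //; lra.
apply: mvt_bound => s st; have sd := between_delta td st.
have D := is_derive_picard n i sd; split; first by case: D.
by rewrite (is_derive1P D); apply: Phi_le1 => // j; exact: IH.
Qed.

Lemma picard_step n i (t : R) : `|t| <= delta ->
  `|P n.+1 i t - P n i t| <= 2^-1 ^+ n.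
Proof.
elim: n i t => [|n IH] i t td; first by rewrite expr0 /=; exact: (picard_near 1 i td).
pose g s := P n.+2 i s - P n.+1 i s.
have -> : P n.+2 i t - P n.+1 i t = g t - g 0.
  by rewrite /g !picard_0 subrr subr0.
apply: (@le_trans _ _ (2^-1 ^+ n * `|t - 0|)); last first.
  rewrite exprSr ler_wpM2l ?exprn_ge0 // ?invr_ge0 // subr0.
  by rewrite (le_trans td) // (le_trans delta4) //; lra.
apply: mvt_bound => s st; have sd := between_delta td st.
have D := isdB (is_derive_picard n.+1 i sd) (is_derive_picard n i sd).
split; first by case: D.
rewrite (is_derive1P D); apply: Phi_lip => // j; first exact: picard_near.
  exact: picard_near.
exact: IH.
Qed.

Lemma picard_cauchy n m i (t : R) : `|t| <= delta ->
  `|P (n + m) i t - P n i t| <= 2 * 2^-1 ^+ n.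
Proof.
move=> td; apply: (@le_trans _ _ (2 * 2^-1 ^+ n - 2 * 2^-1 ^+ (n + m))); last first.
  by rewrite gerBl mulr_ge0 // exprn_ge0 // invr_ge0.
elim: m => [|m IH]; first by rewrite addn0 !subrr normr0.
rewrite addnS -[P (n + m).+1 i t](subrK (P (n + m) i t)) -addrA.
apply: (le_trans (ler_normD _ _)); have := picard_step (n + m) i td.
by rewrite exprS; lra.
Qed.

Lemma picard_limit_ex : exists v : 'I_3 -> R -> R, forall n i t, `|t| <= delta ->
  `|v i t - P n i t| <= 2 * 2^-1 ^+ n.
Proof.
have H (it : 'I_3 * R) : exists l : R, `|it.2| <= delta ->
    forall n, `|l - P n it.1 it.2| <= 2 * 2^-1 ^+ n.
  case: it => i t /=; have [td|td] := boolP (`|t| <= delta); last by exists 0.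
  have h1 : `|2^-1 : R| < 1 by rewrite ger0_norm; lra.
  pose d n := P n.+1 i t - P n i t.
  have cd : cvgn (series d).
    apply: normed_cvg; apply: (@series_le_cvg _ _ (geometric 1 2^-1)) => [n|n|n|].
    - exact: normr_ge0.
    - by rewrite /geometric /= mul1r exprn_ge0 // invr_ge0.
    - by rewrite /geometric /= mul1r; exact: picard_step.
    - by apply/cvg_ex; eexists; exact: cvg_geometric_series.
  have /cvg_ex[l Hl] : cvgn (fun n => P n i t).
    have -> : (fun n => P n i t) = (fun n => c i + series d n).
      apply/funext; elim=> [|n IH]; first by rewrite /series /= big_geq // addr0.
      have -> : series d n.+1 = series d n + d n by rewrite /series /= big_nat_recr.
      by rewrite addrA -IH /d addrC subrK.
    by apply: is_cvgD => //; exact: is_cvg_cst.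
  exists l => _ n; apply/ler_addgt0Pl => e e0.
  have /cvgrPdist_lt /(_ e e0) [N _ HN] := Hl.
  have h2 := HN (n + N)%N (leq_addl _ _); rewrite /= in h2.
  have h3 := picard_cauchy n N i td.
  rewrite -[l](subrK (P (n + N) i t)) -addrA.
  by apply: (le_trans (ler_normD _ _)); apply: lerD => //; exact: ltW.
have /choice[l Hl] := H; exists (fun i t => l (i, t)) => n i t td.
exact: (Hl (i, t) td n).
Qed.

Let picard_arith (x y z w q e h : R) : x <= (2 * q + e) * h -> y <= q -> z <= q ->
  w <= z + y -> 0 <= q -> x + w <= e * h + (4 + 2 * h) * q.
Proof. lra. Qed.

(** The derivative of the limit is checked by the epsilon criterion. On a short segment, [P n.+1]
    minus the candidate linear term has derivative below [e] plus an error in [2^-1 ^+ n], by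
    continuity of [Phi] along the limit; the errors vanish as [n] grows. *)
Lemma picard : exists v : 'I_3 -> R -> R, forall i, v i 0 = c i /\
  forall t : R, `|t| < delta -> is_derive t 1 (v i) (Phi i t (v^~ t)).
Proof.
have [v Hv] := picard_limit_ex.
have v_near i t : `|t| <= delta -> `|v i t - c i| <= 1.
  move=> td; apply: (@le_geometric_eps _ _ 2) => n.
  have := picard_near n i td; have := Hv n i t td.
  by have := ler_normD (v i t - P n i t) (P n i t - c i); rewrite addrA subrK; lra.
have P_lip n i s t : `|s| <= delta -> `|t| <= delta -> `|P n i t - P n i s| <= `|t - s|.
  move=> sd td; case: n => [|n]; first by rewrite subrr normr0.
  rewrite -[leRHS]mul1r; apply: mvt_bound => u ut.
  have ud : `|u| <= delta.
    move: ut sd td; rewrite !ler_norml ge_min le_max.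
    by move=> /andP[/orP[]h1 /orP[]h2] /andP[h3 h4] /andP[h5 h6]; apply/andP; split; lra.
  have D := is_derive_picard n i ud; split; first by case: D.
  by rewrite (is_derive1P D); apply: Phi_le1 => // j; exact: picard_near.
have v_lip i s t : `|s| <= delta -> `|t| <= delta -> `|v i t - v i s| <= `|t - s|.
  move=> sd td; apply: (@le_geometric_eps _ _ 4) => n.
  have := P_lip n i s t sd td; have := Hv n i s sd; have := Hv n i t td.
  have -> : v i t - v i s = (v i t - P n i t) + ((P n i t - P n i s) - (v i s - P n i s)) by lra.
  move=> h1 h2 h3; apply: (le_trans (ler_normD _ _)).
  have := ler_normB (P n i t - P n i s) (v i s - P n i s); lra.
exists v => i; split.
  apply/eqP; rewrite -subr_eq0 -normr_le0; apply: (@le_geometric_eps _ _ 2) => n.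
  by rewrite add0r -(picard_0 n i); apply: Hv; rewrite normr0 ltW.
move=> t td; apply/is_derive_near_bound => e e0.
have v_cont j : {for t, continuous (v j)}.
  apply/cvgrPdist_le => e' e'0; apply/nbhs_ballP.
  exists (Num.min e' (delta - `|t|)); first by rewrite /= lt_min e'0 subr_gt0.
  move=> s; rewrite /ball /= lt_min => /andP[s1 s2].
  apply: (@le_trans _ _ `|t - s|); last exact: ltW.
  apply: v_lip; last exact: ltW.
  by have := ler_normB t (t - s); rewrite opprB addrC subrK; lra.
have Pc := Phi_cont v_cont (i := i).
have [r r0 Hr] := continuous_ball Pc e0.
exists (Num.min r (delta - `|t|)); first by rewrite lt_min r0 subr_gt0.
move=> h; rewrite lt_min => /andP[hr hd].
apply: (@le_geometric_eps _ _ (4 + 2 * `|h|)) => n.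
pose a := Phi i t (v^~ t).
pose g s := P n.+1 i s - a * s.
have th s : Num.min t (t + h) <= s <= Num.max t (t + h) -> `|s - t| <= `|h|.
  by move=> /between_norm; rewrite [t + h]addrC addrK.
have G : `|g (t + h) - g t| <= (2 * 2^-1 ^+ n + e) * `|t + h - t|.
  apply: mvt_bound => s /th sh.
  have sd : `|s| <= delta.
    rewrite -[s](subrK t); apply: (le_trans (ler_normD _ _)); lra.
  have D := isdB (is_derive_picard n i sd) (isdZ a (isd_id s)).
  split; first by case: D.
  rewrite (is_derive1P D) mulr1.
  have h1 := Hr s (le_lt_trans sh hr); rewrite -/a in h1.
  have h2 : `|Phi i s ((P n)^~ s) - Phi i s (v^~ s)| <= 2 * 2^-1 ^+ n.
    apply: Phi_lip => // j; [exact: picard_near|exact: v_near|].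
    by rewrite distrC; exact: Hv.
  rewrite -[Phi i s ((P n)^~ s)](subrK (Phi i s (v^~ s))) -addrA.
  by apply: (le_trans (ler_normD _ _)); apply: lerD => //; exact: ltW.
have td' := ltW td.
have thd : `|t + h| <= delta by apply: (le_trans (ler_normD _ _)); lra.
have h1 := Hv n.+1 i t td'; have h2 := Hv n.+1 i (t + h) thd.
have -> : v i (t + h) - v i t - a * h =
  (g (t + h) - g t) + ((v i (t + h) - P n.+1 i (t + h)) - (v i t - P n.+1 i t)).
  by rewrite /g; ring.
apply: (le_trans (ler_normD _ _)).
have h3 := ler_normB (v i (t + h) - P n.+1 i (t + h)) (v i t - P n.+1 i t).
have p : 2 * 2^-1 ^+ n.+1 = 2^-1 ^+ n :> R by rewrite exprS mulrA divff ?mul1r.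
have q : t + h - t = h by rewrite addrAC subrr add0r.
have p0 : 0 <= 2^-1 ^+ n :> R by rewrite exprn_ge0 // invr_ge0.
rewrite p in h1 h2; rewrite q in G.
exact: (picard_arith G h1 h2 h3 p0).
Qed.

End Picard.

Section Gronwall.
Context {R : realType}.

Lemma gronwall0 (E dE : R -> R) (a b K : R) : a <= b ->
  (forall t, a <= t <= b -> is_derive t 1 E (dE t)) ->
  (forall t, a <= t <= b -> dE t <= K * E t) -> E a <= 0 -> E b <= 0.
Proof.
move=> ab dEE HK Ea.
pose g t := E t * expR (- K * t).
have dg t : a <= t <= b -> is_derive t 1 g (dE t * expR (- K * t) + E t * (expR (- K * t) * - K)).
  move=> tab; apply: isdM; first exact: dEE.
  apply: (isd_comp (f := expR) (g := fun s => - K * s)).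
  by apply: isd_eq (isdZ (- K) (isd_id t)) _; rewrite mulr1.
have gba : g b <= g a.
  apply: (@ler0_derive1_le_cc R g a b) => //.
  - move=> t; rewrite in_itv /= => /andP[/ltW ta /ltW tb].
    by have [] := dg t; rewrite ?ta.
  - move=> t; rewrite in_itv /= => /andP[/ltW ta /ltW tb].
    have tab : a <= t <= b by rewrite ta.
    rewrite (is_derive1P (dg t tab)).
    have := HK t tab; have := expR_gt0 (- K * t); move: (expR _) => x x0.
    move: (dE t) (E t) => d y; nra.
  - apply: derivable_within_continuous => t; rewrite in_itv /= => tab.
    by have [] := dg t tab.
  - by rewrite in_itv /= ab lexx.
  - by rewrite in_itv /= lexx ab.
have : g b <= 0.
  by apply: (le_trans gba); rewrite /g pmulr_lle0 // expR_gt0.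
by rewrite /g pmulr_lle0 // expR_gt0.
Qed.

End Gronwall.

(** * The reduced system *)

Section EvenQuotient.
Context {R : realType}.
Implicit Types f g : R -> R.

Lemma eq_at0 (f g : R -> R) (e : R) : 0 < e -> {for (0 : R), continuous f} -> {for (0 : R), continuous g} ->
  (forall t, 0 < t < e -> f t = g t) -> f 0 = g 0.
Proof.
move=> e0 cf cg fg; apply/eqP; rewrite -subr_eq0 -normr_le0; apply/ler_addgt0Pl => d d0.
rewrite addr0; have d20 : 0 < d / 2 by rewrite divr_gt0.
have [r r0 Hr] := continuous_ball cf d20.
have [s s0 Hs] := continuous_ball cg d20.
pose t := Num.min (e / 2) (Num.min (r / 2) (s / 2)).
have t0 : 0 < t by rewrite !lt_min !divr_gt0.
have te : t <= e / 2 by rewrite ge_min lexx.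
have tr : t <= r / 2 by rewrite !ge_min lexx orbT.
have ts : t <= s / 2 by rewrite !ge_min lexx !orbT.
have h1 : `|f t - f 0| < d / 2 by apply: Hr; rewrite subr0 gtr0_norm //; lra.
have h2 : `|g t - g 0| < d / 2 by apply: Hs; rewrite subr0 gtr0_norm //; lra.
have h3 : f t = g t by apply: fg; lra.
have -> : f 0 - g 0 = (g t - g 0) - (f t - f 0) by rewrite h3; ring.
by apply: (le_trans (ler_normB _ _)); lra.
Qed.

Lemma derive1_even f : (forall t, f (- t) = f t) -> derivable f 0 1 -> derive1 f 0 = 0.
Proof.
move=> ef df; have D := derivableP df; rewrite -derive1E in D.
have D' : is_derive (0 : R) 1 (fun t => f (- t)) (derive1 f 0 * -1).
  apply: (isd_comp (f := f) (g := fun t => - t)); first by rewrite oppr0.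
have E : (fun t => f (- t)) = f by apply/funext.
rewrite E in D'; have := is_derive1P D'; lra.
Qed.

Lemma quo_even f t : (forall s, f (- s) = - f s) -> quo f (- t) = quo f t.
Proof.
move=> fo; have [->|t0] := eqVneq t 0; first by rewrite oppr0.
by rewrite !quoE ?oppr_eq0 // fo invrN mulrNN.
Qed.

Lemma quo_odd f t : (forall s, f (- s) = f s) -> derivable f 0 1 -> quo f (- t) = - quo f t.
Proof.
move=> ef df; have [->|t0] := eqVneq t 0.
  by rewrite oppr0 quo0 derive1_even // oppr0.
by rewrite !quoE ?oppr_eq0 // ef invrN mulrN.
Qed.

(** For even smooth [f] this is [(f t - f 0) / t ^+ 2]: the first quotient is odd, hence vanishes at
    0 and can be divided again. *)
Definition equo f := quo (quo (fun t => f t - f 0)).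

Variables (U : set R) (f : R -> R).
Hypotheses (oU : open U) (U0 : U 0) (sf : smooth U f) (ef : forall t, f (- t) = f t).
Hypothesis bU : forall t s : R, U t -> `|s| <= `|t| -> U s.

Let g t := f t - f 0.
Let sg : smooth U g. Proof. by apply: smoothB => //; exact: smooth_cst. Qed.
Let g0 : g 0 = 0. Proof. exact: subrr. Qed.
Let eg t : g (- t) = g t. Proof. by rewrite /g ef. Qed.
Let dg : derivable g 0 1. Proof. exact: smooth1_derivable U0. Qed.
Let q0 : quo g 0 = 0. Proof. by rewrite quo0 derive1_even. Qed.
Let sq : smooth U (quo g). Proof. exact: smooth_quo. Qed.

Lemma equoE t : f t = f 0 + t ^+ 2 * equo f t.
Proof. by rewrite expr2 -mulrA mul_quo // mul_quo // addrC subrK. Qed.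

Lemma smooth_equo : smooth U (equo f).
Proof. exact: smooth_quo. Qed.

Lemma equo_even t : equo f (- t) = equo f t.
Proof. by apply: quo_even => s; exact: quo_odd. Qed.

Lemma gevrey_equo (D : set R) (x : R) : D `<=` U -> D 0 ->
  (forall s t u : R, D s -> D t -> s <= u <= t -> D u) -> D x ->
  gevrey D x f -> gevrey D x (equo f).
Proof.
move=> DU D0 cD Dx gf.
apply: (gevrey_quo oU DU sq q0 bU D0 cD Dx).
apply: (gevrey_quo oU DU sg g0 bU D0 cD Dx).
by apply: (gevreyB oU DU) => //; [exact: smooth_cst|exact: gevrey_cst].
Qed.

End EvenQuotient.

Section ReducedODE.
Context {R : realType}.
Variable al : 'I_3 -> R -> R.
Hypothesis sal : forall i, smooth (setT : set R) (al i).
Hypothesis eal : forall i t, al i (- t) = al i t.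

Local Notation symI e := [set t : R | `|t| < e].

(* The ODE satisfied by [V i = f_i^+ / t]: it is regular at [t = 0]. *)
Definition reduced_sol (e : R) (c : 'I_3 -> R) (V : 'I_3 -> R -> R) :=
  [/\ forall i, V i 0 = c i, forall i t, V i (- t) = V i t &
   forall i (t : R), `|t| < e -> is_derive t 1 (V i)
     (- t * (al i t * V i t + V (i + 1) t * V (i + 2%:R) t))].

Lemma ex_common_radius (P : 'I_3 -> R -> Prop) :
  (forall i r s, s <= r -> P i r -> P i s) ->
  (forall i, exists2 r : R, 0 < r & P i r) -> exists2 r : R, 0 < r & forall i, P i r.
Proof.
move=> PW H.
have /choice[r Hr] : forall i, exists r : R, 0 < r /\ P i r.
  by move=> i; have [r r0 Pr] := H i; exists r.
have [k Hk] := ex_argmax3 (fun i => - r i).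
exists (r k) => [|i]; first by have [] := Hr k.
by have [_] := Hr i; apply: PW; rewrite -lerN2; exact: Hk.
Qed.

Lemma ex_common_bound (P : 'I_3 -> R -> Prop) :
  (forall i r s, r <= s -> P i r -> P i s) ->
  (forall i, exists r : R, P i r) -> exists2 r : R, 0 < r & forall i, P i r.
Proof.
move=> PW H.
have /choice[r Hr] := H; have [k Hk] := ex_argmax3 r.
exists (Num.max 1 (r k)) => [|i]; first by rewrite lt_max ltr01.
by apply: PW (Hr i); rewrite le_max Hk orbT.
Qed.

Lemma reduced_sol_ex (c : 'I_3 -> R) : exists2 e : R, 0 < e & exists V, reduced_sol e c V.
Proof.
have cal i : {for (0 : R), continuous (al i)} by exact: smooth_continuous (sal i) (I : [set: R] 0).
have [a a0 Ha] : exists2 a : R, 0 < a & forall i, `|al i 0| + 1 <= a.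
  apply: (@ex_common_bound (fun i a => `|al i 0| + 1 <= a)) => [i r s rs h|i]; first exact: le_trans rs.
  by eexists; exact: lexx.
have [r r0 Hr] : exists2 r : R, 0 < r & forall i t, `|t| < r -> `|al i t| <= a.
  apply: (@ex_common_radius (fun i r => forall t, `|t| < r -> `|al i t| <= a)) => [i r s sr h t ts|i].
    by apply: h; exact: lt_le_trans sr.
  have [r r0 h] := continuous_ball (cal i) ltr01; exists r => // t tr.
  have := h t; rewrite subr0 => /(_ tr) h1.
  have := ler_normD (al i t - al i 0) (al i 0); rewrite subrK; have := Ha i; lra.
have [M M0 HM] : exists2 M : R, 0 < M & forall i, `|c i| + 1 <= M.
  apply: (@ex_common_bound (fun i a => `|c i| + 1 <= a)) => [i x s rs h|i]; first exact: le_trans rs.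
  by eexists; exact: lexx.
(* [B] dominates the size [a * M + M * M] of the right-hand side without its factor [t] as well as
   its Lipschitz constant [a + 2 * M], so [delta * B <= 1] yields the normalised hypotheses of
   [picard]. *)
pose B := a * M + M * M + a + 2 * M.
have B0 : 0 < B by rewrite /B !addr_gt0 ?mulr_gt0.
pose delta := Num.min 4^-1 (Num.min (r / 2) B^-1).
have d0 : 0 < delta by rewrite !lt_min !divr_gt0 // ?invr_gt0 // B0 andbT; lra.
have d4 : delta <= 4^-1 by rewrite ge_min lexx.
have dr : delta <= r / 2 by rewrite !ge_min lexx orbT.
have dB : delta * B <= 1 by rewrite -ler_pdivlMr // mul1r !ge_min lexx !orbT.
pose Phi i (t : R) (v : 'I_3 -> R) := - t * (al i t * v i + v (i + 1) * v (i + 2%:R)).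
have near_le (v : 'I_3 -> R) : (forall j, `|v j - c j| <= 1) -> forall j, `|v j| <= M.
  move=> h j; have := ler_normD (v j - c j) (c j); rewrite subrK.
  by have := h j; have := HM j; lra.
have [v Hv] : exists v : 'I_3 -> R -> R, forall i, v i 0 = c i /\
    forall t : R, `|t| < delta -> is_derive t 1 (v i) (Phi i t (v^~ t)).
  apply: (picard d0 d4).
  - move=> v t cv i; apply: (@cvgM _ _ (nbhs t) _ (fun s => - s) (fun s => al i s * v i s + v (i + 1) s * v (i + 2%:R) s)).
      by apply: cvgN; exact: cvg_id.
    apply: cvgD; apply: cvgM; try exact: cv.
    exact: smooth_continuous (sal i) (I : [set: R] t).
  - move=> i t v td /near_le h; rewrite /Phi normrM normrN.
    have hal : `|al i t| <= a by apply: Hr; lra.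
    have h1 : `|al i t * v i| <= a * M by rewrite normrM; apply: ler_pM => //; exact: h.
    have h2 : `|v (i + 1) * v (i + 2%:R)| <= M * M by rewrite normrM; apply: ler_pM => //; exact: h.
    apply: le_trans dB; apply: ler_pM => //.
    by have := ler_normD (al i t * v i) (v (i + 1) * v (i + 2%:R)); rewrite /B; lra.
  - move=> i t v w d td /near_le hv /near_le hw hd; rewrite /Phi -mulrBr normrM normrN.
    have hal : `|al i t| <= a by apply: Hr; lra.
    have dd : 0 <= d by apply: le_trans (hd i).
    have -> : al i t * v i + v (i + 1) * v (i + 2%:R) - (al i t * w i + w (i + 1) * w (i + 2%:R)) =
      al i t * (v i - w i) + (v (i + 1) * (v (i + 2%:R) - w (i + 2%:R)) + w (i + 2%:R) * (v (i + 1) - w (i + 1))) by ring.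
    have h1 : `|al i t * (v i - w i)| <= a * d by rewrite normrM; apply: ler_pM => //; exact: h.
    have h2 : `|v (i + 1) * (v (i + 2%:R) - w (i + 2%:R))| <= M * d by rewrite normrM; apply: ler_pM => //; exact: h.
    have h3 : `|w (i + 2%:R) * (v (i + 1) - w (i + 1))| <= M * d by rewrite normrM; apply: ler_pM => //; exact: h.
    apply: (@le_trans _ _ (delta * ((a + 2 * M) * d))).
      apply: ler_pM => //; apply: (le_trans (ler_normD _ _)); apply: le_trans (lerD h1 (le_trans (ler_normD _ _) (lerD h2 h3))) _.
      by rewrite mulrDl; lra.
    rewrite mulrA -[leRHS]mul1r ler_wpM2r //; apply: le_trans dB; rewrite ler_pM2l // /B.
    by have := mulr_ge0 (ltW a0) (ltW M0); have := mulr_ge0 (ltW M0) (ltW M0); lra.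
(* The solution is used for [t >= 0] and reflected: evenness holds by construction, and the equation
   persists because its right-hand side is odd in [t]. *)
exists delta => //; exists (fun i => parity_ext false (v i)); split.
- by move=> i; rewrite /parity_ext lexx; have [] := Hv i.
- by move=> i t; rewrite parity_ext_opp.
move=> i t td.
have oU : open (symI delta) by exact: open_norm_lt.
have E j : parity_ext false (v j) = fun t => v j `|t|.
  apply/funext => s; rewrite /parity_ext; case: (leP 0 s) => s0; first by rewrite ger0_norm.
  by rewrite ltr0_norm.
have oP : open [set s : R | 0 < s] by exact: open_gt.
have oN : open [set s : R | s < 0] by exact: open_lt.
have [t0|t0|t0] := ltrgt0P t.
- apply: (is_derive_ext_open oP t0 (f := v i)).
    by move=> s s0; rewrite /parity_ext ltW.
  by have := (Hv i).2 t td; rewrite /Phi !E gtr0_norm.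
- apply: (is_derive_ext_open oN t0 (f := fun s => v i (- s))).
    by move=> s s0; rewrite /parity_ext leNgt s0.
  have D := (Hv i).2 (- t); rewrite normrN in D.
  apply: isd_eq (isd_comp (f := v i) (g := fun s => - s) (D td) (isdN (isd_id t))) _.
  by rewrite /Phi !E ltr0_norm // eal; ring.
- rewrite t0 oppr0 mul0r; apply/is_derive_near_bound => e e0.
  have := (Hv i).2 0; rewrite normr0 => /(_ d0); rewrite /Phi oppr0 mul0r.
  move=> /is_derive_near_bound /(_ e e0) [s s0 Hs]; exists s => // h hs.
  by have := Hs `|h|; rewrite normr_id !E !add0r normr0 !mul0r => /(_ hs).
Qed.

Lemma gevrey_common (D : set R) (x : R) (f : 'I_3 -> R -> R) : (forall i, gevrey D x (f i)) ->
  exists (r0 C rho0 : R), [/\ 0 < r0, 0 < C, 1 <= rho0 &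
  forall i r rho N, r <= r0 -> rho0 <= rho -> jbnd (near_in D x r) N C rho (f i)].
Proof.
move=> gf.
have /choice[q Hq] : forall i, exists q : R * R * R, [/\ 0 < q.1.1, 0 < q.1.2, 1 <= q.2 &
    forall r rho N, r <= q.1.1 -> q.2 <= rho -> jbnd (near_in D x r) N q.1.2 rho (f i)].
  by move=> i; have [r [C [rho H]]] := (gevreyP _ _ _).1 (gf i); exists (r, C, rho).
have [r r0 Hr] : exists2 r : R, 0 < r & forall i, r <= (q i).1.1.
  apply: (@ex_common_radius (fun i r => r <= (q i).1.1)) => [i r s|i]; first exact: le_trans.
  by exists (q i).1.1; [have [] := Hq i|].
have [C C0 HC] : exists2 C : R, 0 < C & forall i, (q i).1.2 <= C.
  apply: (@ex_common_bound (fun i r => (q i).1.2 <= r)) => [i r1 s rs h|i]; first exact: le_trans rs.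
  by exists (q i).1.2.
have [rho rho0 Hrho] : exists2 C : R, 0 < C & forall i, (q i).2 <= C.
  apply: (@ex_common_bound (fun i r => (q i).2 <= r)) => [i r1 s rs h|i]; first exact: le_trans rs.
  by exists (q i).2.
exists r, C, rho; split => //; first by apply: le_trans (Hrho ord0); have [] := Hq ord0.
move=> i r' rho' N rr hrho; have [q1 q2 q3 H] := Hq i.
have h3 : (q i).2 <= rho' by exact: le_trans (Hrho i) _.
apply: (@jbndW _ _ N (q i).1.2 C rho' rho').
- by rewrite (ltW q2) HC.
- by rewrite lexx andbT (le_trans _ h3) // (le_trans _ q3).
- by apply: H => //; exact: le_trans (Hr i).
Qed.

Section Solution.
Variables (e : R) (c : 'I_3 -> R) (V : 'I_3 -> R -> R).
Hypothesis HV : reduced_sol e c V.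

Lemma reduced_sol_smooth i : smooth (symI e) (V i).
Proof.
have [_ _ dV] := HV; have oU : open (symI e) by exact: open_norm_lt.
apply: (@salg_smooth1 _ _ (fun f => exists j, f = V j)) => //; last by apply: SalgBase; exists i.
move=> _ [j ->]; split=> [x Ux|]; first by have [] := dV j x Ux.
have XV k : salg (symI e) (fun f => exists j, f = V j) (V k) by apply: SalgBase; exists k.
have Sal : salg (symI e) (fun f => exists j, f = V j) (al j).
  by apply: SalgSmooth; apply: smooth_sub (sal j).
have Sid : salg (symI e) (fun f => exists j, f = V j) (fun t : R => - t).
  by apply: SalgSmooth; apply: smoothN => //; exact: smooth_id.
apply: (SalgExt (SalgM Sid (SalgD (SalgM Sal (XV j)) (SalgM (XV (j + 1)) (XV (j + 2%:R)))))) => x Ux.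
by rewrite (is_derive1P (dV j x Ux)).
Qed.

Lemma balanced_sym : forall t s : R, symI e t -> `|s| <= `|t| -> symI e s.
Proof. by move=> t s /= te st; exact: le_lt_trans te. Qed.

(** Inserting [V_i = V_i 0 + t ^+ 2 * E] and dividing by [t] gives
    [2 * E + t * E' = - (al_i V_i + V_j V_k)] for [t > 0]; both sides are continuous at 0. *)
Lemma equo_reduced_sol0 i : 0 < e ->
  equo (V i) 0 = - 2^-1 * (al i 0 * c i + c (i + 1) * c (i + 2%:R)).
Proof.
move=> e0; have [V0 eV dV] := HV; have oU : open (symI e) by exact: open_norm_lt.
have sV := reduced_sol_smooth; have U0 : symI e 0 by rewrite /= normr0.
have sh := smooth_equo oU U0 (sV i) (eV i) balanced_sym.
pose F t := 2 * equo (V i) t + t * derive1 (equo (V i)) t.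
pose G t := - (al i t * V i t + V (i + 1) t * V (i + 2%:R) t).
have sF : smooth (symI e) F.
  apply: smoothD => //; first exact: smoothZ.
  by apply: smoothM => //; [exact: smooth_id|exact: smooth1_derive].
have sG : smooth (symI e) G.
  apply: smoothN => //; apply: smoothD => //; apply: smoothM => //.
  exact: smooth_sub (sal i).
have FG : F 0 = G 0.
  apply: (eq_at0 e0); [exact: smooth_continuous sF U0|exact: smooth_continuous sG U0|].
  move=> t /andP[t0 te]; have Ut : symI e t by rewrite /= gtr0_norm.
  apply: (mulfI (lt0r_neq0 t0)).
  have D1 := dV i t Ut.
  have E : V i = fun t => V i 0 + t ^+ 2 * equo (V i) t.
    by apply/funext => s; exact: (equoE oU U0 (sV i) (eV i)).
  have D2 := isdD (isd_cst t (V i 0)) (isdM (isdX 1 t) (smooth1_is_derive sh Ut)).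
  rewrite -E in D2.
  have := is_derive1P D1; rewrite (is_derive1P D2) => e1.
  rewrite /F /G; move: e1; rewrite expr1 => e1.
  by rewrite mulrN -mulNr -e1; ring.
move: FG; rewrite /F /G mul0r addr0 !V0 => h.
by apply: (mulfI (_ : 2 != 0 :> R)) => //; rewrite h mulNr mulrN mulrA divff // mul1r.
Qed.

Lemma reduced_sol_gevrey (x : R) : 0 <= x < e ->
  (forall i, gevrey [set t | 0 <= t] x (al i)) ->
  forall i, gevrey [set t | 0 <= t < e] x (V i).
Proof.
move=> x0e gal; have [V0 eV dV] := HV; have oU : open (symI e) by exact: open_norm_lt.
pose D := [set t : R | 0 <= t < e].
have DU : D `<=` symI e by move=> t /andP[t0 te]; rewrite /= ger0_norm.
have Dx : D x by exact: x0e.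
have sV := reduced_sol_smooth.
have gal' i : gevrey D x (al i).
  have [r [C [rho [r0 C0 rho1 H]]]] := gal i; exists r, C, rho; split=> // N n t nN [/andP[t0 te] tr].
  by apply: (H N).
have [r1 [C1 [rho1 [r10 C10 rho11 H1]]]] := gevrey_common gal'.
have [r2 [C2 [rho2 [r20 C20 rho21 H2]]]] := (gevreyP _ _ _).1 (gevrey_id D x).
have [C C0 HC] : exists2 C : R, 0 < C & forall i, `|V i x| + 1 <= C.
  apply: (@ex_common_bound (fun i a => `|V i x| + 1 <= a)) => [i r s rs h|i]; first exact: le_trans rs.
  by eexists; exact: lexx.
have [r3 r30 H3] : exists2 r : R, 0 < r & forall i t, `|t - x| < r -> `|V i t| <= C.
  apply: (@ex_common_radius (fun i r => forall t, `|t - x| < r -> `|V i t| <= C)) => [i r s sr h t ts|i].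
    by apply: h; exact: lt_le_trans sr.
  have cV : {for x, continuous (V i)} by exact: smooth_continuous (sV i) (DU x Dx).
  have [r r0 h] := continuous_ball cV ltr01; exists r => // t tr.
  have := h t tr; have := ler_normD (V i t - V i x) (V i x); rewrite subrK; have := HC i; lra.
pose r := Num.min r1 (Num.min r2 r3).
have r0 : 0 < r by rewrite !lt_min r10 r20.
have rr1 : r <= r1 by rewrite ge_min lexx.
have rr2 : r <= r2 by rewrite !ge_min lexx orbT.
have rr3 : r <= r3 by rewrite !ge_min lexx !orbT.
have nU : near_in D x r `<=` symI e by move=> t [/DU].
apply: (@gevrey_ode R D x 'I_3 V r C (8 * C2 * (8 * C1 * C + 8 * C * C)) (Num.max rho1 rho2)) => //.
- by rewrite !mulr_ge0 ?addr_ge0 ?mulr_ge0 // ltW.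
- by rewrite le_max rho11.
- by move=> i t [_ tr]; apply: H3; exact: lt_le_trans rr3.
move=> rho N; rewrite ge_max => /andP[h1 h2] HVN i n t nN It.
have rho0 : 0 <= rho by apply: le_trans h1; apply: le_trans rho11.
have sal' : smooth (symI e) (al i) by apply: smooth_sub (sal i).
have sI : smooth (symI e) (fun t : R => t) by exact: smooth_id.
have b1 := jbndM oU nU rho0 sal' (sV i) (H1 i r rho N rr1 h1) (HVN i).
have b2 := jbndM oU nU rho0 (sV (i + 1)) (sV (i + 2%:R)) (HVN (i + 1)) (HVN (i + 2%:R)).
have s1 := smoothM oU sal' (sV i); have s2 := smoothM oU (sV (i + 1)) (sV (i + 2%:R)).
have b3 := jbndD oU nU s1 s2 b1 b2.
have b4 := jbndM oU nU rho0 sI (smoothD oU s1 s2) (H2 r rho N rr2 h2) b3.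
have b5 := jbndZ oU nU (-1) (smoothM oU sI (smoothD oU s1 s2)) b4.
have := b5 n t nN It; rewrite normrN1 mul1r; congr (`|_| <= _).
apply: jet_ext_open oU (nU t It) _ => y Uy.
by rewrite (is_derive1P (dV i y Uy)) mulN1r mulNr.
Qed.

End Solution.

Lemma continuous_bound (f : R -> R) (a b : R) : a <= b ->
  (forall t, a <= t <= b -> {for t, continuous f}) ->
  exists C : R, forall t, a <= t <= b -> `|f t| <= C.
Proof.
move=> ab cf; have [|c] := @EVT_max R (fun s => `|f s|) a b ab.
  apply: continuous_in_subspaceT => s; rewrite inE /= in_itv /= => sab.
  by apply: cvg_norm; exact: cf.
rewrite in_itv /= => cab H; exists `|f c| => t tab; apply: H.
by rewrite in_itv.
Qed.

Lemma reduced_sol_unique (e : R) c (V W : 'I_3 -> R -> R) :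
  reduced_sol e c V -> reduced_sol e c W -> forall i (t : R), 0 <= t < e -> V i t = W i t.
Proof.
move=> HV HW i b /andP[b0 be]; have [V0 eV dV] := HV; have [W0 eW dW] := HW.
have oU : open (symI e) by exact: open_norm_lt.
have itv (t : R) : 0 <= t <= b -> `|t| < e.
  by move=> /andP[t0 tb]; rewrite ger0_norm // (le_lt_trans tb).
have bnd (f : 'I_3 -> R -> R) : (forall j, smooth (symI e) (f j)) ->
    exists2 C : R, 0 < C & forall j (t : R), 0 <= t <= b -> `|f j t| <= C.
  move=> sf; apply: (@ex_common_bound (fun j C => forall t, 0 <= t <= b -> `|f j t| <= C)) => [j r s rs h t tb|j].
    exact: le_trans (h t tb) rs.
  apply: continuous_bound => // t tb; apply: smooth_continuous (sf j) _; exact: itv.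
have [A A0 HA] := bnd al (fun j => smooth_sub (fun _ _ => I) (sal j)).
have [C C0 HC] := bnd V (reduced_sol_smooth HV).
have [C' C'0 HC'] := bnd W (reduced_sol_smooth HW).
pose d j t := V j t - W j t.
pose E t := \sum_j d j t ^+ 2.
(* The quadratic terms split as [V_j V_k - W_j W_k = V_j d_k + W_k d_j], so the differences satisfy
   a linear system with bounded coefficients. *)
pose F j t := al j t * d j t + V (j + 1) t * d (j + 2%:R) t + W (j + 2%:R) t * d (j + 1) t.
have dd j (t : R) : 0 <= t <= b -> is_derive t 1 (d j) (- t * F j t).
  move=> /itv tb; apply: isd_eq (isdB (dV j t tb) (dW j t tb)) _.
  by rewrite /F /d; ring.
have dE (t : R) : 0 <= t <= b -> is_derive t 1 E (\sum_j 2 * d j t * (- t * F j t)).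
  move=> tb.
  have -> : E = \sum_j (fun t => d j t ^+ 2) by apply/funext => s; rewrite fct_sumE.
  apply: is_derive_sum => j; apply: isd_eq (isdXn 1 (dd j t tb)) _.
  by rewrite expr1.
have dle j t : d j t ^+ 2 <= E t.
  by rewrite /E (bigD1 j) //= lerDl sumr_ge0 // => k _; exact: sqr_ge0.
have dle2 j k t : `|d j t * d k t| <= E t.
  have h1 := dle j t; have h2 := dle k t.
  rewrite ler_norml; apply/andP; split.
    by have := sqr_ge0 (d j t + d k t); rewrite sqrrD; lra.
  by have := sqr_ge0 (d j t - d k t); rewrite sqrrB; lra.
have E0 t : 0 <= E t by apply: le_trans (dle i t); exact: sqr_ge0.
pose K := \sum_(j < 3) 2 * b * (A + C + C').
have key (t : R) : 0 <= t <= b -> \sum_j 2 * d j t * (- t * F j t) <= K * E t.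
  move=> tb; rewrite /K mulr_suml; apply: ler_sum => j _.
  have [t0 tb'] := andP tb.
  have -> : 2 * d j t * (- t * F j t) = 2 * (- t) * (al j t * (d j t * d j t) +
      V (j + 1) t * (d j t * d (j + 2%:R) t) + W (j + 2%:R) t * (d j t * d (j + 1) t)).
    by rewrite /F; ring.
  set S := (X in _ * X <= _).
  have hS : `|S| <= (A + C + C') * E t.
    rewrite (_ : _ * E t = A * E t + C * E t + C' * E t); last by ring.
    rewrite /S; apply: (le_trans (ler_normD _ _)); apply: lerD; last first.
      by rewrite normrM; apply: ler_pM => //; exact: HC'.
    apply: (le_trans (ler_normD _ _)); apply: lerD; rewrite normrM; apply: ler_pM => //.
      exact: HA.
    exact: HC.
  rewrite mulrN mulNr -mulrN -!mulrA ler_pM2l // .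
  apply: (@le_trans _ _ (t * `|S|)); first by rewrite ler_wpM2l // -(normrN S) ler_norm.
  by apply: ler_pM.
have E00 : E 0 <= 0.
  by rewrite /E big1 // => j _; rewrite /d V0 W0 subrr expr0n.
have := gronwall0 b0 dE key E00 => Eb.
have : d i b ^+ 2 <= 0 by apply: le_trans (dle i b) Eb.
by rewrite real_exprn_even_le0 //= ?num_real // subr_eq0 => /eqP.
Qed.

End ReducedODE.

(** * Coefficients of the instanton equations *)

Section Ord3.

Lemma ord3_eqs (i : 'I_3) : [/\ i + 1 + 1 = i + 2%:R, i + 1 + 2%:R = i,
  i + 2%:R + 1 = i & i + 2%:R + 2%:R = i + 1].
Proof. by case: i => -[|[|[|//]]] ?; split; apply/val_inj. Qed.

Lemma ord3_sums :
  [/\ 0 + 1 = 1 :> 'I_3, 1 + 1 = 2%:R :> 'I_3 & 2%:R + 1 = 0 :> 'I_3] /\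
  [/\ 0 + 2%:R = 2%:R :> 'I_3, 1 + 2%:R = 0 :> 'I_3 & 2%:R + 2%:R = 1 :> 'I_3].
Proof. by do !split; exact: val_inj. Qed.

Lemma ord3P (P : 'I_3 -> Prop) : P 0 -> P 1 -> P 2%:R -> forall i, P i.
Proof.
move=> P0 P1 P2 [[|[|[|//]]] lti].
- by rewrite (_ : Ordinal lti = 0) //; apply/val_inj.
- by rewrite (_ : Ordinal lti = 1) //; apply/val_inj.
- by rewrite (_ : Ordinal lti = 2%:R) //; apply/val_inj.
Qed.

Lemma prod3_cycle (S : comRingType) (f : 'I_3 -> S) (i : 'I_3) :
  f 0 * f 1 * f 2%:R = f i * f (i + 1) * f (i + 2%:R).
Proof.
have e1 : (1 + 1 : 'I_3) = 2%:R by apply/val_inj.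
have e2 : (1 + 2%:R : 'I_3) = 0 by apply/val_inj.
have e3 : (2%:R + 1 : 'I_3) = 0 by apply/val_inj.
have e4 : (2%:R + 2%:R : 'I_3) = 1 by apply/val_inj.
by elim/ord3P: i; rewrite ?add0r ?e1 ?e2 ?e3 ?e4; ring.
Qed.

End Ord3.

Section LinearODE.
Context {R : realType}.
Variables (U D : set R) (p q r s y : 'I_3 -> R -> R).
Hypotheses (oU : open U) (DU : D `<=` U).
Hypotheses (sp : forall i, smooth U (p i)) (sq : forall i, smooth U (q i))
  (sr : forall i, smooth U (r i)) (ss : forall i, smooth U (s i)) (sy : forall i, smooth U (y i)).

Definition affine_rhs i t :=
  p i t + q i t * y i t + r i t * y (i + 1) t + s i t * y (i + 2%:R) t.

Lemma smooth_affine_rhs i : smooth U (affine_rhs i).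
Proof. by do 3!(apply: smoothD => //; last exact: smoothM); apply: sp. Qed.

Lemma jbnd_subset (I J : set R) N C rho (f : R -> R) : J `<=` I -> jbnd I N C rho f -> jbnd J N C rho f.
Proof. by move=> JI h n t nN Jt; apply: h nN (JI t Jt). Qed.

(** The constant is [1 + 8 + 8 + 8], each product costing a factor 8; [1 <= C] absorbs the
    inhomogeneous term. The result is linear in [C], as the maximum principle requires. *)
Lemma jbnd_affine_rhs (I : set R) N (C C1 rho : R) : I `<=` U -> 0 <= rho -> 1 <= C -> 0 <= C1 ->
  (forall i, [/\ jbnd I N C1 rho (p i), jbnd I N C1 rho (q i), jbnd I N C1 rho (r i) & jbnd I N C1 rho (s i)]) ->
  (forall i, jbnd I N C rho (y i)) ->
  forall i, jbnd I N (25 * C1 * C) rho (affine_rhs i).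
Proof.
move=> IU rho0 C1' C10 Hb Hy i; have [bp bq br bs] := Hb i.
have m1 := jbndM oU IU rho0 (sq i) (sy i) bq (Hy i).
have m2 := jbndM oU IU rho0 (sr i) (sy (i + 1)) br (Hy (i + 1)).
have m3 := jbndM oU IU rho0 (ss i) (sy (i + 2%:R)) bs (Hy (i + 2%:R)).
have s1 := smoothM oU (sq i) (sy i).
have s2 := smoothM oU (sr i) (sy (i + 1)).
have s3 := smoothM oU (ss i) (sy (i + 2%:R)).
have b := jbndD oU IU (smoothD oU (smoothD oU (sp i) s1) s2) s3
  (jbndD oU IU (smoothD oU (sp i) s1) s2 (jbndD oU IU (sp i) s1 bp m1) m2) m3.
apply: jbndW b; last by rewrite rho0 lexx.
have C0 : 0 <= C by apply: le_trans C1'.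
rewrite !addr_ge0 ?mulr_ge0 //=.
have : C1 <= C1 * C by rewrite ler_peMr.
by rewrite -!mulrA; lra.
Qed.

Lemma gevrey4_common (x : R) :
  (forall i, [/\ gevrey D x (p i), gevrey D x (q i), gevrey D x (r i) & gevrey D x (s i)]) ->
  exists (r0 C rho0 : R), [/\ 0 < r0, 0 < C, 1 <= rho0 &
    forall r' rho N, r' <= r0 -> rho0 <= rho -> forall i,
    [/\ jbnd (near_in D x r') N C rho (p i), jbnd (near_in D x r') N C rho (q i),
        jbnd (near_in D x r') N C rho (r i) & jbnd (near_in D x r') N C rho (s i)]].
Proof.
move=> g.
have [r1 [C1 [rho1 [r10 C10 rho11 H1]]]] := gevrey_common (fun i => let: And4 h _ _ _ := g i in h).
have [r2 [C2 [rho2 [r20 C20 rho21 H2]]]] := gevrey_common (fun i => let: And4 _ h _ _ := g i in h).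
have [r3 [C3 [rho3 [r30 C30 rho31 H3]]]] := gevrey_common (fun i => let: And4 _ _ h _ := g i in h).
have [r4 [C4 [rho4 [r40 C40 rho41 H4]]]] := gevrey_common (fun i => let: And4 _ _ _ h := g i in h).
exists (Num.min (Num.min r1 r2) (Num.min r3 r4)), (C1 + C2 + C3 + C4),
  (Num.max (Num.max rho1 rho2) (Num.max rho3 rho4)); split.
- by rewrite !lt_min r10 r20 r30 r40.
- by rewrite !addr_gt0.
- by rewrite !le_max rho11.
move=> r' rho N; rewrite !le_min !ge_max => /andP[/andP[a1 a2] /andP[a3 a4]] /andP[/andP[b1 b2] /andP[b3 b4]] i.
have rho0 : 0 <= rho <= rho by rewrite lexx andbT; lra.
split.
- by apply: jbndW (H1 i r' rho N a1 b1) => //; apply/andP; split; lra.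
- by apply: jbndW (H2 i r' rho N a2 b2) => //; apply/andP; split; lra.
- by apply: jbndW (H3 i r' rho N a3 b3) => //; apply/andP; split; lra.
- by apply: jbndW (H4 i r' rho N a4 b4) => //; apply/andP; split; lra.
Qed.

Lemma local_bound (x : R) : U x -> exists r0 C : R, [/\ 0 < r0, 1 <= C &
  forall i t, `|t - x| < r0 -> `|y i t| <= C].
Proof.
move=> Ux.
have [C C0 HC] : exists2 C : R, 0 < C & forall i, `|y i x| + 1 <= C.
  apply: (@ex_common_bound _ (fun i a => `|y i x| + 1 <= a)) => [i r' s' rs h|i]; first exact: le_trans rs.
  by eexists; exact: lexx.
have [r3 r30 H3] : exists2 r : R, 0 < r & forall i t, `|t - x| < r -> `|y i t| <= C.
  apply: (@ex_common_radius _ (fun i r => forall t, `|t - x| < r -> `|y i t| <= C)) => [i r' s' sr' h t ts|i].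
    by apply: h; exact: lt_le_trans sr'.
  have cV : {for x, continuous (y i)} by exact: smooth_continuous (sy i) Ux.
  have [r0 r00 h] := continuous_ball cV ltr01; exists r0 => // t tr.
  have := h t tr; have := ler_normD (y i t - y i x) (y i x); rewrite subrK; have := HC i; lra.
exists r3, C; split => //; have := HC ord0; have := normr_ge0 (y ord0 x); lra.
Qed.

Lemma gevrey_affine_ode (x : R) : D x ->
  (forall i, [/\ gevrey D x (p i), gevrey D x (q i), gevrey D x (r i) & gevrey D x (s i)]) ->
  (forall i t, U t -> derive1 (y i) t = affine_rhs i t) ->
  forall i, gevrey D x (y i).
Proof.
move=> Dx g ode; have [r1 [C1 [rho1 [r10 C10 rho11 H1]]]] := gevrey4_common g.
have [r2 [C [r20 C0 HC]]] := local_bound (DU Dx).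
pose r' := Num.min r1 r2; have rr1 : r' <= r1 by rewrite ge_min lexx.
have r0 : 0 < r' by rewrite lt_min r10.
have IU : near_in D x r' `<=` U by move=> t [/DU].
have C1' := ltW C10.
apply: (@gevrey_ode R D x 'I_3 y r' C (25 * C1 * C) rho1) => //; try lra.
- by rewrite !mulr_ge0 //; lra.
- by move=> i t [_]; rewrite lt_min => /andP[_]; exact: HC.
move=> rho N hrho hy i; have rho0 : 0 <= rho by lra.
have b := jbnd_affine_rhs IU rho0 C0 C1' (fun i => H1 r' rho N rr1 hrho i) hy i.
move=> n t nN It; have := b n t nN It; congr (`|_| <= _).
by apply: jet_ext_open oU (IU t It) _ => z Uz; rewrite ode.
Qed.

End LinearODE.

Section Alpha.
Context {R : realType}.
Variables (a ee dd : 'I_3 -> R -> R).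
Hypotheses (sa : forall i, smooth (setT : set R) (a i)) (se : forall i, smooth (setT : set R) (ee i))
  (sd : forall i, smooth (setT : set R) (dd i)).
Hypotheses (ea : forall i t, a i (- t) = a i t) (eve : forall i t, ee i (- t) = ee i t)
  (ed : forall i t, dd i (- t) = dd i t).
Hypotheses (a0 : forall i t, 0 < a i t) (d0 : forall i t, 0 < dd i t).
Hypothesis aE : forall i t, a i t = 2^-1 + t ^+ 2 * ee i t.

Let oT : open [set: R] := openT.
Let T (x : R) : [set: R] x := I.

Lemma derive1_opp_even (f : R -> R) t : smooth (setT : set R) f ->
  (forall s, f (- s) = f s) -> derive1 f (- t) = - derive1 f t.
Proof.
move=> sf ef.
have D : is_derive t 1 (fun t => f (- t)) (derive1 f (- t) * -1).
  apply: (isd_comp (f := f) (g := fun t => - t)).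
  exact: smooth1_is_derive sf (T _).
have E : (fun t => f (- t)) = f by apply/funext.
by rewrite E in D; have := is_derive1P D; rewrite mulrN1 => ->; rewrite opprK.
Qed.

Let a_neq0 i t : a i t != 0. Proof. exact: lt0r_neq0. Qed.
Let d_neq0 i t : dd i t != 0. Proof. exact: lt0r_neq0. Qed.

Lemma derive1_a i t : derive1 (a i) t = 2 * t * ee i t + t ^+ 2 * derive1 (ee i) t.
Proof.
have -> : a i = fun t => 2^-1 + t ^+ 2 * ee i t by apply/funext => s; exact: aE.
apply: is_derive1P.
apply: isd_eq (isdD (isd_cst t _) (isdM (isdX 1 t) (smooth1_is_derive (se i) (T t)))) _.
by rewrite add0r expr1.
Qed.

(** With [a = 1/2 + t^2 e], the expression [2 a_i a_j a_k + t a_i' a_j a_k - a_i^2] vanishes at 0,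
    since [2 / 8 = 1 / 4], and equals [t^2] times this function. It is the numerator left in the
    coefficient once the pole [- 1 / t] is taken out. *)
Definition alpha_num i t :=
  let j := i + 1 in let k := i + 2%:R in
  let x := ee i t in let y := ee j t in let z := ee k t in
  2^-1 * (x + y + z) + t ^+ 2 * (x * y + y * z + z * x) + 2 * t ^+ 4 * (x * y * z)
  + (2 * x + t * derive1 (ee i) t) * (a j t * a k t) - x - t ^+ 2 * x ^+ 2.

(* The coefficient of the ODE is [- 1 / t + t * alpha]. *)
Definition alpha i t :=
  alpha_num i t * (a i t * a (i + 1) t * a (i + 2%:R) t)^-1 + a i t * (dd i t)^-1.

Lemma alphaE i t : t != 0 ->
  t^-1 + derive1 (a i) t / a i t + t * a i t / dd i t - a i t / (t * (a (i + 1) t * a (i + 2%:R) t))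
  = - t^-1 + t * alpha i t.
Proof.
move=> t0; rewrite /alpha.
have key : 2 * (a i t * a (i + 1) t * a (i + 2%:R) t) +
    t * derive1 (a i) t * (a (i + 1) t * a (i + 2%:R) t) - a i t ^+ 2 = t ^+ 2 * alpha_num i t.
  by rewrite derive1_a /alpha_num !aE; field.
have -> : alpha_num i t = (2 * (a i t * a (i + 1) t * a (i + 2%:R) t) +
    t * derive1 (a i) t * (a (i + 1) t * a (i + 2%:R) t) - a i t ^+ 2) / t ^+ 2.
  by rewrite key mulrAC divff ?mul1r // expf_neq0.
move: (a_neq0 i t) (a_neq0 (i + 1) t) (a_neq0 (i + 2%:R) t) (d_neq0 i t).
move: (a i t) (a (i + 1) t) (a (i + 2%:R) t) (dd i t) (derive1 (a i) t) => u v w d u' u0 v0 w0 dn0.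
by field; rewrite t0 u0 v0 w0 dn0.
Qed.

Lemma alpha_at0 i : alpha i 0 = 4 * (ee (i + 1) 0 + ee (i + 2%:R) 0) + (2 * dd i 0)^-1.
Proof.
rewrite /alpha /alpha_num !aE !expr0n /= !mul0r !addr0 ?mulr0.
by move: (d_neq0 i 0) => h; field.
Qed.

Lemma alpha_even i t : alpha i (- t) = alpha i t.
Proof.
rewrite /alpha /alpha_num !ea !eve ed derive1_opp_even //.
by rewrite !sqrrN mulrNN (_ : (- t) ^+ 4 = t ^+ 4) //; ring.
Qed.

Lemma smooth_id_pow n : smooth (setT : set R) (fun t : R => t ^+ n).
Proof. by apply: smoothX => //; exact: smooth_id. Qed.

Lemma smooth_alpha_num i : smooth (setT : set R) (alpha_num i).
Proof.
have sc (c : R) : smooth (setT : set R) (fun _ : R => c) by exact: smooth_cst.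
have sI := smooth_id oT.
have se' := smooth1_derive oT (se i).
rewrite /alpha_num.
by repeat first [apply: smoothB => //|apply: smoothD => //|apply: smoothM => //|apply: smooth_id_pow|apply: smoothX => //].
Qed.

Lemma smooth_alpha i : smooth (setT : set R) (alpha i).
Proof.
apply: smoothD => //; apply: smoothM => //.
- exact: smooth_alpha_num.
- apply: smoothV => // [y _|]; first by rewrite !mulf_neq0.
  by apply: smoothM => //; exact: smoothM.
- exact: smoothV.
Qed.

Section GevreyAlpha.
Variable x : R.
Let D := [set t : R | 0 <= t].
Hypothesis Dx : D x.
Let DT : D `<=` [set: R]. Proof. by []. Qed.
Hypotheses (ga : forall i, gevrey D x (a i)) (ge : forall i, gevrey D x (ee i))
  (gd : forall i, gevrey D x (dd i)).

Lemma gevreyX n : gevrey D x (fun t : R => t ^+ n).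
Proof.
elim: n => [|n IH]; first exact: gevrey_cst.
apply: (gevrey_ext oT DT (f := fun t => t * t ^+ n)); first by move=> y _; rewrite exprS.
by apply: (gevreyM oT DT) => //; [exact: smooth_id|exact: smooth_id_pow|exact: gevrey_id].
Qed.

Lemma gevrey_alpha i : gevrey D x (alpha i).
Proof.
have sc (c : R) : smooth (setT : set R) (fun _ : R => c) by exact: smooth_cst.
have sI := smooth_id oT.
have se' j := smooth1_derive oT (se j).
have ge' j := gevrey_derive (ge j).
have gc (c : R) : gevrey D x (fun _ => c) by exact: gevrey_cst.
have sn := smooth_alpha_num i.
have sp n := smooth_id_pow n.
have s3 : smooth (setT : set R) (fun t => a i t * a (i + 1) t * a (i + 2%:R) t).
  by apply: smoothM => //; exact: smoothM.
have g3 : gevrey D x (fun t => a i t * a (i + 1) t * a (i + 2%:R) t).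
  by apply: (gevreyM oT DT) => //; [exact: smoothM|exact: (gevreyM oT DT)].
have s4 : smooth (setT : set R) (fun t => (a i t * a (i + 1) t * a (i + 2%:R) t)^-1).
  by apply: smoothV => // y _; rewrite !mulf_neq0.
have g4 : gevrey D x (fun t => (a i t * a (i + 1) t * a (i + 2%:R) t)^-1).
  by apply: (gevreyV oT DT Dx) => // y _; rewrite !mulf_neq0.
have s5 : smooth (setT : set R) (fun t => (dd i t)^-1) by exact: smoothV.
have g5 : gevrey D x (fun t => (dd i t)^-1) by apply: (gevreyV oT DT Dx).
have gn : gevrey D x (alpha_num i).
  rewrite /alpha_num.
  repeat first [exact: gevreyX | exact: gevrey_id | done
    | apply: (gevreyB oT DT) | apply: (gevreyD oT DT) | apply: (gevreyM oT DT)
    | apply: (smoothB oT) | apply: (smoothD oT) | apply: (smoothM oT) | apply: (smoothX oT)].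
apply: (gevreyD oT DT) => //; [exact: smoothM|exact: smoothM|exact: (gevreyM oT DT)|exact: (gevreyM oT DT)].
Qed.

End GevreyAlpha.

End Alpha.

(** * Coclosedness as a singular linear system for [B_j B_k] *)

Section CoclosedODE.
Context {R : realType}.
Variables (a ee dd : 'I_3 -> R -> R).
Hypotheses (sa : forall i, smooth (setT : set R) (a i)) (se : forall i, smooth (setT : set R) (ee i))
  (sd : forall i, smooth (setT : set R) (dd i)).
Hypotheses (ea : forall i t, a i (- t) = a i t) (eve : forall i t, ee i (- t) = ee i t)
  (ed : forall i t, dd i (- t) = dd i t).
Hypotheses (a0 : forall i t, 0 < a i t).
Hypothesis aE : forall i t, a i t = 2^-1 + t ^+ 2 * ee i t.
Hypothesis dd0 : forall i j, dd i 0 = dd j 0.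
(* The coclosedness equations for [A i = t * a i] and [B (i + 1) * B (i + 2) = dd i]. *)
Hypothesis coclosed : forall (i : 'I_3) (t : R), 0 < t ->
  2 * t * (a (i + 1) t * a (i + 2%:R) t * dd i t) +
  t ^+ 2 * (derive1 (a (i + 1)) t * a (i + 2%:R) t * dd i t +
     a (i + 1) t * derive1 (a (i + 2%:R)) t * dd i t + a (i + 1) t * a (i + 2%:R) t * derive1 (dd i) t)
  = t ^+ 3 * (a i t * a (i + 1) t * a (i + 2%:R) t) - t * a i t * dd i t
    + t * a (i + 1) t * dd (i + 1) t + t * a (i + 2%:R) t * dd (i + 2%:R) t.

Let oT : open [set: R] := openT.
Let a_neq0 i t : a i t != 0. Proof. exact: lt0r_neq0. Qed.

(** Dividing the [i]-th equation by [t a_j a_k] leaves coefficients equal to [-4], [2], [2] at 0.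
    These functions are the remainders divided by [t], freed of negative powers of [t] through
    [a = 1/2 + t^2 e]; for instance [1 / a_k - 2 = - 2 t^2 e_k / a_k]. *)
Let p i (t : R) := t * a i t.
Let q i (t : R) :=
  - (t * (ee i t - ee (i + 1) t - ee (i + 2%:R) t - 2 * t ^+ 2 * (ee (i + 1) t * ee (i + 2%:R) t))
     * ((a (i + 1) t)^-1 * (a (i + 2%:R) t)^-1))
  - (derive1 (a (i + 1)) t * (a (i + 1) t)^-1 + derive1 (a (i + 2%:R)) t * (a (i + 2%:R) t)^-1).
Let r (i : 'I_3) (t : R) := - 2 * (t * (ee (i + 2%:R) t * (a (i + 2%:R) t)^-1)).
Let s (i : 'I_3) (t : R) := - 2 * (t * (ee (i + 1) t * (a (i + 1) t)^-1)).

(** The hypothesis covers [t > 0]; negative times follow by reflection, both sides being even, and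
    at 0 the rows [(-4, 2, 2)] annihilate the common initial value. *)
Lemma coclosed_singular i t : t * derive1 (dd i) t =
  2 * dd (i + 1) t + 2 * dd (i + 2%:R) t + -4 * dd i t + t * affine_rhs p q r s dd i t.
Proof.
have pos t' : 0 < t' -> t' * derive1 (dd i) t' =
    2 * dd (i + 1) t' + 2 * dd (i + 2%:R) t' + -4 * dd i t' + t' * affine_rhs p q r s dd i t'.
  move=> t0; have h := coclosed i t0.
  have tn0 := lt0r_neq0 t0.
  have eE j : ee j t' = (a j t' - 2^-1) / t' ^+ 2.
    by rewrite aE addrAC subrr add0r mulrAC divff ?mul1r // expf_neq0.
  apply: (mulfI (_ : t' * (a (i + 1) t' * a (i + 2%:R) t') != 0)); first by rewrite !mulf_neq0.
  have -> : t' * (a (i + 1) t' * a (i + 2%:R) t') * (t' * derive1 (dd i) t') =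
    t' ^+ 3 * (a i t' * a (i + 1) t' * a (i + 2%:R) t') - t' * a i t' * dd i t'
    + t' * a (i + 1) t' * dd (i + 1) t' + t' * a (i + 2%:R) t' * dd (i + 2%:R) t'
    - 2 * t' * (a (i + 1) t' * a (i + 2%:R) t' * dd i t')
    - t' ^+ 2 * (derive1 (a (i + 1)) t' * a (i + 2%:R) t' * dd i t' +
     a (i + 1) t' * derive1 (a (i + 2%:R)) t' * dd i t') by rewrite -h; ring.
  rewrite /affine_rhs /p /q /r /s !eE.
  move: (a_neq0 i t') (a_neq0 (i + 1) t') (a_neq0 (i + 2%:R) t').
  move: (derive1 (a (i + 1)) t') (derive1 (a (i + 2%:R)) t') => v' w'.
  move: (a i t') (a (i + 1) t') (a (i + 2%:R) t') (dd i t') (dd (i + 1) t') (dd (i + 2%:R) t').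
  move=> u v w x y z u0 v0 w0.
  by field; rewrite tn0 v0 w0.
have [t0|t0|->] := ltrgt0P t.
- exact: pos.
- have := pos (- t); rewrite oppr_gt0 => /(_ t0).
  rewrite /affine_rhs /p /q /r /s !ea !eve !ed !derive1_opp_even // sqrrN => h.
  have -> : t * derive1 (dd i) t = - t * - derive1 (dd i) t by rewrite mulrNN.
  by rewrite h; ring.
- by rewrite !mul0r addr0 (dd0 (i + 1) i) (dd0 (i + 2%:R) i); ring.
Qed.

Let sI : smooth (setT : set R) (fun t : R => t). Proof. exact: smooth_id. Qed.
Let sX n : smooth (setT : set R) (fun t : R => t ^+ n). Proof. exact: smooth_id_pow. Qed.
Let sc (c : R) : smooth (setT : set R) (fun _ : R => c). Proof. exact: smooth_cst. Qed.
Let sa' i : smooth (setT : set R) (derive1 (a i)). Proof. exact: smooth1_derive. Qed.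
Let sV i : smooth (setT : set R) (fun t => (a i t)^-1). Proof. exact: smoothV. Qed.

Let sp i : smooth (setT : set R) (p i). Proof. exact: smoothM. Qed.
Let sq i : smooth (setT : set R) (q i).
Proof.
rewrite /q; repeat first [done | apply: (smoothB oT) | apply: (smoothN oT)
  | apply: (smoothD oT) | apply: (smoothM oT)].
Qed.
Let sr i : smooth (setT : set R) (r i).
Proof. by rewrite /r; repeat first [done | apply: (smoothM oT)]. Qed.
Let ss i : smooth (setT : set R) (s i).
Proof. by rewrite /s; repeat first [done | apply: (smoothM oT)]. Qed.

Section Gevrey.
Variable x : R.
Let D := [set t : R | 0 <= t].
Hypothesis Dx : D x.
Let DT : D `<=` [set: R]. Proof. by []. Qed.
Hypotheses (ga : forall i, gevrey D x (a i)) (ge : forall i, gevrey D x (ee i)).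

Let gI : gevrey D x (fun t : R => t). Proof. exact: gevrey_id. Qed.
Let gX n : gevrey D x (fun t : R => t ^+ n). Proof. exact: gevreyX. Qed.
Let gc (c : R) : gevrey D x (fun _ : R => c). Proof. exact: gevrey_cst. Qed.
Let ga' i : gevrey D x (derive1 (a i)). Proof. exact: gevrey_derive. Qed.
Let gV i : gevrey D x (fun t => (a i t)^-1). Proof. exact: (gevreyV oT DT Dx). Qed.

Lemma gevrey_coclosed_coef i :
  [/\ gevrey D x (p i), gevrey D x (q i), gevrey D x (r i) & gevrey D x (s i)].
Proof.
by split; rewrite /p /q /r /s; repeat first [done
  | apply: (gevreyB oT DT) | apply: (gevreyN oT DT) | apply: (gevreyD oT DT) | apply: (gevreyM oT DT)
  | apply: (smoothB oT) | apply: (smoothN oT) | apply: (smoothD oT) | apply: (smoothM oT)].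
Qed.

End Gevrey.

Lemma gevrey_coclosed (x : R) : 0 <= x ->
  (forall i, gevrey [set t | 0 <= t] x (a i)) -> (forall i, gevrey [set t | 0 <= t] x (ee i)) ->
  forall i, gevrey [set t | 0 <= t] x (dd i).
Proof.
move=> x0 ga ge; have g i := gevrey_coclosed_coef x0 ga ge i.
have DT : [set t : R | 0 <= t] `<=` [set: R] by [].
move: x0; rewrite le_eqVlt => /orP[/eqP x0|x0].
  rewrite -x0 in g *.
  have [r1 [C1 [rho1 [r10 C10 rho11 H1]]]] := gevrey4_common g.
  have [r2 [C [r20 C0 HC]]] := local_bound sd (I : [set: R] 0).
  have C1' := ltW C10.
  pose r0 := Num.min r1 r2.
  apply: (@gevrey_singular_ode R _ dd (affine_rhs p q r s dd) r0 C rho1 (25 * C1)) => //.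
  - by move=> i; exact: smooth_affine_rhs.
  - exact: coclosed_singular.
  - by rewrite lt_min r10.
  - by lra.
  - by rewrite mulr_gt0.
  - by move=> i t [_]; rewrite lt_min => /andP[_]; exact: HC.
  move=> J JI rho C' N hrho CC' hy i.
  have IT : J `<=` [set: R] by [].
  apply: (jbnd_affine_rhs oT sp sq sr ss sd IT) => //; try lra.
  have r01 : r0 <= r1 by rewrite ge_min lexx.
  move=> k; have [h1 h2 h3 h4] := H1 r0 rho N r01 hrho k.
  by split; apply: (jbnd_subset JI).
(* Away from 0 the factor [1 / t] satisfies the bounds too, and the system is a regular affine
   ODE. *)
pose U := [set t : R | 0 < t].
have oU : open U by exact: open_gt.
have toD (f : R -> R) : gevrey U x f -> gevrey [set t | 0 <= t] x f.
  move=> [r0 [C [rho [r00 C0 rho1 H]]]]; exists (Num.min r0 x), C, rho; split => //; first by rewrite lt_min r00.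
  move=> N n t nN [Dt]; rewrite lt_min => /andP[tr tx]; apply: (H N) => //; split => //=.
  by rewrite /U /=; move: tx; rewrite ltr_norml => /andP[]; lra.
have ofD (f : R -> R) : gevrey [set t | 0 <= t] x f -> gevrey U x f.
  move=> [r0 [C [rho [r00 C0 rho1 H]]]]; exists r0, C, rho; split => // N n t nN [Ut tr].
  by apply: (H N) => //; split => //; exact: ltW.
have UU : U `<=` U by [].
have sU (f : R -> R) : smooth (setT : set R) f -> smooth U f by exact: smooth_sub.
have sinv : smooth U (fun t : R => t^-1).
  by apply: smoothV => // [y y0|]; [exact: lt0r_neq0|exact: sU].
have ginv : gevrey U x (fun t : R => t^-1).
  by apply: (gevreyV oU UU x0) => // [|y y0|]; [exact: sU|exact: lt0r_neq0|exact: gevrey_id].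
move=> i; apply: toD.
apply: (@gevrey_affine_ode R U U p (fun i t => q i t + -4 * t^-1) (fun i t => r i t + 2 * t^-1)
  (fun i t => s i t + 2 * t^-1) dd oU UU) => //.
- by move=> j; exact: sU.
- by move=> j; apply: smoothD => //; [exact: sU|exact: smoothZ].
- by move=> j; apply: smoothD => //; [exact: sU|exact: smoothZ].
- by move=> j; apply: smoothD => //; [exact: sU|exact: smoothZ].
- by move=> j; exact: sU.
- move=> j; have [g1 g2 g3 g4] := g j.
  split; first exact: ofD.
  + by apply: (gevreyD oU UU) => //; [exact: sU|exact: smoothZ|exact: ofD|exact: (gevreyZ oU UU)].
  + by apply: (gevreyD oU UU) => //; [exact: sU|exact: smoothZ|exact: ofD|exact: (gevreyZ oU UU)].
  + by apply: (gevreyD oU UU) => //; [exact: sU|exact: smoothZ|exact: ofD|exact: (gevreyZ oU UU)].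
move=> j t t0; have tn0 := lt0r_neq0 t0.
apply: (mulfI tn0); rewrite coclosed_singular /affine_rhs.
by move: (p j t) (q j t) (r j t) (s j t) => pp qq rr s0; field.
Qed.

End CoclosedODE.

(** * Even coefficient functions of the geometric data *)

Section CoefficientData.
Context {R : realType}.

Lemma smooth_parity_global (b : bool) (f : R -> R) : smooth_parity b f ->
  exists g, [/\ smooth (setT : set R) g, forall t, 0 <= t -> g t = f t &
    forall t, g (- t) = if b then - g t else g t].
Proof.
move=> [g [sg gf pg]]; exists (parity_ext b g); split.
- exact: smooth_parity_ext.
- by move=> t t0; rewrite /parity_ext t0 gf.
- by move=> t; apply: parity_ext_opp => bt; apply: (pg 0%N); rewrite bt.
Qed.

(* [a i] extends [A i / t], [be i] extends [B i], and [al i] is the regular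
   part of the coefficients of the instanton ODE. *)
Record coef_data (A B : 'I_3 -> R -> R) (a3 : 'I_3 -> R) (b0 : R)
    (a be al : 'I_3 -> R -> R) : Prop := CoefData {
  cd_sa : forall i, smooth (setT : set R) (a i);
  cd_ea : forall i t, a i (- t) = a i t;
  cd_a0 : forall i t, 0 < a i t;
  cd_A : forall i (t : R), 0 <= t -> A i t = t * a i t;
  cd_a00 : forall i, a i 0 = 2^-1;
  cd_sb : forall i, smooth (setT : set R) (be i);
  cd_b0 : forall i t, 0 < be i t;
  cd_B : forall i (t : R), 0 <= t -> B i t = be i t;
  cd_be0 : forall i, be i 0 = b0;
  cd_sal : forall i, smooth (setT : set R) (al i);
  cd_eal : forall i t, al i (- t) = al i t;
  cd_al0 : forall i : 'I_3, al i 0 = 4 * (a3 (i + 1) + a3 (i + 2%:R)) + (2 * b0 ^+ 2)^-1;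
  cd_ode : forall (i : 'I_3) (t : R), 0 < t ->
    derive1 (A i) t / A i t + A i t / (B (i + 1) t * B (i + 2%:R) t)
    - A i t / (A (i + 1) t * A (i + 2%:R) t) = - t^-1 + t * al i t;
  cd_gevrey : (forall i, real_analytic_on `[0, +oo[%classic (A i)) ->
    forall x : R, 0 <= x -> forall i, gevrey [set t | 0 <= t] x (al i)
}.

Lemma coef_data_ex (A B : 'I_3 -> R -> R) (a3 : 'I_3 -> R) (b0 : R)
  (hA : forall i, smooth_odd (A i))
  (hApos : forall i t, 0 < t -> 0 < A i t)
  (hAdot : forall i, (fun t => A i t / t) @ 0^'+ --> (2^-1 : R))
  (hA3 : forall i, exists C : R, \forall t \near 0^'+,
           `|A i t - (t / 2 + a3 i * t ^+ 3)| <= C * t ^+ 5)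
  (hb0 : 0 < b0)
  (hB : forall i, smooth_even (B i))
  (hBpos : forall i t, 0 <= t -> 0 < B i t)
  (hB0 : forall i, B i 0 = b0)
  (hAB : coclosed_equations A B) :
  exists a be al, coef_data A B a3 b0 a be al.
Proof.
have /choice[Ae HAe] : forall i, exists g, [/\ smooth (setT : set R) g, forall t, 0 <= t -> g t = A i t &
    forall t, g (- t) = - g t] by move=> i; exact: smooth_parity_global (hA i).
have /choice[be Hbe] : forall i, exists g, [/\ smooth (setT : set R) g, forall t, 0 <= t -> g t = B i t &
    forall t, g (- t) = g t] by move=> i; exact: smooth_parity_global (hB i).
have oT : open [set: R] := openT.
have T (x : R) : [set: R] x := I.
have bT (t s : R) : [set: R] t -> `|s| <= `|t| -> [set: R] s by [].
have sA i : smooth (setT : set R) (Ae i) by have [] := HAe i.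
have Ae0 i : Ae i 0 = 0.
  by have [_ _ /(_ 0)] := HAe i; rewrite oppr0; lra.
pose a i := quo (Ae i).
have sa i : smooth (setT : set R) (a i) by exact: (smooth_quo oT (sA i) (Ae0 i) bT).
have ea i t : a i (- t) = a i t by apply: quo_even; have [] := HAe i.
have aA i (t : R) : 0 <= t -> A i t = t * a i t.
  by move=> t0; have [_ AeA _] := HAe i; rewrite mul_quo // AeA.
have apos i (t : R) : 0 < t -> 0 < a i t.
  by move=> t0; have := hApos i t t0; rewrite (aA i t (ltW t0)) pmulr_rgt0.
have a00 i : a i 0 = 2^-1.
  have ca : {for (0 : R), continuous (a i)} by exact: smooth_continuous (sa i) (T 0).
  have h1 : a i t @[t --> 0^'+] --> a i 0 by exact: cvg_at_right_filter.
  have h2 : a i t @[t --> 0^'+] --> (2^-1 : R).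
    apply: cvg_trans (hAdot i); apply: near_eq_cvg; near=> t.
    have t0 : 0 < t by near: t; exact: nbhs_right_gt.
    by rewrite aA ?ltW // mulrAC divff ?mul1r // lt0r_neq0.
  exact: (cvg_unique _ h1 h2).
have a0 i t : 0 < a i t.
  have [t0|t0|->] := ltrgt0P t; [exact: apos| |by rewrite a00 invr_gt0].
  by rewrite -ea; apply: apos; rewrite oppr_gt0.
pose ee i := equo (a i).
have se i : smooth (setT : set R) (ee i) by exact: (smooth_equo oT (T 0) (sa i) (ea i) bT).
have aE i t : a i t = 2^-1 + t ^+ 2 * ee i t.
  by rewrite {1}(equoE oT (T 0) (sa i) (ea i)) a00.
have eve i t : ee i (- t) = ee i t by exact: (equo_even oT (T 0) (sa i) (ea i)).
(* Since [A_i = t * a_i = t / 2 + t^3 * ee i], the hypothesis says that [ee i - a3 i] is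
   [O(t^2)]. *)
have ee0 i : ee i 0 = a3 i.
  have [C HC] := hA3 i.
  have ce : {for (0 : R), continuous (ee i)} by exact: smooth_continuous (se i) (T 0).
  have h1 : ee i t @[t --> 0^'+] --> ee i 0 by exact: cvg_at_right_filter.
  have h2 : ee i t @[t --> 0^'+] --> a3 i.
    have h3 : C * t ^+ 2 @[t --> 0^'+] --> (C * 0 ^+ 2 : R).
      apply: cvg_at_right_filter; apply: cvgM; first exact: cvg_cst.
      exact: exprn_continuous.
    apply/cvgrPdist_le => e e0; move: h3; rewrite expr0n mulr0 => /cvgrPdist_le /(_ e e0) h3.
    near=> t; have t0 : 0 < t by near: t; exact: nbhs_right_gt.
    have h4 : `|0 - C * t ^+ 2| <= e by near: t; exact: h3.
    have h5 : `|A i t - (t / 2 + a3 i * t ^+ 3)| <= C * t ^+ 5 by near: t; exact: HC.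
    rewrite sub0r normrN in h4; apply: le_trans h4; apply: le_trans (ler_norm _).
    move: h5; rewrite (aA i t (ltW t0)) aE.
    have -> : t * (2^-1 + t ^+ 2 * ee i t) - (t / 2 + a3 i * t ^+ 3) = - (t ^+ 3 * (a3 i - ee i t)) by ring.
    have -> : C * t ^+ 5 = t ^+ 3 * (C * t ^+ 2) by ring.
    by rewrite normrN normrM (gtr0_norm (exprn_gt0 _ t0)) ler_pM2l // exprn_gt0.
  exact: (cvg_unique _ h1 h2).
have sb i : smooth (setT : set R) (be i) by have [] := Hbe i.
have bB i (t : R) : 0 <= t -> B i t = be i t by move=> t0; have [_ -> ] := Hbe i.
have eb i t : be i (- t) = be i t by have [] := Hbe i.
have b_pos i t : 0 < be i t.
  have [t0|t0|->] := ltrgt0P t.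
  - by rewrite -bB ?ltW //; apply: hBpos; exact: ltW.
  - by rewrite -eb -bB ?oppr_ge0 ?ltW //; apply: hBpos; rewrite oppr_ge0 ltW.
  - by rewrite -bB // hB0.
pose dd (i : 'I_3) (t : R) := be (i + 1) t * be (i + 2%:R) t.
have sd i : smooth (setT : set R) (dd i) by exact: smoothM.
have ed i t : dd i (- t) = dd i t by rewrite /dd !eb.
have d0 i t : 0 < dd i t by rewrite mulr_gt0.
have dd0 i : dd i 0 = b0 ^+ 2 by rewrite /dd -!bB // !hB0 expr2.
have dA i (t : R) : 0 < t -> derive1 (A i) t = a i t + t * derive1 (a i) t.
  move=> t0; have oP : open [set s : R | 0 < s] by exact: open_gt.
  rewrite (derive1_ext_open oP t0 (g := fun s => s * a i s)); last by move=> s s0; rewrite aA ?ltW.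
  by rewrite (is_derive1P (isdM (isd_id t) (smooth1_is_derive (sa i) (T t)))) mul1r.
have coclosed (i : 'I_3) (t : R) : 0 < t ->
  2 * t * (a (i + 1) t * a (i + 2%:R) t * dd i t) +
  t ^+ 2 * (derive1 (a (i + 1)) t * a (i + 2%:R) t * dd i t +
     a (i + 1) t * derive1 (a (i + 2%:R)) t * dd i t + a (i + 1) t * a (i + 2%:R) t * derive1 (dd i) t)
  = t ^+ 3 * (a i t * a (i + 1) t * a (i + 2%:R) t) - t * a i t * dd i t
    + t * a (i + 1) t * dd (i + 1) t + t * a (i + 2%:R) t * dd (i + 2%:R) t.
  move=> t0; have := hAB i t t0; have oP : open [set s : R | 0 < s] by exact: open_gt.
  have t00 := ltW t0.
  rewrite /= (derive1_ext_open oP t0 (g := fun s => s ^+ 2 * (a (i + 1) s * a (i + 2%:R) s * dd i s))); last first.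
    by move=> s s0; rewrite !aA ?(ltW s0) // !bB ?(ltW s0) // /dd; ring.
  have da j := smooth1_is_derive (sa j) (T t).
  have D := isdM (isdX 1 t) (isdM (isdM (da (i + 1)) (da (i + 2%:R))) (smooth1_is_derive (sd i) (T t))).
  have [e1 e2 e3 e4] := ord3_eqs i.
  rewrite (is_derive1P D) (prod3_cycle (fun j => A j t) i) !aA // !bB // expr1 => h.
  have dd1 : dd (i + 1) t = be (i + 2%:R) t * be i t by rewrite /dd e1 e2.
  have dd2 : dd (i + 2%:R) t = be i t * be (i + 1) t by rewrite /dd e3 e4.
  rewrite dd1 dd2.
  transitivity (2 * t * (a (i + 1) t * a (i + 2%:R) t * dd i t) + t ^+ 2 *
    ((derive1 (a (i + 1)) t * a (i + 2%:R) t + a (i + 1) t * derive1 (a (i + 2%:R)) t) * dd i t +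
      a (i + 1) t * a (i + 2%:R) t * derive1 (dd i) t)); first by ring.
  by rewrite h /dd; ring.
exists a, be, (alpha a ee dd); split => //.
- by move=> i; rewrite -bB.
- by move=> i; exact: smooth_alpha.
- by move=> i t; exact: alpha_even.
- by move=> i; rewrite alpha_at0 // !ee0 dd0.
- move=> i t t0; have t00 := ltW t0; have tn0 := lt0r_neq0 t0.
  rewrite -alphaE // dA // !aA // !bB // -/(dd i t).
  move: (lt0r_neq0 (a0 i t)) (lt0r_neq0 (a0 (i + 1) t)) (lt0r_neq0 (a0 (i + 2%:R) t)) (lt0r_neq0 (d0 i t)).
  move: (a i t) (a (i + 1) t) (a (i + 2%:R) t) (dd i t) (derive1 (a i) t) => u v w d u' u0 v0 w0 dn0.
  by field; rewrite tn0 u0 v0 w0 dn0.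
move=> anA x x0 i.
have cD (s t u : R) : [set t : R | 0 <= t] s -> [set t : R | 0 <= t] t -> s <= u <= t -> [set t : R | 0 <= t] u.
  by move=> /= s0 _ /andP[su _]; exact: le_trans su.
have DT : [set t : R | 0 <= t] `<=` [set: R] by [].
have ga j : gevrey [set t | 0 <= t] x (a j).
  apply: (gevrey_quo oT DT (sA j) (Ae0 j) bT (lexx _ : [set t : R | 0 <= t] 0) cD x0).
  have [|r r0 [c Hc]] := anA j x; first by rewrite /= in_itv /= x0.
  apply: (analytic_gevrey (r := r) (c := c)) => // t t0 tr.
  have [_ -> // _] := HAe j; apply: Hc => //.
  by rewrite /= in_itv /= t0.
have ge j : gevrey [set t | 0 <= t] x (ee j).
  exact: (gevrey_equo oT (T 0) (sa j) (ea j) bT DT (lexx _ : [set t : R | 0 <= t] 0) cD x0 (ga j)).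
have gd j : gevrey [set t | 0 <= t] x (dd j).
  apply: (gevrey_coclosed sa se sd ea eve ed a0 aE _ coclosed x0 ga ge).
  by move=> k l; rewrite !dd0.
exact: gevrey_alpha.
Unshelve. all: by end_near. Qed.

End CoefficientData.

(** * Family members and solutions of the reduced system *)

Section FamilyReduced.
Context {R : realType}.
Variables (A B : 'I_3 -> R -> R) (a3 : 'I_3 -> R) (b0 : R) (a be al : 'I_3 -> R -> R).
Hypothesis hb0 : 0 < b0.
Hypothesis cd : coef_data A B a3 b0 a be al.

(** The derivative of [t V_i] produces a term [V_i], cancelled by the [- V_i] that comes from the
    pole [- 1 / t]; a common factor [t] remains and is divided out. *)
Lemma instanton_ODE_reduced (fp V : 'I_3 -> R -> R) (e : R) : 
  (forall i (t : R), 0 < t < e -> fp i t = t * V i t) ->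
  (forall i (t : R), 0 < t < e -> derivable (V i) t 1) ->
  instanton_ODE A B e fp <->
  (forall i (t : R), 0 < t < e ->
     derive1 (V i) t = - t * (al i t * V i t + V (i + 1) t * V (i + 2%:R) t)).
Proof.
move=> fV dV; have oU : open `]0, e[%classic by exact: itv_open.
have dfp i (t : R) : 0 < t < e -> derive1 (fp i) t = V i t + t * derive1 (V i) t.
  move=> te; have Ut : `]0, e[%classic t by rewrite /= in_itv.
  rewrite (derive1_ext_open oU Ut (g := fun s => s * V i s)); last first.
    by move=> s; rewrite /= in_itv /=; exact: fV.
  have D := derivableP (dV i t te); rewrite -derive1E in D.
  by rewrite (is_derive1P (isdM (isd_id t) D)) mul1r.
split=> H i t te; have := H i t te; have t0 : 0 < t by case/andP: te.
  rewrite /= (cd_ode cd) // dfp // !fV //; have tn0 := lt0r_neq0 t0 => h.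
  apply: (mulfI tn0); move: h.
  move: (derive1 (V i) t) (V i t) (V (i + 1) t) (V (i + 2%:R) t) (al i t) => d v w x y h.
  have -> : t * d = v + t * d + (- t^-1 + t * y) * (t * v) - t ^+ 2 * y * v by field.
  by rewrite h; ring.
move=> h /=; rewrite (cd_ode cd) // dfp // !fV // h.
have tn0 := lt0r_neq0 t0.
by move: (V i t) (V (i + 1) t) (V (i + 2%:R) t) (al i t) => v w x y; field.
Qed.

(** Built from the values of [fp] at positive times only, since those elsewhere are arbitrary, with
    the parameter as value at 0. *)
Definition even_quotient (c : 'I_3 -> R) (fp : 'I_3 -> R -> R) (i : 'I_3) (t : R) : R :=
  if t == 0 then c i else fp i `|t| / `|t|.

(** The quadratic bound supplies the point 0: it makes the quotient differentiable there with slope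
    0, which is what the reduced equation asks at [t = 0]. Family members and smoothly extending
    instantons both satisfy it. *)
Lemma reduced_sol_quotient (e : R) (c : 'I_3 -> R) (fp : 'I_3 -> R -> R) :
  instanton_ODE A B e fp ->
  (forall i (t : R), 0 < t < e -> derivable (fp i) t 1) ->
  (forall i, exists C r : R, 0 < r /\ forall t : R, 0 < t < r -> `|fp i t / t - c i| <= C * t ^+ 2) ->
  reduced_sol al e c (even_quotient c fp).
Proof.
move=> ode dfp fp0; pose V := even_quotient c fp.
have Vpos i (t : R) : 0 < t -> V i t = fp i t / t.
  by move=> t0; rewrite /V /even_quotient gt_eqF // gtr0_norm.
have eV i (t : R) : V i (- t) = V i t by rewrite /V /even_quotient oppr_eq0 normrN.
have oU : open `]0, e[%classic by exact: itv_open.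
have dV i (t : R) : 0 < t < e -> derivable (V i) t 1.
  move=> te; have Ut : `]0, e[%classic t by rewrite /= in_itv.
  have tn0 : t != 0 by case/andP: te => /lt0r_neq0.
  apply: (derivable_ext_open oU Ut (f := fun s => fp i s * s^-1)).
    by move=> s; rewrite /= in_itv /= => /andP[s0 _]; rewrite Vpos.
  have [] : is_derive t 1 (fun s => fp i s * s^-1) (derive1 (fp i) t * t^-1 + fp i t * (- 1 / t ^+ 2)) => //.
  apply: isdM; last exact: (isdV tn0 (isd_id t)).
  by rewrite derive1E; apply: derivableP; exact: dfp.
have fV i (t : R) : 0 < t < e -> fp i t = t * V i t.
  by move=> /andP[t0 _]; rewrite Vpos // mulrCA divff ?mulr1 // lt0r_neq0.
have odeV := (instanton_ODE_reduced fV dV).1 ode.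
have Dpos i (t : R) : 0 < t < e -> is_derive t 1 (V i) (- t * (al i t * V i t + V (i + 1) t * V (i + 2%:R) t)).
  by move=> te; rewrite -odeV // derive1E; apply: derivableP; exact: dV.
split=> [i|i t|i t te].
- by rewrite /even_quotient eqxx.
- exact: eV.
rewrite -/V; have [t0|t0|t0] := ltrgt0P t.
- by apply: Dpos; rewrite t0 (le_lt_trans (ler_norm t)).
- have E : V i = fun s => V i (- s) by apply/funext => s; rewrite eV.
  have D := Dpos i (- t); rewrite oppr_gt0 t0 /= (_ : - t < e) in D; last by rewrite -ltr0_norm.
  rewrite E; apply: isd_eq (isd_comp (f := V i) (g := fun s => - s) (D isT) (isdN (isd_id t))) _.
  by rewrite /= !eV (cd_eal cd); ring.
rewrite t0 oppr0 mul0r; apply/is_derive_near_bound => d d0.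
have [C [r [r0 HC]]] := fp0 i.
pose C1 := `|C| + 1; have C10 : 0 < C1 by rewrite ltr_wpDl.
exists (Num.min r (d / C1)); first by rewrite lt_min r0 divr_gt0.
move=> h; rewrite lt_min => /andP[hr hd]; rewrite add0r mul0r subr0.
have V0 : V i 0 = c i by rewrite /V /even_quotient eqxx.
have [->|h0] := eqVneq h 0; first by rewrite subrr normr0 mulr0.
have hn : 0 < `|h| by rewrite normr_gt0.
have -> : V i h = fp i `|h| / `|h| by rewrite /V /even_quotient (negbTE h0).
rewrite V0; apply: (le_trans (HC _ _)); first by rewrite hn.
rewrite expr2 mulrA ler_pM2r //; apply: (@le_trans _ _ (C1 * `|h|)).
  by rewrite ler_pM2r //; have := ler_norm C; rewrite /C1; lra.
by rewrite mulrC -ler_pdivlMr // ltW.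
Qed.

Lemma family_of_reduced (e : R) (c : 'I_3 -> R) (fp V : 'I_3 -> R -> R) : 0 < e ->
  reduced_sol al e c V -> (forall i (t : R), 0 < t < e -> fp i t = t * V i t) ->
  family_member A B b0 a3 e c fp.
Proof.
move=> e0 HV fV; have [V0 eV dV] := HV.
have te0 (t : R) : 0 < t < e -> `|t| < e by move=> /andP[t0 te]; rewrite gtr0_norm.
have oU : open [set t : R | `|t| < e] by exact: open_norm_lt.
have U0 : [set t : R | `|t| < e] 0 by rewrite /= normr0.
have sV i := reduced_sol_smooth (cd_sal cd) HV i.
have su i : smooth [set t : R | `|t| < e] (equo (V i)).
  by apply: smooth_equo => //; exact: balanced_sym.
split.
  apply/(instanton_ODE_reduced fV) => [i t /te0 te|i t /te0 te].
    by have [] := dV i t te.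
  exact: is_derive1P (dV i t te).
exists (fun i => equo (V i)); split.
- move=> i t te; rewrite fV // {1}(equoE oU U0 (sV i) (eV i)).
  by rewrite V0; ring.
- move=> i; exists [set t : R | `|t| < e], (equo (V i)); split => // t.
  by rewrite /= in_itv /= => /andP[t0 te]; rewrite ger0_norm.
- move=> anA i x; rewrite /= in_itv /= => xe.
  pose D := [set t : R | 0 <= t < e].
  have DU : D `<=` [set t : R | `|t| < e] by move=> t /andP[t0 te]; rewrite /= ger0_norm.
  have cD (s t u : R) : D s -> D t -> s <= u <= t -> D u.
    by move=> /andP[s0 _] /andP[_ te] /andP[su' ut]; rewrite /D /= (le_trans s0) // (le_lt_trans ut).
  have D0 : D 0 by rewrite /D /= lexx.
  have Dx : D x by exact: xe.
  have gal := cd_gevrey cd anA (x := x); have x0 : 0 <= x by case/andP: xe.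
  have gV := reduced_sol_gevrey (cd_sal cd) HV xe (gal x0) i.
  have gu := gevrey_equo oU U0 (sV i) (eV i) (@balanced_sym _ e) DU D0 cD Dx gV.
  have [r r0 [c' Hc]] := gevrey_analytic oU DU (su i) cD Dx gu.
  exists r => //; exists c' => t; rewrite in_itv /= => te; exact: Hc.
move=> i; rewrite (equo_reduced_sol0 (cd_sal cd) HV) // (cd_al0 cd) /=.
by field; rewrite gt_eqF.
Qed.

Lemma reduced_of_family (e : R) (c : 'I_3 -> R) (fp : 'I_3 -> R -> R) : 0 < e ->
  family_member A B b0 a3 e c fp ->
  exists2 V, reduced_sol al e c V & forall i (t : R), 0 < t < e -> fp i t = t * V i t.
Proof.
move=> e0 [ode [u [fu su _ _]]]; exists (even_quotient c fp); last first.
  move=> i t /andP[t0 te]; rewrite /even_quotient gt_eqF // gtr0_norm //.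
  by rewrite mulrCA divff ?mulr1 // lt0r_neq0.
have oU : open `]0, e[%classic by exact: itv_open.
apply: reduced_sol_quotient => // [i t te|i].
  have [U [g [oU' sU sg gu]]] := su i.
  have Ut : `]0, e[%classic t by rewrite /= in_itv.
  have Dt : `[0, e[%classic t by move: te => /andP[t0 te]; rewrite /= in_itv /= ltW.
  apply: (derivable_ext_open oU Ut (f := fun s => c i * s + s ^+ 3 * g s)).
    move=> s; rewrite /= in_itv /= => se; rewrite fu // gu //.
    by move: se => /andP[s0 se]; rewrite /= in_itv /= ltW.
  by have [] := isdD (isdZ (c i) (isd_id t)) (isdM (isdX 2 t) (smooth1_is_derive sg (sU t Dt))).
have [U [g [oU' sU sg gu]]] := su i.
have D0 : `[0, e[%classic (0 : R) by rewrite /= in_itv /= lexx.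
have cg : {for (0 : R), continuous g} by exact: smooth_continuous sg (sU 0 D0).
have [r r0 Hr] := continuous_ball cg ltr01.
exists (`|g 0| + 1), (Num.min r e); split; first by rewrite lt_min r0.
move=> t /andP[t0]; rewrite lt_min => /andP[tr te].
rewrite fu ?t0 // -gu; last by rewrite /= in_itv /= ltW.
have -> : (c i * t + t ^+ 3 * g t) / t - c i = g t * t ^+ 2 by field; rewrite lt0r_neq0.
rewrite normrM (ger0_norm (sqr_ge0 t)) ler_wpM2r ?sqr_ge0 //.
have h : `|g t - g 0| < 1 by apply: Hr; rewrite subr0 gtr0_norm.
have := ler_normD (g t - g 0) (g 0); rewrite subrK; lra.
Qed.

End FamilyReduced.

(** * Curvature contracted with [psi] *)

Section FrameSets.
Context {R : realType}.

(* Sets of frame indices are handled through the ranks of their elements, on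
   which shuffle signs can be computed. *)
Definition fset_of_ranks (s : seq nat) : {set frame} := [set a | frame_rank a \in s].

Definition frame_of_rank (n : nat) : frame :=
  nth None [:: None; Some (true, 0); Some (true, 1); Some (true, 2%:R);
               Some (false, 0); Some (false, 1); Some (false, 2%:R)] n.

Lemma frame_rankK : cancel frame_rank frame_of_rank.
Proof.
by move=> [[[] [[|[|[|//]]] lt_i]]|] //; congr (Some (_, _)); exact: val_inj.
Qed.

Lemma frame_rank_inj : injective frame_rank.
Proof. exact: can_inj frame_rankK. Qed.

Lemma frame_rank_lt a : (frame_rank a < 7)%N.
Proof. by case: a => [[[] [[|[|[|//]]] lt_i]]|]. Qed.

Lemma frame_of_rankK n : (n < 7)%N -> frame_rank (frame_of_rank n) = n.
Proof. by case: n => [|[|[|[|[|[|[|]]]]]]]. Qed.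

Lemma fset_of_ranksU s s' : fset_of_ranks s :|: fset_of_ranks s' = fset_of_ranks (s ++ s').
Proof. by apply/finset.setP => a; rewrite !inE mem_cat. Qed.

Lemma fset_of_ranksD s s' : fset_of_ranks s :\: fset_of_ranks s' = fset_of_ranks [seq n <- s | n \notin s'].
Proof. by apply/finset.setP => a; rewrite !inE mem_filter. Qed.

Lemma fset_of_ranks1 (a : frame) : [set a]%SET = fset_of_ranks [:: frame_rank a].
Proof. by apply/finset.setP => b; rewrite !inE (inj_eq frame_rank_inj). Qed.

Lemma eq_fset_of_ranks s s' : s =i s' -> fset_of_ranks s = fset_of_ranks s'.
Proof. by move=> e; apply/finset.setP => b; rewrite !inE e. Qed.

Lemma sub_fset_of_ranks s s' : all (fun n => (n < 7)%N) s ->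
  (fset_of_ranks s \subset fset_of_ranks s') = all (mem s') s.
Proof.
move=> /allP s7; apply/fintype.subsetP/allP => [h n ns|h a].
  by have := h (frame_of_rank n); rewrite !inE frame_of_rankK ?s7 // => /(_ ns).
by rewrite !inE => /h.
Qed.

Lemma card_fset_of_ranks s : uniq s -> all (fun n => (n < 7)%N) s -> #|fset_of_ranks s| = size s.
Proof.
move=> us /allP s7.
have -> : fset_of_ranks s = [set x in map frame_of_rank s]%SET.
  apply/finset.setP => a; rewrite !inE; apply/idP/mapP => [h|[n ns ->]].
    by exists (frame_rank a) => //; rewrite frame_rankK.
  by rewrite frame_of_rankK ?s7.
rewrite cardsE; transitivity (size (map frame_of_rank s)); last by rewrite size_map.
apply/card_uniqP; rewrite map_inj_in_uniq // => m n /s7 m7 /s7 n7 /(congr1 frame_rank).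
by rewrite !frame_of_rankK.
Qed.

Definition inversions (s s' : seq nat) : nat :=
  count (fun p : nat * nat => (p.2 < p.1)%N) (allpairs pair s s').

Lemma shuffle_sign_ranks s s' : uniq s -> uniq s' ->
  all (fun n => (n < 7)%N) s -> all (fun n => (n < 7)%N) s' ->
  shuffle_sign (fset_of_ranks s) (fset_of_ranks s') = (-1) ^+ inversions s s' :> R.
Proof.
move=> us us' /allP s7 /allP s7'; rewrite /shuffle_sign /inversions -size_filter.
set L := seq.filter _ _; congr (_ ^+ _).
pose g (p : nat * nat) := (frame_of_rank p.1, frame_of_rank p.2).
have L7 p : p \in L -> (p.1 < 7)%N /\ (p.2 < 7)%N.
  rewrite mem_filter => /andP[_ /allpairsP[q [q1 q2 ->]]]; split; [exact: s7|exact: s7'].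
rewrite -(size_map g); rewrite -(card_uniqP _); last first.
  rewrite map_inj_in_uniq; first by rewrite filter_uniq // allpairs_uniq // => [[? ?] [? ?]].
  move=> [m n] [m' n'] /L7[/= m7 n7] /L7[/= m7' n7'] [/(congr1 frame_rank) + /(congr1 frame_rank)].
  by rewrite !frame_of_rankK // => -> ->.
apply: eq_card => -[a b]; rewrite !inE /=; apply/and3P/mapP => [[ha hb hab]|[[m n]]].
  exists (frame_rank a, frame_rank b); last by rewrite /g /= !frame_rankK.
  by rewrite mem_filter /= hab; apply/allpairsP; exists (frame_rank a, frame_rank b).
move=> mnL [-> ->]; have [/= m7 n7] := L7 _ mnL; rewrite !frame_of_rankK //.
by move: mnL; rewrite mem_filter /= => /andP[-> /allpairsP[[? ?] [/= ? ? [-> ->]]]].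
Qed.

Local Notation form := Defs.form.
Local Notation wedge := Defs.wedge.

Definition mono (S : {set frame}) : form R^o := [ffun I : {set frame} => (I == S)%:R].

Lemma wedge_mono_r (W : lmodType R) (al : form W) (S K : {set frame}) :
  wedge al (mono S) K =
  if S \subset K then shuffle_sign (K :\: S) S *: al (K :\: S) else 0.
Proof.
rewrite ffunE; have [SK|nSK] := boolP (S \subset K).
  have DD : K :\: (K :\: S) = S by rewrite finset.setDDr finset.setDv finset.set0U; apply/finset.setIidPr.
  rewrite (bigD1 (K :\: S)) ?finset.subsetDl //= big1 ?addr0; first by rewrite ffunE DD eqxx mulr1.
  move=> I /andP[IK nI]; rewrite ffunE; case: eqP => [E|_]; last by rewrite mulr0 scale0r.
  by move: nI; rewrite -E finset.setDDr finset.setDv finset.set0U (finset.setIidPr IK) eqxx.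
rewrite big1 // => I IK; rewrite ffunE; case: eqP => [E|_]; last by rewrite mulr0 scale0r.
by move: nSK; rewrite -E finset.subsetDl.
Qed.

Lemma wedge_mono (S S' : {set frame}) :
  wedge (mono S) (mono S') =
  (if [disjoint S & S'] then shuffle_sign S S' else 0) *: mono (S :|: S').
Proof.
apply/ffunP => K; rewrite wedge_mono_r !ffunE.
have [dSS|ndSS] := boolP [disjoint S & S'].
  have -> : (K == S :|: S') = (S' \subset K) && (K :\: S' == S).
    apply/eqP/andP => [->|[h /eqP <-]].
      rewrite finset.subsetUr finset.setDUl finset.setDv finset.setU0; split=> //; apply/eqP/finset.setDidPl.
      by [].
    by rewrite -{1}(finset.setID K S') (finset.setIidPr h) finset.setUC.
  case: (S' \subset K) => /=; last by rewrite scaler0.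
  by case: eqP => [->|_] //; rewrite !scaler0.
rewrite scale0r; case: ifP => // _; case: eqP => [E|_]; last by rewrite scaler0.
by case/negP: ndSS; apply/pred0P => x /=; rewrite -E !inE; case: (x \in S'); rewrite ?andbF.
Qed.

Lemma wedgeDl (W : lmodType R) (al al' : form W) be : wedge (al + al') be = wedge al be + wedge al' be.
Proof.
by apply/ffunP => K; rewrite !ffunE -big_split; apply: eq_bigr => I _; rewrite ffunE scalerDr.
Qed.

Lemma wedgeDr (W : lmodType R) (al : form W) be be' : wedge al (be + be') = wedge al be + wedge al be'.
Proof.
by apply/ffunP => K; rewrite !ffunE -big_split; apply: eq_bigr => I _; rewrite ffunE mulrDr scalerDl.
Qed.

Lemma wedgeZl (W : lmodType R) (c : R) (al : form W) be : wedge (c *: al) be = c *: wedge al be.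
Proof.
apply/ffunP => K; rewrite !ffunE scaler_sumr; apply: eq_bigr => I _.
by rewrite ffunE !scalerA mulrC.
Qed.

Lemma wedgeZr (W : lmodType R) (c : R) (al : form W) (be : form R^o) : wedge al (c *: be) = c *: wedge al be.
Proof.
apply/ffunP => K; rewrite !ffunE scaler_sumr; apply: eq_bigr => I _.
by rewrite ffunE !scalerA mulrCA.
Qed.

Lemma coframeE a : coframe a = mono (fset_of_ranks [:: frame_rank a]).
Proof. by rewrite -fset_of_ranks1. Qed.

Definition lt7 (s : seq nat) := uniq s && all (fun n => (n < 7)%N) s.

Lemma wedge_mono_ranks (s s' : seq nat) : lt7 s -> lt7 s' ->
  wedge (mono (fset_of_ranks s)) (mono (fset_of_ranks s')) =
  (if has (mem s) s' then 0 else (-1) ^+ inversions s s') *: mono (fset_of_ranks (s ++ s')).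
Proof.
move=> /andP[us s7] /andP[us' s7']; rewrite wedge_mono fset_of_ranksU shuffle_sign_ranks //.
suff -> : [disjoint fset_of_ranks s & fset_of_ranks s']%B = ~~ has (mem s) s' by case: has.
rewrite fintype.disjoint_sym fintype.disjoint_subset; apply/fintype.subsetP/hasPn => [h n ns|h a].
  have := h (frame_of_rank n); rewrite !inE frame_of_rankK; last exact: (allP s7' _ ns).
  by move=> /(_ ns).
by rewrite !inE => /h.
Qed.

Lemma wedge_mono_r_ranks (W : lmodType R) (al : form W) (s k : seq nat) : lt7 s -> lt7 k ->
  wedge al (mono (fset_of_ranks s)) (fset_of_ranks k) =
  (if all (mem k) s then (-1) ^+ inversions [seq n <- k | n \notin s] s else 0) *:
    al (fset_of_ranks [seq n <- k | n \notin s]).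
Proof.
move=> /andP[us s7] /andP[uk k7]; rewrite wedge_mono_r sub_fset_of_ranks //.
case: ifP => _; last by rewrite scale0r.
rewrite fset_of_ranksD shuffle_sign_ranks // ?filter_uniq //.
by apply/allP => n; rewrite mem_filter => /andP[_ /(allP k7)].
Qed.

End FrameSets.
Section CurvatureForm.
Context {R : realType}.
Local Notation form := Defs.form.
Local Notation wedge := Defs.wedge.

Lemma sum_ord3 (V : nmodType) (F : 'I_3 -> V) : \sum_i F i = F 0 + F 1 + F 2%:R.
Proof.
by rewrite !big_ord_recl big_ord0 addr0 addrA; congr (F _ + F _ + F _); exact: val_inj.
Qed.

Lemma eq_fset_sort (s s' : seq nat) : sort leq s = s' -> fset_of_ranks s = fset_of_ranks s'.
Proof. by move=> <-; apply: eq_fset_of_ranks => n; rewrite mem_sort. Qed.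

Variables (A B : 'I_3 -> R -> R).

Lemma coframe_ranks a n : frame_rank a = n -> coframe (R := R) a = mono (fset_of_ranks [:: n]).
Proof. by move=> <-; exact: coframeE. Qed.

Lemma wedge_mono_sort (s s' r : seq nat) (k : nat) : lt7 s -> lt7 s' -> ~~ has (mem s) s' ->
  sort leq (s ++ s') = r -> inversions s s' = k ->
  wedge (mono (R := R) (fset_of_ranks s)) (mono (fset_of_ranks s')) =
  (-1) ^+ k *: mono (fset_of_ranks r).
Proof.
move=> ls ls' /negbTE h e <-; rewrite wedge_mono_ranks // h.
by rewrite (eq_fset_sort e).
Qed.

Lemma wedge_mono_same (s : seq nat) : lt7 s -> has (mem s) s ->
  wedge (mono (R := R) (fset_of_ranks s)) (mono (fset_of_ranks s)) = 0.
Proof. by move=> ls h; rewrite wedge_mono_ranks // h scale0r. Qed.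

Lemma omegaE (t : R) : omega A B t =
  (- 4 * (A 0 t * B 0 t)) *: mono (fset_of_ranks [:: 1; 4]%N)
  + (- 4 * (A 1 t * B 1 t)) *: mono (fset_of_ranks [:: 2; 5]%N)
  + (- 4 * (A 2%:R t * B 2%:R t)) *: mono (fset_of_ranks [:: 3; 6]%N).
Proof.
have W i : wedge (coframe (R := R) (Some (false, i))) (coframe (Some (true, i))) =
    - mono (fset_of_ranks [:: (1 + i)%N; (4 + i)%N]).
  rewrite !coframeE -[RHS]scaleN1r -[-1]expr1.
  by case: i => [[|[|[|//]]] lt_i]; exact: wedge_mono_sort.
have W0 : wedge (coframe (Some (false, 0))) _ = - mono (fset_of_ranks [:: 1; 4]%N) := W 0.
have W1 : wedge (coframe (Some (false, 1))) _ = - mono (fset_of_ranks [:: 2; 5]%N) := W 1.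
have W2 : wedge (coframe (Some (false, 2%:R))) _ = - mono (fset_of_ranks [:: 3; 6]%N) := W 2%:R.
rewrite /omega sum_ord3 /etam /etap W0 W1 W2.
rewrite !scalerDr !scalerN !scalerA -!scaleNr.
move: (A 0 t) (A 1 t) (A 2%:R t) (B 0 t) (B 1 t) (B 2%:R t) => a0 a1 a2 b0 b1 b2.
by congr (_ *: _ + _ *: _ + _ *: _); ring.
Qed.

Lemma Omega2E (t : R) : Omega2 A B t =
  (- 8 * (A 0 t * A 1 t * A 2%:R t)) *: mono (fset_of_ranks [:: 1; 2; 3]%N)
  + (8 * (B 0 t * B 1 t * A 2%:R t)) *: mono (fset_of_ranks [:: 3; 4; 5]%N)
  + (8 * (B 1 t * B 2%:R t * A 0 t)) *: mono (fset_of_ranks [:: 1; 5; 6]%N)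
  + (- 8 * (B 2%:R t * B 0 t * A 1 t)) *: mono (fset_of_ranks [:: 2; 4; 6]%N).
Proof.
have [[E1 E2 E3] [E4 E5 E6]] := ord3_sums.
rewrite /Omega2 sum_ord3 E1 E2 E3 E4 E5 E6 /etam /etap.
rewrite (coframe_ranks (a := Some (true, 0)) (n := 1)) // (coframe_ranks (a := Some (true, 1)) (n := 2)) //.
rewrite (coframe_ranks (a := Some (true, 2%:R)) (n := 3)) // (coframe_ranks (a := Some (false, 0)) (n := 4)) //.
rewrite (coframe_ranks (a := Some (false, 1)) (n := 5)) // (coframe_ranks (a := Some (false, 2%:R)) (n := 6)) //.
rewrite (@wedge_mono_sort [:: 1] [:: 2] [:: 1; 2] 0)%N // (@wedge_mono_sort [:: 4] [:: 5] [:: 4; 5] 0)%N //.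
rewrite (@wedge_mono_sort [:: 5] [:: 6] [:: 5; 6] 0)%N // (@wedge_mono_sort [:: 6] [:: 4] [:: 4; 6] 1)%N //.
rewrite !wedgeZl (@wedge_mono_sort [:: 1; 2] [:: 3] [:: 1; 2; 3] 0)%N // (@wedge_mono_sort [:: 4; 5] [:: 3] [:: 3; 4; 5] 2)%N //.
rewrite (@wedge_mono_sort [:: 5; 6] [:: 1] [:: 1; 5; 6] 2)%N // (@wedge_mono_sort [:: 4; 6] [:: 2] [:: 2; 4; 6] 2)%N //.
move: (A 0 t) (A 1 t) (A 2%:R t) (B 0 t) (B 1 t) (B 2%:R t) => a0 a1 a2 b0 b1 b2.
move: (mono _) (mono _) (mono _) (mono _) => m1 m2 m3 m4.
apply/ffunP => K; rewrite !ffunE.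
move: (m1 K) (m2 K) (m3 K) (m4 K) => x1 x2 x3 x4.
by rewrite /GRing.scale /=; ring.
Qed.

(** Each cross term of [omega^2] occurs twice, which cancels the factor [1/2]; the squares
    vanish. *)
Lemma psiE (t : R) : psi A B t =
    (- 16 * (A 0 t * B 0 t * A 1 t * B 1 t)) *: mono (fset_of_ranks [:: 1; 2; 4; 5]%N)
  + (- 16 * (A 0 t * B 0 t * A 2%:R t * B 2%:R t)) *: mono (fset_of_ranks [:: 1; 3; 4; 6]%N)
  + (- 16 * (A 1 t * B 1 t * A 2%:R t * B 2%:R t)) *: mono (fset_of_ranks [:: 2; 3; 5; 6]%N)
  + (8 * (A 0 t * A 1 t * A 2%:R t)) *: mono (fset_of_ranks [:: 0; 1; 2; 3]%N)
  + (- 8 * (B 0 t * B 1 t * A 2%:R t)) *: mono (fset_of_ranks [:: 0; 3; 4; 5]%N)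
  + (- 8 * (B 1 t * B 2%:R t * A 0 t)) *: mono (fset_of_ranks [:: 0; 1; 5; 6]%N)
  + (8 * (B 2%:R t * B 0 t * A 1 t)) *: mono (fset_of_ranks [:: 0; 2; 4; 6]%N)%N.
Proof.
rewrite /psi omegaE Omega2E /dt (coframe_ranks (a := None) (n := 0)) //.
rewrite !(wedgeDl, wedgeDr, wedgeZl, wedgeZr).
rewrite !(@wedge_mono_same [:: 1; 4]%N, @wedge_mono_same [:: 2; 5]%N, @wedge_mono_same [:: 3; 6]%N) // !scaler0 add0r addr0 addr0.
rewrite (@wedge_mono_sort [:: 1; 4] [:: 2; 5] [:: 1; 2; 4; 5] 1)%N // (@wedge_mono_sort [:: 2; 5] [:: 1; 4] [:: 1; 2; 4; 5] 3)%N //.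
rewrite (@wedge_mono_sort [:: 1; 4] [:: 3; 6] [:: 1; 3; 4; 6] 1)%N // (@wedge_mono_sort [:: 3; 6] [:: 1; 4] [:: 1; 3; 4; 6] 3)%N //.
rewrite (@wedge_mono_sort [:: 2; 5] [:: 3; 6] [:: 2; 3; 5; 6] 1)%N // (@wedge_mono_sort [:: 3; 6] [:: 2; 5] [:: 2; 3; 5; 6] 3)%N //.
rewrite (@wedge_mono_sort [:: 0] [:: 1; 2; 3] [:: 0; 1; 2; 3] 0)%N // (@wedge_mono_sort [:: 0] [:: 3; 4; 5] [:: 0; 3; 4; 5] 0)%N //.
rewrite (@wedge_mono_sort [:: 0] [:: 1; 5; 6] [:: 0; 1; 5; 6] 0)%N // (@wedge_mono_sort [:: 0] [:: 2; 4; 6] [:: 0; 2; 4; 6] 0)%N //.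
move: (A 0 t) (A 1 t) (A 2%:R t) (B 0 t) (B 1 t) (B 2%:R t) => a0 a1 a2 b0 b1 b2.
move: (mono _) (mono _) (mono _) (mono _) (mono _) (mono _) (mono _) => m1 m2 m3 m4 m5 m6 m7.
apply/ffunP => K; rewrite !ffunE.
move: (m1 K) (m2 K) (m3 K) (m4 K) (m5 K) (m6 K) (m7 K) => x1 x2 x3 x4 x5 x6 x7.
rewrite /GRing.scale /=.
by field.
Qed.

End CurvatureForm.

Section CurvatureComponents.
Context {R : realType}.
Local Notation form := Defs.form.
Local Notation wedge := Defs.wedge.

Lemma pair_rank_eq (m n m' n' : nat) : (m < n)%N -> (m' < n')%N ->
  (m < 7)%N -> (n < 7)%N ->
  fset_of_ranks [:: m; n] = fset_of_ranks [:: m'; n'] -> m = m' /\ n = n'.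
Proof.
move=> mn mn' m7 n7 /setP E.
have := E (frame_of_rank m); have := E (frame_of_rank n).
rewrite !inE !frame_of_rankK // !eqxx orbT => /esym/orP[]/eqP en /esym/orP[]/eqP em; subst=> //.
- by rewrite ltnn in mn.
- by have := ltn_trans mn mn'; rewrite ltnn.
by rewrite ltnn in mn.
Qed.

Lemma curvature_ranks (theta : R -> form (quat R)) (t : R) (K : {set frame}) :
  curvature theta t K = \sum_(a : frame) \sum_(b : frame | (frame_rank a < frame_rank b)%N)
    (K == fset_of_ranks [:: frame_rank a; frame_rank b])%:R *: curvature_at theta t a b.
Proof.
rewrite sum_ffunE; apply: eq_bigr => a _; rewrite sum_ffunE; apply: eq_bigr => b ab.
rewrite ffunE !coframeE wedge_mono_ranks ?/lt7 /= ?frame_rank_lt //.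
rewrite /inversions /= ltnNge (ltnW ab) /= orbF inE eq_sym (ltn_eqF ab).
by rewrite expr0 scale1r ffunE.
Qed.

Lemma curvature_pair (theta : R -> form (quat R)) (t : R) (m n : nat) : (m < n < 7)%N ->
  curvature theta t (fset_of_ranks [:: m; n]) =
  curvature_at theta t (frame_of_rank m) (frame_of_rank n).
Proof.
move=> /andP[mn n7]; have m7 := ltn_trans mn n7; rewrite curvature_ranks.
rewrite (bigD1 (frame_of_rank m)) //= (bigD1 (frame_of_rank n)) /= ?frame_of_rankK //.
rewrite eqxx scale1r big1 ?addr0 => [|b /andP[bn nb]].
  rewrite big1 ?addr0 // => a nam; rewrite big1 // => b ab.
  case: eqP => [/pair_rank_eq[]// ema _|_]; last by rewrite scale0r.
  by rewrite ema frame_rankK eqxx in nam.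
case: eqP => [/pair_rank_eq[]// _ enb|_]; last by rewrite scale0r.
by rewrite enb frame_rankK eqxx in nb.
Qed.

Lemma curvature_not_pair (theta : R -> form (quat R)) (t : R) (K : {set frame}) :
  #|K| <> 2 -> curvature theta t K = 0.
Proof.
move=> K2; rewrite curvature_ranks big1 // => a _; rewrite big1 // => b ab.
case: eqP => [E|_]; last by rewrite scale0r.
case: K2; rewrite E card_fset_of_ranks //= ?frame_rank_lt //.
by rewrite inE neq_ltn ab.
Qed.

Variables (A B : 'I_3 -> R -> R) (T : 'I_3 -> quat R).
Hypothesis hT : standard_basis T.

Definition coef_of (fp fm : 'I_3 -> R -> R) (s : bool) (i : 'I_3) (t : R) : R :=
  if s then A i t * fp i t else B i t * fm i t.

Lemma on_frame_theta (fp fm : 'I_3 -> R -> R) (t : R) (a : frame) :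
  on_frame (theta_of A B T fp fm t) a =
  if a is Some (s, i) then coef_of fp fm s i t *: T i else 0.
Proof.
rewrite /on_frame /theta_of ffunE !sum_ffunE.
under eq_bigr do rewrite !ffunE (inj_eq set1_inj).
under [X in _ + X]eq_bigr do rewrite !ffunE (inj_eq set1_inj).
have S (s s' : bool) (j : 'I_3) (x : 'I_3 -> R) :
    \sum_i x i *: (((Some (s', j) == Some (s, i) :> frame)%:R : R^o) *: T i) =
    if s' == s then x j *: T j else 0.
  case: (eqVneq s' s) => [->|ns]; last first.
    rewrite big1 // => i _; case: eqP => [[e _]|_]; last by rewrite scale0r scaler0.
    by rewrite e eqxx in ns.
  rewrite (bigD1 j) //= eqxx scale1r big1 ?addr0 // => i ij.
  case: eqP => [[e]|_]; last by rewrite scale0r scaler0.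
  by rewrite e eqxx in ij.
case: a => [[[] i]|]; first by rewrite !S addr0.
  by rewrite !S add0r.
by rewrite !big1 ?addr0 // => i _ /=; rewrite scale0r scaler0.
Qed.

Lemma qcommZ (x y : R) (u v : quat R) : qcomm (x *: u) (y *: v) = (x * y) *: qcomm u v.
Proof.
by apply/rowP => l; case: l => -[|[|[|[|//]]]] lt_l; rewrite !mxE /= ?mxE; ring.
Qed.

Lemma curvature_at_theta (fp fm : 'I_3 -> R -> R) (t : R) (s s' : bool) (i j : 'I_3) :
  curvature_at (theta_of A B T fp fm) t (Some (s, i)) (Some (s', j)) =
  \sum_k (2 * levi_civita i j k *
    (coef_of fp fm s i t * coef_of fp fm s' j t - coef_of fp fm (s == s') k t)) *: T k.
Proof.
rewrite /curvature_at /= subr0 !on_frame_theta qcommZ; have [_ _ ->] := hT.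
have -> : \sum_(c : frame) bracket (Some (s, i)) (Some (s', j)) c *: on_frame (theta_of A B T fp fm t) c =
    \sum_k (2 * levi_civita i j k * coef_of fp fm (s == s') k t) *: T k.
  rewrite (bigD1 None) //= scale0r add0r.
  rewrite (reindex_omap (Some : bool * 'I_3 -> frame) id) /=; last by case.
  transitivity (\sum_(p : bool * 'I_3) (if p.1 == (s == s') then 2 * levi_civita i j p.2 else 0) *:
      on_frame (theta_of A B T fp fm t) (Some (p.1, p.2))).
    by apply: eq_big => [p|[s'' k] _] //=; rewrite eqxx.
  rewrite -(pair_bigA _ (fun s'' k => (if s'' == (s == s') then 2 * levi_civita i j k else 0) *:
    on_frame (theta_of A B T fp fm t) (Some (s'', k)))) big_bool /=.
  rewrite -big_split /=; apply: eq_bigr => k _; rewrite !on_frame_theta.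
  by case: (s == s'); rewrite /= scale0r ?addr0 ?add0r scalerA.
rewrite add0r -sumrN scaler_sumr -big_split /=; apply: eq_bigr => k _.
by rewrite scalerA -scaleNr -scalerDl; congr (_ *: _); ring.
Qed.

Lemma curvature_at_dt (fp fm : 'I_3 -> R -> R) (t : R) (s : bool) (i : 'I_3) :
  derivable (coef_of fp fm s i) t 1 ->
  curvature_at (theta_of A B T fp fm) t None (Some (s, i)) = derive1 (coef_of fp fm s i) t *: T i.
Proof.
move=> df; rewrite /curvature_at /= !on_frame_theta big1 => [|c _]; last by rewrite scale0r.
have -> : qcomm 0 (coef_of fp fm s i t *: T i) = 0.
  by rewrite -[X in qcomm X _](scale0r (T i)) qcommZ mul0r scale0r.
rewrite !subr0 addr0.
have -> : (fun u : R => on_frame (theta_of A B T fp fm u) (Some (s, i))) =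
    (fun u => coef_of fp fm s i u *: T i) by apply/funext => u; rewrite on_frame_theta.
by rewrite !derive1E; have [] := is_derive_scale (T i) df.
Qed.

(** Up to sign, the [T_i]-coefficient of [F /\ psi] on the 6-form that omits [eta_i^-]; [residual_m]
    belongs to the one that omits [eta_i^+]. *)
Definition residual_p (fp fm : 'I_3 -> R -> R) (i : 'I_3) (t : R) : R :=
  let j := i + 1 in let k := i + 2%:R in
  - 16 * (A j t * B j t * A k t * B k t) * derive1 (coef_of fp fm true i) t
  - 16 * (A i t * B j t * B k t) *
      (A j t * fp j t * (A k t * fp k t) - A i t * fp i t)
  + 16 * (A i t * A j t * A k t) *
      (B j t * fm j t * (B k t * fm k t) - A i t * fp i t).

Definition residual_m (fp fm : 'I_3 -> R -> R) (i : 'I_3) (t : R) : R :=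
  let j := i + 1 in let k := i + 2%:R in
  - 16 * (A j t * B j t * A k t * B k t) * derive1 (coef_of fp fm false i) t
  + 16 * (A k t * B i t * B j t) *
      (A j t * fp j t * (B k t * fm k t) - B i t * fm i t)
  + 16 * (A j t * B i t * B k t) *
      (A k t * fp k t * (B j t * fm j t) - B i t * fm i t).

Lemma basis_scale_eq0 (x : R) (i : 'I_3) : (x *: T i == 0) = (x == 0).
Proof.
have [_ rf _] := hT; rewrite scaler_eq0; case: (eqVneq (T i) 0) => [Ti0|]; last by rewrite orbF.
have : delta_mx 0 i = 0 :> 'rV[R]_3.
  by apply: (row_free_inj rf); rewrite -rowE rowK Ti0 mul0mx.
by move=> /rowP/(_ i)/eqP; rewrite !mxE !eqxx oner_eq0.
Qed.

(** Listing [psi] as data lets every component of a wedge with it be evaluated by reduction on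
    ranks. *)
Definition psi_terms (t : R) : seq (R * seq nat) :=
  [:: (- 16 * (A 0 t * B 0 t * A 1 t * B 1 t), [:: 1; 2; 4; 5]%N);
      (- 16 * (A 0 t * B 0 t * A 2%:R t * B 2%:R t), [:: 1; 3; 4; 6]%N);
      (- 16 * (A 1 t * B 1 t * A 2%:R t * B 2%:R t), [:: 2; 3; 5; 6]%N);
      (8 * (A 0 t * A 1 t * A 2%:R t), [:: 0; 1; 2; 3]%N);
      (- 8 * (B 0 t * B 1 t * A 2%:R t), [:: 0; 3; 4; 5]%N);
      (- 8 * (B 1 t * B 2%:R t * A 0 t), [:: 0; 1; 5; 6]%N);
      (8 * (B 2%:R t * B 0 t * A 1 t), [:: 0; 2; 4; 6]%N)].

Lemma wedge_psi (W : lmodType R) (al : form W) (t : R) (k : seq nat) : lt7 k ->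
  wedge al (psi A B t) (fset_of_ranks k) =
  \sum_(p <- psi_terms t)
    (if all (mem k) p.2 then p.1 * (-1) ^+ inversions [seq n <- k | n \notin p.2] p.2 else 0)
    *: al (fset_of_ranks [seq n <- k | n \notin p.2]).
Proof.
move=> lk.
have -> : psi A B t = \sum_(p <- psi_terms t) p.1 *: mono (fset_of_ranks p.2).
  by rewrite psiE /psi_terms !big_cons big_nil addr0 !addrA.
have : all (fun p : R * seq nat => lt7 p.2) (psi_terms t) by [].
elim: (psi_terms t) => [_|p s IH /= /andP[lp ls]].
  by rewrite !big_nil ffunE big1 // => I _; rewrite ffunE mulr0 scale0r.
rewrite !big_cons wedgeDr wedgeZr ffunE IH //; congr (_ + _).
rewrite ffunE wedge_mono_r_ranks // scalerA; case: ifP => _ //.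
by rewrite mulr0.
Qed.

Lemma levi_civita_cycle (i k : 'I_3) : levi_civita (i + 1) (i + 2%:R) k = (k == i)%:R :> R.
Proof.
have [e1 e2 _ _] := ord3_eqs i; rewrite /levi_civita e1 e2 eqxx /=.
by case: (k == i) => //; case: ifP => // /andP[/eqP h _]; move: i h {e1 e2}; apply: ord3P.
Qed.

Lemma levi_civita_anti (i j k : 'I_3) : levi_civita j i k = - levi_civita i j k :> R.
Proof.
rewrite /levi_civita.
by move: i j k; do 3 apply: ord3P; rewrite /= ?oppr0 ?opprK.
Qed.

Lemma levi_civita_refl (i k : 'I_3) : levi_civita i i k = 0 :> R.
Proof. by rewrite /levi_civita; move: i k; do 2 apply: ord3P. Qed.

Section Components.
Variables (fp fm : 'I_3 -> R -> R) (t : R).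
Let F (s s' : bool) (i j : 'I_3) := curvature_at (theta_of A B T fp fm) t (Some (s, i)) (Some (s', j)).
Let g s i := coef_of fp fm s i t.

Lemma curvature_at_cycle s s' (i : 'I_3) :
  F s s' (i + 1) (i + 2%:R) = (2 * (g s (i + 1) * g s' (i + 2%:R) - g (s == s') i)) *: T i.
Proof.
rewrite /F curvature_at_theta (bigD1 i) //= levi_civita_cycle eqxx mulr1 big1 ?addr0 // => k ki.
by rewrite levi_civita_cycle (negbTE ki) mulr0 mul0r scale0r.
Qed.

Lemma curvature_at_anticycle s s' (i : 'I_3) :
  F s s' (i + 2%:R) (i + 1) = (- 2 * (g s (i + 2%:R) * g s' (i + 1) - g (s == s') i)) *: T i.
Proof.
rewrite /F curvature_at_theta (bigD1 i) //= levi_civita_anti levi_civita_cycle eqxx mulrN1 big1 ?addr0 // => k ki.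
by rewrite levi_civita_anti levi_civita_cycle (negbTE ki) oppr0 mulr0 mul0r scale0r.
Qed.

Lemma curvature_at_diag s s' (i : 'I_3) : F s s' i i = 0.
Proof. by rewrite /F curvature_at_theta big1 // => k _; rewrite levi_civita_refl mulr0 mul0r scale0r. Qed.

Hypothesis df : forall s i, derivable (coef_of fp fm s i) t 1.

Let W := wedge (curvature (theta_of A B T fp fm) t) (psi A B t).

Lemma wedge_component_p (i : 'I_3) :
  W (fset_of_ranks [seq n <- iota 0 7 | n != (4 + i)%N]) = ((-1) ^+ i * residual_p fp fm i t) *: T i.
Proof.
have [[E1 E2 E3] [E4 E5 E6]] := ord3_sums.
have c0 s s' := curvature_at_cycle s s' 0; rewrite /F E1 E4 in c0.
have c1 s s' := curvature_at_cycle s s' 1; rewrite /F E2 E5 in c1.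
have c2 s s' := curvature_at_cycle s s' 2%:R; rewrite /F E3 E6 in c2.
have d0 s s' := curvature_at_anticycle s s' 0; rewrite /F E1 E4 in d0.
have d1 s s' := curvature_at_anticycle s s' 1; rewrite /F E2 E5 in d1.
have d2 s s' := curvature_at_anticycle s s' 2%:R; rewrite /F E3 E6 in d2.
move: i; apply: ord3P; rewrite /residual_p; rewrite ?(E1, E2, E3, E4, E5, E6).
- rewrite /W wedge_psi // /psi_terms !big_cons big_nil /= !scale0r !add0r !addr0 /inversions /=.
  rewrite !curvature_pair // /frame_of_rank /= curvature_at_dt //.
  by rewrite !(c0, d0) !scalerA -!scalerDl /g /=; congr (_ *: _); rewrite /coef_of /=; ring.
- rewrite /W wedge_psi // /psi_terms !big_cons big_nil /= !scale0r !add0r !addr0 /inversions /=.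
  rewrite !curvature_pair // /frame_of_rank /= curvature_at_dt //.
  by rewrite !(c1, d1) !scalerA -!scalerDl /g /=; congr (_ *: _); rewrite /coef_of /=; ring.
- rewrite /W wedge_psi // /psi_terms !big_cons big_nil /= !scale0r !add0r !addr0 /inversions /=.
  rewrite !curvature_pair // /frame_of_rank /= curvature_at_dt //.
  by rewrite !(c2, d2) !scalerA -!scalerDl /g /=; congr (_ *: _); rewrite /coef_of /=; ring.
Qed.

Lemma wedge_component_m (i : 'I_3) :
  W (fset_of_ranks [seq n <- iota 0 7 | n != (1 + i)%N]) = ((-1) ^+ i * residual_m fp fm i t) *: T i.
Proof.
have [[E1 E2 E3] [E4 E5 E6]] := ord3_sums.
have c0 s s' := curvature_at_cycle s s' 0; rewrite /F E1 E4 in c0.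
have c1 s s' := curvature_at_cycle s s' 1; rewrite /F E2 E5 in c1.
have c2 s s' := curvature_at_cycle s s' 2%:R; rewrite /F E3 E6 in c2.
have d0 s s' := curvature_at_anticycle s s' 0; rewrite /F E1 E4 in d0.
have d1 s s' := curvature_at_anticycle s s' 1; rewrite /F E2 E5 in d1.
have d2 s s' := curvature_at_anticycle s s' 2%:R; rewrite /F E3 E6 in d2.
move: i; apply: ord3P; rewrite /residual_m; rewrite ?(E1, E2, E3, E4, E5, E6).
- rewrite /W wedge_psi // /psi_terms !big_cons big_nil /= !scale0r !add0r !addr0 /inversions /=.
  rewrite !curvature_pair // /frame_of_rank /= curvature_at_dt //.
  by rewrite !(c0, d0) !scalerA -!scalerDl /g /=; congr (_ *: _); rewrite /coef_of /=; ring.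
- rewrite /W wedge_psi // /psi_terms !big_cons big_nil /= !scale0r !add0r !addr0 /inversions /=.
  rewrite !curvature_pair // /frame_of_rank /= curvature_at_dt //.
  by rewrite !(c1, d1) !scalerA -!scalerDl /g /=; congr (_ *: _); rewrite /coef_of /=; ring.
- rewrite /W wedge_psi // /psi_terms !big_cons big_nil /= !scale0r !add0r !addr0 /inversions /=.
  rewrite !curvature_pair // /frame_of_rank /= curvature_at_dt //.
  by rewrite !(c2, d2) !scalerA -!scalerDl /g /=; congr (_ *: _); rewrite /coef_of /=; ring.
Qed.

(** The terms of [psi] without [dt] pair with [F (T_i^+, T_i^-)], whose bracket and commutator parts
    both come from [[T_i, T_i]]. *)
Lemma wedge_component_dt : W (fset_of_ranks (iota 1 6)) = 0.
Proof.
rewrite /W wedge_psi // /psi_terms !big_cons big_nil /= !scale0r !add0r !addr0 /inversions /=.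
rewrite !curvature_pair // /frame_of_rank /=.
by have D := curvature_at_diag true false; rewrite /F in D; rewrite !D !scaler0 !addr0.
Qed.

(** [F] has degree 2 and [psi] degree 4, so only sets of six frame vectors matter, each the
    complement of a single one: the residuals account for six of them, and the complement of [dt]
    gives nothing. *)
Lemma instanton_at_residuals : W = 0 <->
  forall i, residual_p fp fm i t = 0 /\ residual_m fp fm i t = 0.
Proof.
split=> [W0 i|res].
  have := wedge_component_p i; have := wedge_component_m i; rewrite W0 !ffunE.
  move=> /esym/eqP; rewrite basis_scale_eq0 mulf_eq0 signr_eq0 /= => /eqP ->.
  by move=> /esym/eqP; rewrite basis_scale_eq0 mulf_eq0 signr_eq0 /= => /eqP ->.
apply/ffunP => K; rewrite [RHS]ffunE.
pose k := [seq n <- iota 0 7 | frame_of_rank n \in K].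
have lk : lt7 k.
  rewrite /lt7 filter_uniq ?iota_uniq //=; apply/allP => n; rewrite mem_filter mem_iota.
  by move=> /andP[_].
have Kk : K = fset_of_ranks k.
  apply/setP => a; rewrite !inE mem_filter mem_iota frame_rankK.
  by rewrite leq0n add0n frame_rank_lt !andbT.
have k7 : size k = #|K| by rewrite Kk card_fset_of_ranks //; case/andP: lk.
have [K6|nK6] := eqVneq #|K| 6.
  have : #|(~: K)%SET| = 1%N.
    have := cardsC K; rewrite K6 card_option card_prod card_bool card_ord /= => /eqP.
    by rewrite -[X in _ == X]/(6 + 1)%N eqn_add2l => /eqP.
  move=> /eqP/cards1P[a Ka].
  have -> : K = fset_of_ranks [seq n <- iota 0 7 | n != frame_rank a].
    apply/setP => b; rewrite !inE mem_filter mem_iota leq0n add0n frame_rank_lt !andbT.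
    rewrite (inj_eq frame_rank_inj).
    by have := congr1 (fun S : {set frame} => b \in S) Ka; rewrite !inE => <-; rewrite negbK.
  case: a {Ka} => [[[] i]|].
  - by rewrite -[frame_rank _]/(1 + i)%N wedge_component_m (res i).2 mulr0 scale0r.
  - by rewrite -[frame_rank _]/(4 + i)%N wedge_component_p (res i).1 mulr0 scale0r.
  - exact: wedge_component_dt.
rewrite /W Kk wedge_psi // big_seq big1 // => p pin; case: ifP => [pk|_]; last by rewrite scale0r.
rewrite curvature_not_pair ?scaler0 //.
have : lt7 p.2 /\ size p.2 = 4%N.
  by move: pin; rewrite /psi_terms !inE => /orP[/eqP->|]; do ?[case/orP => [/eqP->|]] => // /eqP ->.
move=> [lp p4].
rewrite card_fset_of_ranks; last first.
- by case/andP: lk => _ /allP ak; apply/allP => n; rewrite mem_filter => /andP[_ /ak].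
- by rewrite filter_uniq //; case/andP: lk.
move=> h; case/eqP: nK6; rewrite -k7 -(count_predC (mem p.2) k) -!size_filter.
rewrite [X in (_ + X)%N](_ : _ = 2%N) //.
suff -> : size [seq x <- k | mem p.2 x] = 4%N by [].
rewrite -p4.
apply: perm_size; apply: uniq_perm; first by rewrite filter_uniq //; case/andP: lk.
  by case/andP: lp.
move=> n; rewrite mem_filter; apply: andb_idr => np; exact: (allP pk).
Qed.

End Components.

End CurvatureComponents.

(** * Vanishing of the [eta_i^-] part *)

Section SingularLinearSystem.
Context {R : realType}.

(* [t ^+ 2 * E t] extends by [0] and satisfies an ordinary Gronwall inequality. *)
Lemma singular_gronwall (E dE : R -> R) (t1 K C r : R) : 0 < t1 -> 0 < r ->
  (forall t : R, 0 < t <= t1 -> is_derive t 1 E (dE t)) ->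
  (forall t : R, 0 < t <= t1 -> t * dE t + 2 * E t <= K * t * E t) ->
  (forall t : R, 0 < t < r -> `|E t| <= C) -> E t1 <= 0.
Proof.
move=> t10 r0 dEE HK HC.
pose H (t : R) : R := if t <= 0 then 0 else t ^+ 2 * E t.
pose dH (t : R) : R := if t <= 0 then 0 else t * (t * dE t + 2 * E t).
have : H t1 <= 0.
  apply: (@gronwall0 R H dH 0 t1 K (ltW t10)) => [t /andP[t0 tt1]|t /andP[t0 tt1]|].
  - move: t0; rewrite le_eqVlt => /orP[/eqP <-|t0].
      rewrite /dH lexx; apply/is_derive_near_bound => e e0.
      pose C1 := `|C| + 1; have C10 : 0 < C1 by rewrite ltr_wpDl.
      exists (Num.min r (e / C1)); first by rewrite lt_min r0 divr_gt0.
      move=> h; rewrite lt_min => /andP[hr he]; rewrite add0r mul0r subr0 {2}/H lexx subr0.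
      rewrite /H; case: (leP h 0) => h0; first by rewrite normr0 mulr_ge0 // ltW.
      rewrite gtr0_norm // in hr he *; have := HC h; rewrite h0 => /(_ hr) hC.
      rewrite normrM (ger0_norm (sqr_ge0 h)) expr2 -mulrA mulrC ler_pM2r //.
      apply: (@le_trans _ _ (h * C1)); last by rewrite -ler_pdivlMr // ltW.
      by rewrite ler_pM2l // (le_trans hC) // /C1; have := ler_norm C; lra.
    have oU : open [set s : R | 0 < s] by exact: open_gt.
    rewrite /dH leNgt t0 /=.
    have Ut : [set s : R | 0 < s] t by exact: t0.
    apply: (is_derive_ext_open oU Ut (f := fun s : R => s ^+ 2 * E s)).
      by move=> s s0; rewrite /H leNgt s0.
    apply: isd_eq (isdM (isdX 1 t) (dEE t _)) _; first by rewrite t0.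
    by rewrite expr1; ring.
  - rewrite /dH /H; case: (leP t 0) => t0'; first by rewrite mulr0.
    have := HK t; rewrite t0' => /(_ tt1) h.
    rewrite (_ : K * _ = t * (K * t * E t)); last by ring.
    by rewrite ler_pM2l.
  by rewrite /H lexx.
have -> : H t1 = t1 ^+ 2 * E t1 by rewrite /H (lt_geF t10).
by rewrite pmulr_rle0 // exprn_gt0.
Qed.

Lemma mulr_quad_bound (M p x z : R) : `|p| <= M -> p * x * z <= M * (x ^+ 2 + z ^+ 2) / 2.
Proof.
move=> pM; apply: (le_trans (ler_norm _)); rewrite !normrM.
apply: (@le_trans _ _ (M * (`|x| * `|z|))).
  by rewrite -mulrA ler_wpM2r // mulr_ge0.
have M0 : 0 <= M by exact: le_trans pM.
rewrite -mulrA ler_wpM2l // -(real_normK (num_real x)) -(real_normK (num_real z)).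
have := sqr_ge0 (`|x| - `|z|); nra.
Qed.

(** A damping [k] of at least [1 / t - M] makes [2 y y'] contribute at most [- 2 y^2 / t] up to
    bounded multiples of squares, which is what the weight [t ^+ 2] needs. The coupling terms are
    split by Young's inequality; the three estimates add up to [3 * M * t * E], whence the constant
    [6 * M]. *)
Lemma singular_linear_system (y k p q : 'I_3 -> R -> R) (t1 M C r : R) : 0 < t1 -> 0 < r ->
  (forall i (t : R), 0 < t <= t1 -> is_derive t 1 (y i)
    (- k i t * y i t + p i t * y (i + 2%:R) t + q i t * y (i + 1) t)) ->
  (forall i (t : R), 0 < t <= t1 -> 1 - t * k i t <= M * t) ->
  (forall i (t : R), 0 < t <= t1 -> `|p i t| <= M /\ `|q i t| <= M) ->
  (forall i (t : R), 0 < t < r -> `|y i t| <= C) ->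
  forall i, y i t1 = 0.
Proof.
move=> t10 r0 dy kM pqM yC.
pose E (t : R) := y 0 t ^+ 2 + y 1 t ^+ 2 + y 2%:R t ^+ 2.
pose d (i : 'I_3) (t : R) := - k i t * y i t + p i t * y (i + 2%:R) t + q i t * y (i + 1) t.
pose dE (t : R) := 2 * (y 0 t * d 0 t + y 1 t * d 1 t + y 2%:R t * d 2%:R t).
have Et1 : E t1 <= 0.
  apply: (@singular_gronwall E dE t1 (6 * M) (3 * C ^+ 2) r) => // t tt.
  - have sq (i : 'I_3) : is_derive t 1 (fun s => y i s ^+ 2) (2 * (y i t * d i t)).
      by apply: isd_eq (isdM (dy i t tt) (dy i t tt)) _; rewrite -/(d i t); ring.
    by apply: isd_eq (isdD (isdD (sq 0) (sq 1)) (sq 2%:R)) _; rewrite /dE; ring.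
  - have t0 : 0 < t by case/andP: tt.
    have T (i : 'I_3) : t * (y i t * d i t) + y i t ^+ 2 <= M * t * (2 * y i t ^+ 2 +
        (y (i + 1) t ^+ 2 + y (i + 2%:R) t ^+ 2) / 2).
      have [pM qM] := pqM i t tt.
      have h1 := mulr_quad_bound (y i t) (y (i + 2%:R) t) pM.
      have h2 := mulr_quad_bound (y i t) (y (i + 1) t) qM.
      have h3 := ler_wpM2r (sqr_ge0 (y i t)) (kM i t tt).
      have h4 := ler_wpM2l (ltW t0) (lerD h1 h2).
      rewrite /d; move: h3 h4.
      move: (y i t) (y (i + 1) t) (y (i + 2%:R) t) (p i t) (q i t) (k i t) => a b c p' q' k'.
      lra.
    have := T 0; have := T 1; have := T 2%:R.
    have [[E1 E2 E3] [E4 E5 E6]] := ord3_sums.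
    rewrite E1 E2 E3 E4 E5 E6 /dE /E.
    move: (y 0 t) (y 1 t) (y 2%:R t) (d 0 t) (d 1 t) (d 2%:R t) => a b c d0 d1 d2.
    lra.
  have B (i : 'I_3) : y i t ^+ 2 <= C ^+ 2.
    rewrite -(real_normK (num_real _)) ler_pXn2r // ?nnegrE // ?yC //.
    exact: le_trans (yC i t tt).
  rewrite ger0_norm; last by rewrite !addr_ge0 // sqr_ge0.
  have := B 0; have := B 1; have := B 2%:R; rewrite /E; lra.
have s0 i := sqr_ge0 (y i t1).
suff H (i : 'I_3) : y i t1 ^+ 2 <= E t1.
  move=> i; apply/eqP; rewrite -sqrf_eq0; apply/eqP/le_anti; rewrite s0 andbT.
  exact: le_trans (H i) Et1.
have := s0 0; have := s0 1; have := s0 2%:R; rewrite /E.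
move: i; apply: ord3P; lra.
Qed.

End SingularLinearSystem.

Section InstantonEquations.
Context {R : realType}.
Variables (A B : 'I_3 -> R -> R) (a3 : 'I_3 -> R) (b0 : R) (a be al : 'I_3 -> R -> R).
Hypothesis hb0 : 0 < b0.
Hypothesis cd : coef_data A B a3 b0 a be al.
Variable T : 'I_3 -> quat R.
Hypothesis hT : standard_basis T.

Lemma derivable_A i (t : R) : 0 < t -> derivable (A i) t 1.
Proof.
move=> t0; have oU : open [set s : R | 0 < s] by exact: open_gt.
have Ut : [set s : R | 0 < s] t by exact: t0.
apply: (derivable_ext_open oU Ut (f := fun s : R => s * a i s)).
  by move=> s s0; rewrite (cd_A cd) // ltW.
by have [] := isdM (isd_id t) (smooth1_is_derive (cd_sa cd i) (I : [set: R] t)).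
Qed.

Lemma derivable_B i (t : R) : 0 < t -> derivable (B i) t 1.
Proof.
move=> t0; have oU : open [set s : R | 0 < s] by exact: open_gt.
have Ut : [set s : R | 0 < s] t by exact: t0.
apply: (derivable_ext_open oU Ut (f := be i)).
  by move=> s s0; rewrite (cd_B cd) // ltW.
exact: smooth1_derivable (cd_sb cd i) (I : [set: R] t).
Qed.

Lemma A_gt0 i (t : R) : 0 < t -> 0 < A i t.
Proof. by move=> t0; rewrite (cd_A cd) ?ltW // mulr_gt0 // (cd_a0 cd). Qed.

Lemma B_gt0 i (t : R) : 0 < t -> 0 < B i t.
Proof. by move=> t0; rewrite (cd_B cd) ?ltW // (cd_b0 cd). Qed.

Variables (fp fm : 'I_3 -> R -> R) (t : R).
Hypothesis t0 : 0 < t.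

Lemma is_derive_coef_p i : derivable (fp i) t 1 ->
  is_derive t 1 (coef_of A B fp fm true i) (derive1 (A i) t * fp i t + A i t * derive1 (fp i) t).
Proof.
move=> df; rewrite !derive1E.
by apply: isdM; apply: derivableP => //; exact: derivable_A.
Qed.

Lemma is_derive_coef_m i : derivable (fm i) t 1 ->
  is_derive t 1 (coef_of A B fp fm false i) (derive1 (B i) t * fm i t + B i t * derive1 (fm i) t).
Proof.
move=> df; rewrite !derive1E.
by apply: isdM; apply: derivableP => //; exact: derivable_B.
Qed.

Lemma residual_pE i : derivable (fp i) t 1 ->
  let j := i + 1 in let k := i + 2%:R in
  residual_p A B fp fm i t = - 16 * (A i t * (A j t * B j t * A k t * B k t)) *
    (derive1 (fp i) t
     + (derive1 (A i) t / A i t + A i t / (B j t * B k t) - A i t / (A j t * A k t)) * fp i t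
     + fp j t * fp k t - fm j t * fm k t).
Proof.
move=> df j k; rewrite /residual_p (is_derive1P (is_derive_coef_p df)) -/j -/k.
clearbody j k.
move: (lt0r_neq0 (A_gt0 i t0)) (lt0r_neq0 (A_gt0 j t0)) (lt0r_neq0 (A_gt0 k t0)).
move: (lt0r_neq0 (B_gt0 j t0)) (lt0r_neq0 (B_gt0 k t0)).
move: (A i t) (A j t) (A k t) (B i t) (B j t) (B k t) (derive1 (A i) t) (derive1 (fp i) t).
move: (fp i t) (fp j t) (fp k t) (fm j t) (fm k t) => f g h g' h' x y z u v w x' f' v0 w0 x0 y0 z0.
by field; rewrite x0 y0 z0 v0 w0.
Qed.

(** The unknown is [B_i f_i^-], the quantity that a smooth extension bounds; in it the equation is
    linear for given [f^+] and free of the derivative of [B_i]. *)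
Lemma residual_mE i :
  let j := i + 1 in let k := i + 2%:R in let y := coef_of A B fp fm false in
  residual_m A B fp fm i t = - 16 * (A j t * B j t * A k t * B k t) *
    (derive1 (y i) t - (- (B i t / (A j t * B k t) + B i t / (A k t * B j t)) * y i t
       + (B i t * fp j t / B k t) * y k t + (B i t * fp k t / B j t) * y j t)).
Proof.
move=> j k y; rewrite /residual_m -/j -/k /y {y}; clearbody j k.
move: (derive1 _ t); rewrite /coef_of => y'.
move: (lt0r_neq0 (A_gt0 j t0)) (lt0r_neq0 (A_gt0 k t0)).
move: (lt0r_neq0 (B_gt0 j t0)) (lt0r_neq0 (B_gt0 k t0)).
move: (A j t) (A k t) (B i t) (B j t) (B k t).
move: (fp j t) (fp k t) (fm i t) (fm j t) (fm k t) => g h f' g' h' y z u v w v0 w0 y0 z0.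
by field; rewrite y0 z0 v0 w0.
Qed.

Hypotheses (dfp : forall i, derivable (fp i) t 1) (dfm : forall i, derivable (fm i) t 1).

Lemma instanton_at : 
  wedge (curvature (theta_of A B T fp fm) t) (psi A B t) = 0 <->
  (forall i : 'I_3, let j := i + 1 in let k := i + 2%:R in
    derive1 (fp i) t
    + (derive1 (A i) t / A i t + A i t / (B j t * B k t) - A i t / (A j t * A k t)) * fp i t
    = fm j t * fm k t - fp j t * fp k t) /\
  (forall i : 'I_3, let j := i + 1 in let k := i + 2%:R in let y := coef_of A B fp fm false in
    derive1 (y i) t = - (B i t / (A j t * B k t) + B i t / (A k t * B j t)) * y i t
       + (B i t * fp j t / B k t) * y k t + (B i t * fp k t / B j t) * y j t).
Proof.
have nA i := lt0r_neq0 (A_gt0 i t0); have nB i := lt0r_neq0 (B_gt0 i t0).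
rewrite (instanton_at_residuals hT) => [|s i]; last first.
  by case: s; [have [] := is_derive_coef_p (@dfp i)|have [] := is_derive_coef_m (@dfm i)].
have n16 : - 16 != 0 :> R by rewrite oppr_eq0 pnatr_eq0.
split=> [res|[ep em] i].
  split=> i; have [rp rm] := res i.
    move/eqP: rp; rewrite residual_pE // !mulf_eq0 (negbTE n16) !(negbTE (nA _)) !(negbTE (nB _)) /=.
    by rewrite subr_eq0 => /eqP <-; rewrite addrK.
  move/eqP: rm; rewrite residual_mE // !mulf_eq0 (negbTE n16) !(negbTE (nA _)) !(negbTE (nB _)) /=.
  by rewrite subr_eq0 => /eqP.
split.
  by rewrite residual_pE // ep subrK subrr mulr0.
by rewrite residual_mE // em subrr mulr0.
Qed.

End InstantonEquations.

Section DiagonalVanishing.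
Context {R : realType}.
Variables (A B : 'I_3 -> R -> R) (a3 : 'I_3 -> R) (b0 : R) (a be al : 'I_3 -> R -> R).
Hypothesis hb0 : 0 < b0.
Hypothesis cd : coef_data A B a3 b0 a be al.
Variables (fp fm : 'I_3 -> R -> R) (e : R).
Hypothesis dfp : forall i (t : R), 0 < t < e -> derivable (fp i) t 1.
Hypothesis dfm : forall i (t : R), 0 < t < e -> derivable (fm i) t 1.
Local Notation y := (coef_of A B fp fm false).
Hypothesis ode : forall (i : 'I_3) (t : R), 0 < t < e -> let j := i + 1 in let k := i + 2%:R in
    derive1 (y i) t = - (B i t / (A j t * B k t) + B i t / (A k t * B j t)) * y i t
       + (B i t * fp j t / B k t) * y k t + (B i t * fp k t / B j t) * y j t.
Hypothesis fp_bound : forall i, exists C r : R, 0 < r /\ forall t : R, 0 < t < r -> `|fp i t| <= C.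
Hypothesis y_bound : forall i, exists C r : R, 0 < r /\ forall t : R, 0 < t < r -> `|y i t| <= C.

Lemma minus_part_vanishes i (t : R) : 0 < t < e -> fm i t = 0.
Proof.
move=> /andP[t0 te]; have sb k := cd_sb cd k; have sa k := cd_sa cd k.
have inU (s : R) : [set: R] s by [].
have bn k s : be k s != 0 by exact: lt0r_neq0 (cd_b0 cd k s).
have an k s : a k s != 0 by exact: lt0r_neq0 (cd_a0 cd k s).
have oT : open [set: R] := openT.
have sq j k : smooth (setT : set R) (fun s => be j s / be k s).
  by apply: smoothM => //; apply: smoothV.
pose kap (i : 'I_3) (s : R) := B i s / (A (i + 1) s * B (i + 2%:R) s) + B i s / (A (i + 2%:R) s * B (i + 1) s).
pose tk (i : 'I_3) (s : R) := be i s / be (i + 2%:R) s * (a (i + 1) s)^-1 + be i s / be (i + 1) s * (a (i + 2%:R) s)^-1.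
have stk k : smooth (setT : set R) (tk k).
  by apply: smoothD => //; apply: smoothM => //; apply: smoothV.
have tkE k (s : R) : 0 < s -> s * kap k s = tk k s.
  move=> s0; rewrite /kap /tk !(cd_A cd) ?ltW // !(cd_B cd) ?ltW //.
  move: (bn k s) (bn (k + 1) s) (bn (k + 2%:R) s) (an (k + 1) s) (an (k + 2%:R) s) (lt0r_neq0 s0).
  move: (be k s) (be (k + 1) s) (be (k + 2%:R) s) (a (k + 1) s) (a (k + 2%:R) s) => x z u v w x0 z0 u0 v0 w0 sn0.
  by field; rewrite sn0 v0 w0 u0 z0.
(* Each of the two terms tends to [1 / (1/2) = 2], because the [B_i] agree at 0; the system is thus
   damped like [4 / t]. *)
have tk0 k : tk k 0 = 4.
  rewrite /tk !(cd_be0 cd) !(cd_a00 cd) divff ?lt0r_neq0 // invrK; ring.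
have tk_pos k s : 0 < tk k s by rewrite addr_gt0 // !mulr_gt0 // ?invr_gt0 ?(cd_b0 cd) ?(cd_a0 cd).
have [M1 M10 HM1] : exists2 M1 : R, 0 < M1 & forall i (s : R), 0 < s <= t -> 1 - s * kap i s <= M1 * s.
  apply: (@ex_common_bound R (fun i M => forall s : R, 0 < s <= t -> 1 - s * kap i s <= M * s)).
    move=> j r s rs H u ut; apply: (le_trans (H u ut)); rewrite ler_wpM2r //.
    by case/andP: ut => /ltW.
  (* Near 0, [s * kap] exceeds 3 and the left-hand side is negative; from [d] on it stays below 1,
     hence below [s / d]. *)
  move=> j; have [d d0 Hd] := continuous_ball (smooth_continuous (stk j) (inU 0)) (ltr01 : 0 < 1 :> R).
  exists d^-1 => s /andP[s0 _]; rewrite tkE //.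
  have [sd|ds] := ltP s d.
    have := Hd s; rewrite subr0 gtr0_norm // => /(_ sd); rewrite tk0 ltr_norml => /andP[h _].
    have : 0 <= d^-1 * s by rewrite mulr_ge0 // ltW // invr_gt0.
    by lra.
  have : 1 <= d^-1 * s by rewrite mulrC ler_pdivlMr // mul1r.
  have := tk_pos j s; lra.
have fb i' : exists C : R, forall s, 0 < s <= t -> `|fp i' s| <= C.
  have [C [r [r0 HC]]] := fp_bound i'.
  have [rt|tr] := leP r t; last by exists C => s /andP[s0 st]; apply: HC; rewrite s0 (le_lt_trans st).
  have rt2 : r / 2 <= t by lra.
  have [s /andP[rs st]|D HD] := continuous_bound (f := fp i') rt2.
    apply: differentiable_continuous; apply/derivable1_diffP; apply: dfp; lra.
  exists (Num.max C D) => s /andP[s0 st]; rewrite le_max.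
  have [sr|rs] := ltP s r; first by rewrite HC ?s0.
  by apply/orP; right; apply: HD; rewrite st andbT; lra.
have bb j k : exists C : R, forall s, 0 < s <= t -> `|be j s / be k s| <= C.
  have [s st|D HD] := continuous_bound (f := fun s => be j s / be k s) (ltW t0).
    exact: smooth_continuous (sq j k) (inU s).
  by exists D => s /andP[s0 st]; apply: HD; rewrite st ltW.
have pb (i1 i2 i3 : 'I_3) : exists C : R, forall s, 0 < s <= t -> `|B i1 s * fp i2 s / B i3 s| <= C.
  have [C HC] := bb i1 i3; have [D HD] := fb i2; exists (C * D) => s st.
  have s0 : 0 <= s by case/andP: st => /ltW.
  by rewrite !(cd_B cd) // mulrAC normrM ler_pM // ?HC ?HD.
have wk (f : 'I_3 -> R -> R) i' r s : r <= s -> (forall u : R, 0 < u <= t -> `|f i' u| <= r) ->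
    forall u : R, 0 < u <= t -> `|f i' u| <= s.
  by move=> rs H u ut; exact: le_trans (H u ut) rs.
pose p (i : 'I_3) s := B i s * fp (i + 1) s / B (i + 2%:R) s.
pose q (i : 'I_3) s := B i s * fp (i + 2%:R) s / B (i + 1) s.
have [M2 M20 HM2] := ex_common_bound (wk p) (fun i => pb i (i + 1) (i + 2%:R)).
have [M3 M30 HM3] := ex_common_bound (wk q) (fun i => pb i (i + 2%:R) (i + 1)).
have [C C0 [r r0 HC]] : exists2 C : R, 0 < C & exists2 r : R, 0 < r &
    forall i (s : R), 0 < s < r -> `|y i s| <= C.
  have [C C0 HC] := @ex_common_bound R (fun i C => exists2 r : R, 0 < r & forall s : R, 0 < s < r -> `|y i s| <= C)
    (fun i r s rs H => let: ex_intro2 r1 r10 Hr := H in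
       ex_intro2 _ _ r1 r10 (fun u uu => le_trans (Hr u uu) rs))
    (fun i => let: ex_intro C (ex_intro r (conj r0 H)) := y_bound i in ex_intro _ C (ex_intro2 _ _ r r0 H)).
  exists C => //; apply: (@ex_common_radius R (fun i r => forall s : R, 0 < s < r -> `|y i s| <= C)) => //.
  move=> i' r s sr H u /andP[u0 us]; apply: H; rewrite u0; exact: lt_le_trans us sr.
have : y i t = 0.
  apply: (@singular_linear_system R y kap p q t (M1 + M2 + M3) C r) => // k s st.
  - have se : 0 < s < e by case/andP: st => -> /= /le_lt_trans; exact.
    have s0 : 0 < s by case/andP: st.
    rewrite -(ode k se) derive1E; apply: derivableP.
    by have [] := is_derive_coef_m cd fp s0 (@dfm k s se).
  - apply: le_trans (HM1 k s st) _; rewrite ler_wpM2r //; last by lra.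
    by case/andP: st => /ltW.
  - split; [apply: le_trans (HM2 k s st) _|apply: le_trans (HM3 k s st) _]; lra.
move/eqP; rewrite /coef_of mulf_eq0 (negbTE (lt0r_neq0 (B_gt0 cd i t0))) => /eqP; exact.
Qed.

End DiagonalVanishing.

(** * Restriction of a smooth extension to a path *)

Section SmoothComposition.
Context {R : realType}.

(** The chart is quadratic along lines, and a linear functional is the case [Q = 0]; dividing the
    increment by [h] leaves [L + h Q]. *)
Lemma derive_quadratic (V W : normedModType R) (f : V -> W) x v L Q :
  (forall h : R, f (h *: v + x) = f x + h *: L + h ^+ 2 *: Q) -> is_derive x v f L.
Proof.
move=> fE; have H : (fun h : R => h^-1 *: ((f \o shift x) (h *: v) - f x)) @ 0^' --> L.
  have : (fun h : R => L + h *: Q) @ 0^' --> L + 0 *: Q.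
    apply: cvg_within_filter; apply: cvgD; first exact: cvg_cst.
    by apply: cvgZr_tmp; exact: cvg_id.
  rewrite scale0r addr0; apply: cvg_trans; apply: near_eq_cvg; near=> h.
  have hn0 : h != 0 by near: h; exact: nbhs_dnbhs_neq.
  have -> : (f \o shift x) (h *: v) - f x = h *: L + h ^+ 2 *: Q.
    by apply/eqP; rewrite /= fE subr_eq [eqbRHS]addrC addrA.
  by rewrite scalerDr !scalerA expr2 mulrA mulVf // mul1r scale1r.
by split; [apply/cvg_ex; eexists; exact: H|apply: cvg_lim].
Unshelve. all: by end_near. Qed.

Lemma smooth_line (V W : normedModType R) (U : set V) (f : V -> W) (d x0 : V) : open U ->
  smooth U f -> smooth [set s : R | U (s *: d + x0)] (fun s : R => f (s *: d + x0)).
Proof.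
move=> oU sf.
have oP : open [set s : R | U (s *: d + x0)].
  apply: (@open_comp _ _ (fun s : R => s *: d + x0) U) => // s _.
  by apply: cvgD; [apply: cvgZr_tmp; exact: cvg_id|exact: cvg_cst].
suff: forall g : R -> W, (exists2 f : V -> W, smooth U f & g = (fun s => f (s *: d + x0))) ->
    smooth [set s : R | U (s *: d + x0)] g.
  by apply; exists f.
apply: smooth_coind => // _ {f sf} [f sf ->]; split=> [s Us|v].
  apply: (@continuous_comp _ _ _ (fun s : R => s *: d + x0) f); last exact: smooth_continuous sf Us.
  by apply: cvgD; [apply: cvgZr_tmp; exact: cvg_id|exact: cvg_cst].
have E (s : R) : (fun h : R => h^-1 *: (((fun s => f (s *: d + x0)) \o shift s) (h *: (v : R)) - f (s *: d + x0)))
    = (fun h : R => h^-1 *: ((f \o shift (s *: d + x0)) (h *: (v *: d)) - f (s *: d + x0))).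
  by apply/funext => h /=; rewrite scalerDl addrA scalerA.
split=> [s Us|].
  by rewrite /derivable E; exact: smooth_derivable sf Us.
exists (fun s : R => 'D_(v *: d) f (s *: d + x0)).
  by exists ('D_(v *: d) f) => //; exact: smooth_derive.
by move=> s Us; rewrite /derive E.
Qed.

Lemma smooth_coord (V : normedModType R) (n : nat) (U : set V) (f : V -> 'rV[R]_n.+1) (l : 'I_n.+1) : open U ->
  smooth U f -> smooth U (fun x => f x 0 l).
Proof.
move=> oU sf.
suff: forall g : V -> R, (exists2 f : V -> 'rV[R]_n.+1, smooth U f & g = (fun x => f x 0 l)) -> smooth U g.
  by apply; exists f.
apply: smooth_coind => // _ {f sf} [f sf ->].
have C : continuous (fun x : 'rV[R]_n.+1 => x 0 l) by exact: coord_continuous.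
split=> [x Ux|v].
  by apply: (@continuous_comp _ _ _ f (fun x => x 0 l)); [exact: smooth_continuous sf Ux|exact: C].
have H x : U x -> is_derive x v (fun x => f x 0 l) ('D_v f x 0 l).
  move=> Ux; have df : derivable f x v by apply: smooth_derivable sf Ux.
  have H : (fun h : R => h^-1 *: (((fun x => f x 0 l) \o shift x) (h *: v) - f x 0 l)) @ 0^'
      --> 'D_v f x 0 l.
    have -> : (fun h : R => h^-1 *: (((fun x => f x 0 l) \o shift x) (h *: v) - f x 0 l)) =
        (fun h : R => (h^-1 *: ((f \o shift x) (h *: v) - f x)) 0 l).
      by apply/funext => h; rewrite !mxE.
    exact: (cvg_comp _ (fun y : 'rV[R]_n.+1 => y 0 l) df (C ('D_v f x))).
  by split; [apply/cvg_ex; eexists; exact: H|apply: cvg_lim].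
split=> [x Ux|]; first by have [] := H x Ux.
exists (fun x => 'D_v f x 0 l); last by move=> x Ux; have [] := H x Ux.
by exists (fun x => 'D_v f x) => //; exact: smooth_derive.
Qed.

End SmoothComposition.

(** * Quaternion identities and the differential of the chart *)

Section QuaternionAlgebra.
Context {R : realType}.
Implicit Types x y z : quat R.

Definition qone : quat R := mkquat 1 0 0 0.

Lemma quatP x y :
  [/\ x 0 0 = y 0 0, x 0 1 = y 0 1, x 0 2%:R = y 0 2%:R & x 0 3%:R = y 0 3%:R] -> x = y.
Proof.
move=> [e0 e1 e2 e3]; apply/rowP; case=> -[|[|[|[|//]]]] l4.
- by rewrite (_ : Ordinal l4 = 0) //; exact: val_inj.
- by rewrite (_ : Ordinal l4 = 1) //; exact: val_inj.
- by rewrite (_ : Ordinal l4 = 2%:R) //; exact: val_inj.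
- by rewrite (_ : Ordinal l4 = 3%:R) //; exact: val_inj.
Qed.

Ltac quat_ring := apply: quatP; split; rewrite !mxE /= ?mxE /=; ring.

Lemma qmulDl x y z : qmul (x + y) z = qmul x z + qmul y z. Proof. quat_ring. Qed.
Lemma qmulDr x y z : qmul x (y + z) = qmul x y + qmul x z. Proof. quat_ring. Qed.
Lemma qmulZl (c : R) x y : qmul (c *: x) y = c *: qmul x y. Proof. quat_ring. Qed.
Lemma qmulZr (c : R) x y : qmul x (c *: y) = c *: qmul x y. Proof. quat_ring. Qed.
Lemma qmulA x y z : qmul x (qmul y z) = qmul (qmul x y) z. Proof. quat_ring. Qed.
Lemma qmul1l x : qmul qone x = x. Proof. rewrite /qone; quat_ring. Qed.
Lemma qmul1r x : qmul x qone = x. Proof. rewrite /qone; quat_ring. Qed.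
Lemma qconjD x y : qconj (x + y) = qconj x + qconj y. Proof. quat_ring. Qed.
Lemma qconjZ (c : R) x : qconj (c *: x) = c *: qconj x. Proof. quat_ring. Qed.
Lemma qconjM x y : qconj (qmul x y) = qmul (qconj y) (qconj x). Proof. quat_ring. Qed.
Lemma qconjK x : qconj (qconj x) = x. Proof. quat_ring. Qed.
Lemma qconj1 : qconj qone = qone. Proof. rewrite /qone; quat_ring. Qed.

Lemma qmul0l x : qmul 0 x = 0. Proof. quat_ring. Qed.
Lemma qmul0r x : qmul x 0 = 0. Proof. quat_ring. Qed.
Lemma qconj0 : qconj 0 = 0 :> quat R. Proof. quat_ring. Qed.

Lemma SU2_qone : SU2 qone.
Proof. by rewrite /SU2 /= !big_ord_recl big_ord0 !mxE /=; ring. Qed.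

Lemma SU2_qoneN : SU2 (- qone).
Proof. by rewrite /SU2 /= !big_ord_recl big_ord0 !mxE /=; ring. Qed.

Lemma su2_conj x : su2 x -> qconj x = - x.
Proof. by move=> x0; apply: quatP; split; rewrite !mxE //= x0 oppr0. Qed.

End QuaternionAlgebra.

Section ChartDerivative.
Context {R : realType}.
Local Notation H := (quat R).

Lemma derive_chart (t s : R) (a1 a2 g b1 b2 : H) :
  is_derive (t, a1, a2, g) ((s, b1, b2, 0) : R * H * H * H) chart
    (s *: a1 + t *: b1, qmul b1 (qconj a2) + qmul a1 (qconj b2), 0).
Proof.
apply: (derive_quadratic (Q := (s *: b1, qmul b1 (qconj b2), 0))) => h.
rewrite -[LHS]/((h * s + t) *: (h *: b1 + a1), qmul (h *: b1 + a1) (qconj (h *: b2 + a2)), h *: 0 + g).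
rewrite -[RHS]/(t *: a1 + h *: (s *: a1 + t *: b1) + h ^+ 2 *: (s *: b1),
  qmul a1 (qconj a2) + h *: (qmul b1 (qconj a2) + qmul a1 (qconj b2)) + h ^+ 2 *: qmul b1 (qconj b2),
  g + h *: 0 + h ^+ 2 *: 0).
congr (_, _, _); last by rewrite !scaler0 add0r !addr0.
  rewrite scalerDr !scalerDl !scalerDr !scalerA expr2.
  by apply: quatP; split; rewrite !mxE; ring.
rewrite qconjD qconjZ !qmulDl !qmulDr !qmulZl !qmulZr.
by apply: quatP; split; rewrite !mxE; ring.
Qed.

(** The [T_i^+] span the isotropy directions of the singular orbit: in the [q] component the
    contributions [a1 T_i conj a2] and [a1 conj (a2 T_i)] cancel, as [T_i] is imaginary. *)
Lemma derive_chart_p (T : 'I_3 -> H) (i : 'I_3) (t : R) (a1 a2 g : H) :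
  su2 (T i) ->
  'D_(frame_field T (Some (true, i)) (t, a1, a2, g)) chart (t, a1, a2, g) =
  (t *: qmul a1 (T i), 0, 0).
Proof.
move=> Ti; rewrite /frame_field /=; have [_ ->] := derive_chart t 0 a1 a2 g (qmul a1 (T i)) (qmul a2 (T i)).
rewrite scale0r add0r qconjM (su2_conj Ti) -qmulA -scaleN1r qmulZl qmulZr scaleN1r.
by rewrite subrr.
Qed.

(** The sign in [T_i^-] turns the cancellation of [derive_chart_p] into a doubling. *)
Lemma derive_chart_m (T : 'I_3 -> H) (i : 'I_3) (t : R) (a1 a2 g : H) :
  su2 (T i) ->
  'D_(frame_field T (Some (false, i)) (t, a1, a2, g)) chart (t, a1, a2, g) =
  (t *: qmul a1 (T i), 2 *: qmul (qmul a1 (T i)) (qconj a2), 0).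
Proof.
move=> Ti; rewrite /frame_field /=; have [_ ->] := derive_chart t 0 a1 a2 g (qmul a1 (T i)) (qmul a2 (- T i)).
rewrite scale0r add0r qconjM -(su2_conj Ti) qconjK qmulA.
by rewrite -mulr2n -scaler_nat.
Qed.

Lemma derive_chart_dt (T : 'I_3 -> H) (t : R) (a1 a2 g : H) :
  'D_(frame_field T None (t, a1, a2, g)) chart (t, a1, a2, g) = (a1, 0, 0).
Proof.
rewrite /frame_field /=; have [_ ->] := derive_chart t 1 a1 a2 g (qmul a1 0) (qmul a2 0).
by rewrite !qmul0r qconj0 qmul0r qmul0l scale1r scaler0 !addr0.
Qed.

End ChartDerivative.

Section SmoothExtensionNecessary.
Context {R : realType}.
Local Notation H := (quat R).
Variables (A B : 'I_3 -> R -> R) (T : 'I_3 -> H).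
Hypothesis hT : standard_basis T.
Variables (e : R) (fp fm : 'I_3 -> R -> R).
Hypothesis e0 : 0 < e.
Hypothesis ext : extends_on_P1 T e (theta_of A B T fp fm).

Lemma linearZ_at (V W : lmodType R) (f : V -> W) : linear f -> forall c v, f (c *: v) = c *: f v.
Proof.
move=> lf c v; have f0 : f 0 = 0.
  by have := lf (- 1) 0 0; rewrite scaler0 add0r scaleN1r addNr.
by rewrite -[c *: v]addr0 lf f0 addr0.
Qed.

Lemma basis_coord i : exists l, T i 0 l != 0.
Proof.
have := basis_scale_eq0 hT 1 i; rewrite scale1r oner_eq0 => /negbT/eqP Ti.
apply/existsP; apply: contra_notT Ti; rewrite negb_exists => /forallP Tl.
by apply/rowP => l; rewrite mxE; apply/eqP; have := Tl l; rewrite negbK.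
Qed.

Lemma ball_sub_open (U : set R) : open U -> U 0 -> exists2 r : R, 0 < r & forall s, `|s| < r -> U s.
Proof.
move=> oU U0; have /nbhs_ballP[r r0 Hr] : nbhs (0 : R) U by exact: open_nbhs_nbhs.
by exists r => // s sr; apply: Hr; rewrite /ball /= sub0r normrN.
Qed.

Definition base_path (s : R) : H * H * H := (s *: qone, qone, qone).

(** [chi] and [mu] are read from the connection along [(T_i, 0, 0)] and [(0, T_i, 0)] at
    [(s, 1, 1)], through one nonzero coordinate of [T_i], and make sense for [s <= 0] too. The frame
    vectors [T_i^+] and [T_i^-] push forward to [t (T_i, 0, 0)] and
    [t (T_i, 0, 0) + 2 (0, T_i, 0)]. *)
Lemma extension_profiles i : exists r : R, exists chi mu : R -> R,
  [/\ 0 < r, smooth [set s : R | `|s| < r] chi, smooth [set s : R | `|s| < r] mu &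
   forall t : R, 0 < t < r -> t < e ->
    [/\ A i t * fp i t = t * chi t, chi (- t) = - chi t & B i t * fm i t = t * chi t + 2 * mu t]].
Proof.
have [U [w [oU U0 [sw lw _ _ _] wE]]] := ext.
have Ti : su2 (T i) by have [h _ _] := hT; exact: h.
have pathE s : s *: ((qone, 0, 0) : H * H * H) + (0, qone, qone) = base_path s.
  rewrite -[LHS]/(s *: qone + 0, s *: (0 : H) + qone, s *: (0 : H) + qone).
  by rewrite !scaler0 !add0r addr0.
pose U' := [set s : R | U (s *: ((qone, 0, 0) : H * H * H) + (0, qone, qone))].
have oU' : open U'.
  apply: (@open_comp _ _ (fun s : R => s *: ((qone, 0, 0) : H * H * H) + (0, qone, qone)) U) => // s _.
  by apply: cvgD; [apply: cvgZr_tmp; exact: cvg_id|exact: cvg_cst].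
have [r r0 Hr] : exists2 r : R, 0 < r & forall s, `|s| < r -> U' s.
  apply: ball_sub_open => //; rewrite /U' /= scale0r add0r.
  by apply: U0; exact: SU2_qone.
have [l Tl] := basis_coord i.
pose W v (s : R) := w (base_path s) v 0 l / T i 0 l.
have sW v : smooth [set s : R | `|s| < r] (W v).
  have oI : open [set s : R | `|s| < r] by exact: open_norm_lt.
  apply: smoothM => //; last exact: smooth_cst.
  have -> : (fun s : R => w (base_path s) v 0 l) =
      (fun s : R => w (s *: ((qone, 0, 0) : H * H * H) + (0, qone, qone)) v 0 l).
    by apply/funext => s; rewrite pathE.
  apply: smooth_coord => //; apply: smooth_sub (smooth_line _ _ oU (sw v)).
  exact: Hr.
have Ub s : `|s| < r -> U (base_path s) by move=> /Hr; rewrite /U' /= pathE.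
have chart1 (t : R) : chart (t, qone, qone, qone) = base_path t :> H * H * H.
  by rewrite /chart qconj1 qmul1l.
(* The element [(-1, -1)] sends [p] to [- p] and fixes [q], so the same invariant form is read at
   both ends of the path; this yields the oddness of [chi]. *)
have chartN (t : R) : chart (t, - qone, - qone, qone) = base_path (- t) :> H * H * H.
  have -> : - qone = (-1) *: qone :> H by rewrite scaleN1r.
  rewrite /chart /base_path qconjZ qmulZl qmulZr qconj1 qmul1l !scalerA mulrN1.
  by rewrite mulrNN mulr1 scale1r.
exists r, (W (T i, 0, 0)), (W (0, T i, 0)); split => // t /andP[t0 tr] te.
have Ut : U (base_path t) by apply: Ub; rewrite gtr0_norm.
have UNt : U (base_path (- t)) by apply: Ub; rewrite normrN gtr0_norm.
have t0e : 0 < t < e by rewrite t0.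
have h1 := wE t qone qone qone t0e SU2_qone SU2_qone SU2_qone.
have h2 := wE t (- qone) (- qone) qone t0e SU2_qoneN SU2_qoneN SU2_qone.
cbv zeta in h1, h2; rewrite chart1 in h1; rewrite chartN in h2.
have := h1 Ut (Some (true, i)); have := h1 Ut (Some (false, i)); have := h2 UNt (Some (true, i)).
rewrite !derive_chart_p // !derive_chart_m // !on_frame_theta qconj1 !qmul1l !qmul1r /coef_of.
have -> : qmul (- qone) (T i) = - T i by rewrite -scaleN1r qmulZl qmul1l scaleN1r.
have -> : (t *: - T i, 0, 0) = (- t) *: ((T i, 0, 0) : H * H * H).
  by rewrite -[RHS]/(- t *: T i, - t *: (0 : H), - t *: (0 : H)) !scaler0 scalerN scaleNr.
have -> : (t *: T i, 2 *: T i, 0) = t *: ((T i, 0, 0) : H * H * H) + 2 *: ((0, T i, 0) : H * H * H).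
  rewrite -[RHS]/(t *: T i + 2 *: (0 : H), t *: (0 : H) + 2 *: T i, t *: (0 : H) + 2 *: (0 : H)).
  by rewrite !scaler0 !add0r !addr0.
have -> : (t *: T i, 0, 0) = t *: ((T i, 0, 0) : H * H * H).
  by rewrite -[RHS]/(t *: T i, t *: (0 : H), t *: (0 : H)) !scaler0.
rewrite (lw _ Ut) !(linearZ_at (lw _ Ut)) (linearZ_at (lw _ UNt)).
move=> /rowP/(_ l) + /rowP/(_ l) + /rowP/(_ l); rewrite !mxE /W => e1 e2 e3.
split.
- by rewrite mulrA e3 mulfK.
- have tn0 := lt0r_neq0 t0; apply: (mulfI tn0); rewrite mulrN [in RHS]mulrA e3 -e1.
  by rewrite mulNr -mulNr mulrA mulNr; ring.
by rewrite !mulrA -mulrDl e2 mulfK.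
Qed.

End SmoothExtensionNecessary.

(** * Parameters of a smoothly extending instanton *)

Section InstantonIsFamilyMember.
Context {R : realType}.
Variables (A B : 'I_3 -> R -> R) (a3 : 'I_3 -> R) (b0 : R) (a be al : 'I_3 -> R -> R).
Hypothesis hb0 : 0 < b0.
Hypothesis cd : coef_data A B a3 b0 a be al.
Variable T : 'I_3 -> quat R.
Hypothesis hT : standard_basis T.
Local Notation symI r := [set s : R | `|s| < r].

Lemma smooth_bound_at0 (g : R -> R) (r : R) : 0 < r -> smooth (symI r) g ->
  exists C d : R, [/\ 0 <= C, 0 < d & forall s, `|s| < d -> `|g s| <= C].
Proof.
move=> r0 sg; have g0 : symI r 0 by rewrite /= normr0.
have [d d0 Hd] := continuous_ball (smooth_continuous sg g0) (ltr01 : 0 < 1 :> R).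
exists (`|g 0| + 1), d; split => // s sd; have := Hd s; rewrite subr0 => /(_ sd) h.
have := ler_normD (g s - g 0) (g 0); rewrite subrK; lra.
Qed.

Variables (e : R) (fp fm : 'I_3 -> R -> R).
Hypothesis e0 : 0 < e.

(** [f_i^+ / t] equals [(chi / t) / a_i], smooth and even through 0, so it differs from its value
    there by [O(t^2)]. That value is [2 * chi' (0)] because [a_i (0) = 1/2]. *)
Lemma even_quotient_bound (c : 'I_3 -> R) i (r : R) (chi : R -> R) : 0 < r ->
  smooth (symI r) chi -> c i = 2 * derive1 chi 0 ->
  (forall t : R, 0 < t < r -> A i t * fp i t = t * chi t /\ chi (- t) = - chi t) ->
  exists C d : R, 0 < d /\ forall t : R, 0 < t < d -> `|fp i t / t - c i| <= C * t ^+ 2.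
Proof.
move=> r0 schi ci Hchi; have oI : open (symI r) by exact: open_norm_lt.
have I0 : symI r 0 by rewrite /= normr0.
have chi0 : chi 0 = 0.
  have cN : {for (0 : R), continuous (fun s => chi (- s))}.
    apply: (@continuous_comp _ _ _ (fun s : R => - s) chi); first exact: opp_continuous.
    by rewrite oppr0; exact: smooth_continuous schi I0.
  have cN' : {for (0 : R), continuous (fun s => - chi s)}.
    by apply: cvgN; exact: smooth_continuous schi I0.
  have := eq_at0 r0 cN cN' (fun t tr => (Hchi t tr).2); rewrite oppr0; lra.
have sq := smooth_quo oI schi chi0 (@balanced_sym _ r).
have an s : a i s != 0 by exact: lt0r_neq0 (cd_a0 cd i s).
have sm : smooth (symI r) (fun s => quo chi s / a i s).
  by apply: smoothM => //; apply: smoothV => //; apply: smooth_sub (cd_sa cd i).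
pose V := even_quotient c fp i.
have Vpos (s : R) : 0 < s < r -> fp i s / s = quo chi s / a i s.
  move=> sr; have s0 : 0 < s by case/andP: sr.
  have [h _] := Hchi s sr; rewrite quoE ?lt0r_neq0 //.
  rewrite (cd_A cd) ?ltW // -mulrA in h; rewrite -(mulfI (lt0r_neq0 s0) h).
  by field; rewrite an lt0r_neq0.
have qE (s : R) : 0 < s < r -> quo chi (- s) = quo chi s.
  move=> sr; have s0 : 0 < s by case/andP: sr.
  have [_ h] := Hchi s sr; rewrite !quoE ?oppr_eq0 ?lt0r_neq0 //.
  by rewrite h invrN mulrNN.
have VE s : symI r s -> quo chi s / a i s = V s.
  move=> sr; rewrite /V /even_quotient; have [->|sn0] := eqVneq s 0.
    by rewrite quo0 (cd_a00 cd) ci invrK mulrC.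
  have ns : 0 < `|s| < r by rewrite normr_gt0 sn0.
  rewrite Vpos //; have [s0|s0] := ger0P s => //.
  by rewrite (ltr0_norm s0) in ns; rewrite (cd_ea cd) -(qE _ ns) opprK.
have sV : smooth (symI r) V by exact: smooth_ext_open VE sm.
have eV s : V (- s) = V s by rewrite /V /even_quotient oppr_eq0 normrN.
have sE : smooth (symI r) (equo V) by apply: smooth_equo => //; exact: balanced_sym.
have [C [d [C0 d0 HC]]] := smooth_bound_at0 r0 sE.
exists C, d; split => // t /andP[t0 td].
have -> : fp i t / t = V t by rewrite /V /even_quotient (gt_eqF t0) gtr0_norm.
have V0 : V 0 = c i by rewrite /V /even_quotient eqxx.
rewrite (equoE oI I0 sV eV t) V0 addrAC subrr add0r normrM (ger0_norm (sqr_ge0 t)) mulrC.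
by rewrite ler_wpM2r ?sqr_ge0 // HC // gtr0_norm.
Qed.

Lemma family_of_instanton : instanton_on_P1 A B T e fp fm ->
  (forall i (t : R), 0 < t < e -> fm i t = 0) /\
  exists c : 'I_3 -> R, family_member A B b0 a3 e c fp.
Proof.
move=> [sfpm inst ext].
have inU (t : R) : 0 < t < e -> `]0, e[%classic t by rewrite /= in_itv.
have dfp i (t : R) : 0 < t < e -> derivable (fp i) t 1.
  by move=> /inU; apply: smooth1_derivable; have [] := sfpm i.
have dfm i (t : R) : 0 < t < e -> derivable (fm i) t 1.
  by move=> /inU; apply: smooth1_derivable; have [] := sfpm i.
have eqs (t : R) : 0 < t < e -> _ := fun te =>
  (instanton_at cd hT (proj1 (andP te)) (fun i => @dfp i t te) (fun i => @dfm i t te)).1 (inst t te).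
have /choice[r Hr] : forall i, exists r : R, exists chi mu : R -> R,
    [/\ 0 < r, smooth (symI r) chi, smooth (symI r) mu & forall t : R, 0 < t < r ->
     [/\ A i t * fp i t = t * chi t, chi (- t) = - chi t & B i t * fm i t = t * chi t + 2 * mu t]].
  move=> i; have [r [chi [mu [r0 schi smu H]]]] := extension_profiles hT ext i.
  exists (Num.min r e), chi, mu; split; first by rewrite lt_min r0.
  - by apply: smooth_sub schi => s /=; rewrite lt_min => /andP[].
  - by apply: smooth_sub smu => s /=; rewrite lt_min => /andP[].
  by move=> t; rewrite lt_min => /and3P[t0 tr te]; apply: H; rewrite ?t0.
have /choice[chi Hchi] := Hr.
pose c i := 2 * derive1 (chi i) 0.
have qb i : exists C d : R, 0 < d /\ forall t : R, 0 < t < d -> `|fp i t / t - c i| <= C * t ^+ 2.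
  have [mu [r0 schi _ H]] := Hchi i; apply: (even_quotient_bound r0 schi) => // t tr.
  by have [] := H t tr.
have fm0 : forall i (t : R), 0 < t < e -> fm i t = 0.
  apply: (minus_part_vanishes hb0 cd dfp dfm) => [i t te|i|i].
  - by have [_] := eqs t te; exact.
  - have [C [d [d0 H]]] := qb i; exists (`|c i| + `|C|), (Num.min d 1).
    split; first by rewrite lt_min d0 ltr01.
    move=> t; rewrite lt_min => /and3P[t0 td t1].
    have := H t; rewrite t0 => /(_ td) h.
    have -> : fp i t = t * ((fp i t / t - c i) + c i) by rewrite subrK mulrCA divff ?mulr1 // lt0r_neq0.
    rewrite normrM gtr0_norm //; have h2 := ler_normD (fp i t / t - c i) (c i).
    have h3 := ler_norm C; have h4 : t ^+ 2 <= 1 by rewrite expr_le1 // ltW.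
    have h5 : C * t ^+ 2 <= `|C|.
      apply: (le_trans (ler_norm _)); rewrite normrM (ger0_norm (sqr_ge0 t)).
      by rewrite ler_piMr.
    apply: (@le_trans _ _ (1 * `|fp i t / t - c i + c i|)).
      by rewrite ler_wpM2r // ltW.
    by rewrite mul1r; lra.
  - have [mu [r0 schi smu H]] := Hchi i.
    have sg : smooth (symI (r i)) (fun t => t * chi i t + 2 * mu t).
      have oI : open (symI (r i)) by exact: open_norm_lt.
      by apply: smoothD => //; [apply: smoothM => //; exact: smooth_id|exact: smoothZ].
    have [C [d [C0 d0 HC]]] := smooth_bound_at0 r0 sg.
    exists C, (Num.min d (r i)); split; first by rewrite lt_min d0.
    move=> t; rewrite lt_min => /and3P[t0 td tr].
    rewrite /coef_of; have [|_ _ ->] := H t; first by rewrite t0.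
    by apply: HC; rewrite gtr0_norm.
split => //; exists c.
(* Once [f^-] is known to vanish, the term [f_j^- f_k^-] leaves the equations for [f^+]. *)
have ode : instanton_ODE A B e fp.
  by move=> i t te /=; have [h _] := eqs t te; rewrite h !fm0 // mul0r sub0r.
have HV := reduced_sol_quotient cd ode dfp qb.
apply: (family_of_reduced hb0 cd e0 HV) => i t /andP[t0 te].
rewrite /even_quotient gt_eqF // gtr0_norm // mulrCA divff ?mulr1 //.
exact: lt0r_neq0.
Qed.

End InstantonIsFamilyMember.

(** * Construction of the extension *)

Section RadialFunctions.
Context {R : realType}.
Local Notation symI r := [set s : R | `|s| < r].

Lemma is_derive_line (V W : normedModType R) (f : V -> W) x v d :
  is_derive (0 : R) 1 (fun s : R => f (s *: v + x)) d -> is_derive x v f d.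
Proof.
have E : (fun h : R => h^-1 *: (((fun s : R => f (s *: v + x)) \o shift 0) (h *: (1 : R)) - f ((0 : R) *: v + x)))
    = (fun h : R => h^-1 *: ((f \o shift x) (h *: v) - f x)).
  apply/funext => h; rewrite /= addr0 scale0r add0r.
  by rewrite (_ : h *: (1 : R) = h) // /GRing.scale /= mulr1.
by move=> [dF <-]; split; [move: dF; rewrite /derivable E|rewrite /derive E].
Qed.

Lemma derive1_even_on (e : R) (h : R -> R) : smooth (symI e) h ->
  (forall s, symI e s -> h (- s) = h s) -> forall s, symI e s -> derive1 h (- s) = - derive1 h s.
Proof.
move=> sh eh s se; have oI : open (symI e) by exact: open_norm_lt.
have se' : symI e (- s) by rewrite /= normrN.
have D := isd_comp (f := h) (g := fun u => - u) (smooth1_is_derive sh se') (isdN (isd_id s)).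
have D2 : is_derive s 1 h (derive1 h (- s) * -1) by exact: (is_derive_ext_open oI se (fun u ue => eh u ue) D).
by rewrite (is_derive1P D2) mulrN1 opprK.
Qed.

Lemma quo_derive1_even (e : R) (h : R -> R) : 0 < e -> smooth (symI e) h ->
  (forall s, symI e s -> h (- s) = h s) ->
  [/\ derive1 h 0 = 0, smooth (symI e) (quo (derive1 h)) &
      forall s, symI e s -> quo (derive1 h) (- s) = quo (derive1 h) s].
Proof.
move=> e0 sh eh; have oI : open (symI e) by exact: open_norm_lt.
have oh := derive1_even_on sh eh.
have h0 : derive1 h 0 = 0 by have := oh 0; rewrite /= normr0 oppr0 => /(_ e0); lra.
split=> // [|s se].
  by apply: (smooth_quo oI) => //; [exact: smooth1_derive|exact: balanced_sym].
have [->|s0] := eqVneq s 0; first by rewrite oppr0.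
by rewrite !quoE ?oppr_eq0 // oh // invrN mulrNN.
Qed.

(** [N] is a quadratic form with polar form [b], possibly degenerate: in the application it is the
    squared norm of [p] alone on the triples [(p, q, g)]. *)
Variables (V : normedModType R) (N : V -> R) (b : V -> V -> R) (e : R).
Hypothesis e0 : 0 < e.
Hypothesis N0 : forall x, 0 <= N x.
Hypothesis NE : forall x v (s : R), N (s *: v + x) = N x + 2 * s * b v x + s ^+ 2 * N v.
Hypothesis sN : smooth (setT : set V) N.
Hypothesis sb : forall v, smooth (setT : set V) (b v).
Local Notation U := [set x : V | N x < e ^+ 2].
Local Notation r x := (Num.sqrt (N x)).

Lemma open_radial_ball : open U.
Proof.
have -> : U = N @^-1` [set s : R | s < e ^+ 2] by [].
apply: open_comp; last exact: open_lt.
by move=> x _; exact: smooth_continuous sN _.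
Qed.

Lemma radius_lt x : U x -> symI e (r x).
Proof.
move=> Ux; rewrite /= ger0_norm ?sqrtr_ge0 //.
by rewrite -(ltr_pXn2r (n := 2)) ?nnegrE ?sqrtr_ge0 ?ltW // sqr_sqrtr.
Qed.

Lemma radius_continuous x : {for x, continuous (fun x => r x)}.
Proof.
apply: (@continuous_comp _ _ _ N Num.sqrt); last exact: sqrt_continuous.
exact: smooth_continuous sN _.
Qed.

(* With [k u = h' u / u], the function [h u - k s * u ^+ 2 / 2] is negligible
   near [s = r x] compared with [u ^+ 2 - s ^+ 2], which is a polynomial along
   lines; this treats [r x = 0] together with the other points. *)
Lemma is_derive_radial (h : R -> R) x v : smooth (symI e) h ->
  (forall s, symI e s -> h (- s) = h s) -> U x ->
  is_derive x v (fun x => h (r x)) (quo (derive1 h) (r x) * b v x).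
Proof.
move=> sh eh Ux; have [h0 sk _] := quo_derive1_even e0 sh eh.
set k := quo (derive1 h) in sk *; apply: is_derive_line; apply/is_derive_near_bound => d d0.
set s := r x; set B := b v x; set n := N v.
have s0 : 0 <= s := sqrtr_ge0 _.
have se : s < e by have := radius_lt Ux; rewrite /= ger0_norm ?sqrtr_ge0.
have n0 : 0 <= n := N0 v.
have M0 : 0 < 2 * `|B| + n + 1 by have := normr_ge0 B; lra.
(* Since [|t^2 - s^2| <= |q| (2 |B| + n)] for [|q| <= 1], this keeps the variation of [phi] below
   [d / 2 * |q|]; the other half of [d] covers the term in [q ^+ 2]. *)
pose d1 := d / 2 / (2 * `|B| + n + 1).
have d10 : 0 < d1 by rewrite !divr_gt0.
have [del del0 Hdel] := continuous_ball (smooth_continuous sk (radius_lt Ux)) d10.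
have ct : {for (0 : R), continuous (fun q : R => r (q *: v + x))}.
  apply: (@continuous_comp _ _ _ (fun q : R => q *: v + x) (fun x => r x)); last exact: radius_continuous.
  by apply: cvgD; [apply: cvgZr_tmp; exact: cvg_id|exact: cvg_cst].
have m0 : 0 < Num.min del (e - s) by rewrite lt_min del0 subr_gt0.
have [rho rho0 Hrho] := continuous_ball ct m0.
pose C := `|k s| * n + 1; have C0 : 0 < C by rewrite ltr_wpDl // mulr_ge0.
exists (Num.min rho (Num.min 1 (d / C))); first by rewrite !lt_min rho0 ltr01 divr_gt0.
move=> q; rewrite !lt_min => /and3P[q1 q2 q3].
have := Hrho q; rewrite subr0 scale0r !add0r -/s => /(_ q1).
set t := r (q *: v + x); rewrite lt_min => /andP[t1 t2].
have t0 : 0 <= t := sqrtr_ge0 _.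
have te : t < e by move: t2; rewrite ltr_norml => /andP[]; lra.
have ts : t ^+ 2 - s ^+ 2 = 2 * q * B + q ^+ 2 * n.
  by rewrite !sqr_sqrtr ?N0 // NE -/B -/n; ring.
pose phi u := h u - k s * (u ^+ 2 / 2).
have P : `|phi t - phi s| <= d1 * (s + t) * `|t - s|.
  apply: mvt_bound => u /andP[u1 u2].
  have u0 : 0 <= u by apply: le_trans u1; rewrite le_min s0.
  have ue : symI e u by rewrite /= ger0_norm // (le_lt_trans u2) // gt_max se.
  have us : u <= s + t by apply: (le_trans u2); rewrite ge_max lerDl t0 lerDr s0.
  have ust : `|u - s| <= `|t - s| by apply: between_norm; rewrite u1.
  have D : is_derive u 1 phi ((k u - k s) * u).
    have D1 := isdB (smooth1_is_derive sh ue) (isdZ (k s) (isdZ 2^-1 (isdX 1 u))).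
    have -> : phi = (fun y => h y - k s * (2^-1 * y ^+ 2)).
      by apply/funext => y; rewrite /phi (mulrC (y ^+ 2)).
    apply: isd_eq D1 _; rewrite expr1 -(mul_quo u h0) -/k.
    by field.
  split; first by case: D.
  rewrite (is_derive1P D) normrM (ger0_norm u0).
  apply: ler_pM => //; apply/ltW/Hdel; exact: le_lt_trans t1.
have Q : `|t ^+ 2 - s ^+ 2| <= `|q| * (2 * `|B| + n).
  rewrite ts (_ : _ + _ = q * (2 * B + q * n)); last by ring.
  rewrite normrM ler_wpM2l //; apply: (le_trans (ler_normD _ _)).
  rewrite normrM (ger0_norm (ler0n R 2)) lerD2l normrM (ger0_norm n0).
  by rewrite ler_piMl // ltW.
have P2 : `|phi t - phi s| <= d / 2 * `|q|.
  apply: (le_trans P); rewrite -mulrA -(ger0_norm (addr_ge0 s0 t0)) -normrM.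
  rewrite (_ : (s + t) * (t - s) = t ^+ 2 - s ^+ 2); last by ring.
  apply: (@le_trans _ _ (d1 * (`|q| * (2 * `|B| + n)))); first by rewrite ler_pM2l.
  rewrite mulrCA mulrC ler_wpM2r // /d1 mulrAC ler_pdivrMr // ler_pM2l ?divr_gt0 //.
  by rewrite lerDl.
have -> : h t - h s - k s * B * q = (phi t - phi s) + k s * n / 2 * q ^+ 2.
  have E : t ^+ 2 = s ^+ 2 + (2 * q * B + q ^+ 2 * n) by rewrite -ts addrC subrK.
  by rewrite /phi /= E; move: (h t) (h s) (k s) => x1 x2 x3; field.
apply: (le_trans (ler_normD _ _)).
have q3' : C * `|q| <= d by move: q3; rewrite ltr_pdivlMr // mulrC => /ltW.
have -> : `|k s * n / 2 * q ^+ 2| = `|k s| * n / 2 * `|q| * `|q|.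
  by rewrite !normrM (ger0_norm n0) normfV (ger0_norm (ler0n R 2)) mulrA.
have q0 := normr_ge0 q; have : `|k s| * n / 2 * `|q| * `|q| <= d / 2 * `|q|.
  rewrite ler_wpM2r //; move: q3'; rewrite /C mulrDl mul1r.
  by move: (`|k s| * n) => y; lra.
by move: P2; lra.
Qed.

(** The derivative of [h (r x)] is [k (r x) * b v x] with [k u = h' u / u] again smooth and even, so
    such functions generate an algebra stable under derivatives although [r] itself need not be
    smooth where it vanishes. *)
Lemma smooth_radial (h : R -> R) : smooth (symI e) h ->
  (forall s, symI e s -> h (- s) = h s) -> smooth U (fun x => h (r x)).
Proof.
move=> sh eh.
pose X (f : V -> R) := exists h, [/\ smooth (symI e) h, forall s, symI e s -> h (- s) = h s & f = fun x => h (r x)].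
apply: (@salg_smooth _ _ _ X open_radial_ball); last by apply: SalgBase; exists h.
move=> _ [{sh eh}h [sh eh ->]]; split=> [x Ux|v].
  apply: (@continuous_comp _ _ _ (fun x => r x) h); first exact: radius_continuous.
  exact: smooth_continuous sh (radius_lt Ux).
split=> [x Ux|]; first by have [] := is_derive_radial v sh eh Ux.
have [_ sk ek] := quo_derive1_even e0 sh eh.
apply: (SalgExt (f := fun x => quo (derive1 h) (r x) * b v x)).
  apply: SalgM; first by apply: SalgBase; exists (quo (derive1 h)).
  by apply: SalgSmooth; apply: smooth_sub (sb v).
by move=> x Ux; have [] := is_derive_radial v sh eh Ux.
Qed.

End RadialFunctions.

Section VectorSmoothness.
Context {R : realType}.

Lemma smooth_functional (V : normedModType R) (f : V -> R) :
  (forall (c : R) u v, f (c *: u + v) = c * f u + f v) -> continuous f -> smooth (setT : set V) f.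
Proof.
move=> lf cf.
pose X (f : V -> R) := (forall (c : R) u v, f (c *: u + v) = c * f u + f v) /\ continuous f.
apply: (@salg_smooth _ _ _ X openT); last by apply: SalgBase.
move=> {lf cf}f [lf cf]; split=> [x _|v]; first exact: cf.
have D x : is_derive x v f (f v).
  apply: (derive_quadratic (Q := 0)) => h.
  by rewrite lf scaler0 addr0 addrC.
split=> [x _|]; first by have [] := D x.
apply: (SalgExt (f := fun=> f v)); first by apply: SalgSmooth; exact: (smooth_cst openT (f v)).
by move=> x _; have [] := D x.
Qed.

Lemma smooth_lincomb (V W : normedModType R) (U : set V) (n : nat) (F : 'I_n -> V -> R) (E : 'I_n -> W) :
  open U -> (forall i, smooth U (F i)) -> smooth U (fun x => \sum_i F i x *: E i).
Proof.
move=> oU sF.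
suff: forall g : V -> W, (exists2 F : 'I_n -> V -> R, forall i, smooth U (F i) & g = fun x => \sum_i F i x *: E i) ->
  smooth U g by apply; exists F.
apply: smooth_coind => // _ {F sF} [F sF ->].
have sumE (G : 'I_n -> V -> R) : (fun x => \sum_i G i x *: E i) = \sum_i (fun x => G i x *: E i).
  by apply/funext => x; rewrite fct_sumE.
split=> [x Ux|v].
  rewrite sumE; apply: (@big_ind _ (fun f : V -> W => {for x, continuous f})) => [|f g|i _].
  - exact: cvg_cst.
  - exact: cvgD.
  - by apply: cvgZr_tmp; exact: smooth_continuous (sF i) Ux.
have D x : U x -> is_derive x v (fun x => \sum_i F i x *: E i) (\sum_i 'D_v (F i) x *: E i).
  move=> Ux; rewrite sumE; apply: is_derive_sum => i.
  by apply: is_derive_scale; exact: smooth_derivable (sF i) Ux.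
split=> [x Ux|]; first by have [] := D x Ux.
exists (fun x => \sum_i 'D_v (F i) x *: E i); last by move=> x Ux; have [] := D x Ux.
by exists (fun i => 'D_v (F i)) => // i; exact: smooth_derive.
Qed.

Lemma smooth_row (V : normedModType R) (U : set V) (n : nat) (f : V -> 'rV[R]_n.+1) : open U ->
  (forall l, smooth U (fun x => f x 0 l)) -> smooth U f.
Proof.
move=> oU sf; have := smooth_lincomb (fun l => delta_mx 0 l : 'rV[R]_n.+1) oU sf.
by apply: smooth_ext_open => // x _; rewrite -row_sum_delta.
Qed.

Variables (V : normedModType R) (U : set V).
Hypothesis oU : open U.
Implicit Types f g : V -> quat R.

Definition csmooth f := forall l, smooth U (fun x => f x 0 l).

Lemma csmooth_mk (f0 f1 f2 f3 : V -> R) : smooth U f0 -> smooth U f1 -> smooth U f2 -> smooth U f3 ->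
  csmooth (fun x => mkquat (f0 x) (f1 x) (f2 x) (f3 x)).
Proof.
move=> s0 s1 s2 s3; case=> -[|[|[|[|//]]]] l4.
- by apply: smooth_ext_open s0 => // x _; rewrite mxE.
- by apply: smooth_ext_open s1 => // x _; rewrite mxE.
- by apply: smooth_ext_open s2 => // x _; rewrite mxE.
- by apply: smooth_ext_open s3 => // x _; rewrite mxE.
Qed.

Lemma csmooth_qmul f g : csmooth f -> csmooth g -> csmooth (fun x => qmul (f x) (g x)).
Proof.
by move=> sf sg; apply: csmooth_mk; repeat first [exact: smoothM|apply: smoothB => //|apply: smoothD => //].
Qed.

Lemma csmooth_qconj f : csmooth f -> csmooth (fun x => qconj (f x)).
Proof. by move=> sf; apply: csmooth_mk => //; exact: smoothN. Qed.

Lemma csmoothD f g : csmooth f -> csmooth g -> csmooth (fun x => f x + g x).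
Proof.
by move=> sf sg l; apply: (smooth_ext_open oU _ (smoothD oU (sf l) (sg l))) => x _; rewrite mxE.
Qed.

Lemma csmooth_scale (k : V -> R) f : smooth U k -> csmooth f -> csmooth (fun x => k x *: f x).
Proof.
by move=> sk sf l; apply: (smooth_ext_open oU _ (smoothM oU sk (sf l))) => x _; rewrite mxE.
Qed.

Lemma csmooth_cst (c : quat R) : csmooth (fun=> c).
Proof. by move=> l; exact: (smooth_cst oU (c 0 l)). Qed.

Lemma csmooth_sum (I : Type) (s : seq I) (F : I -> V -> quat R) : (forall i, csmooth (F i)) ->
  csmooth (fun x => \sum_(i <- s) F i x).
Proof.
move=> sF l; have := smooth_sum oU s (fun i => sF i l).
by apply: smooth_ext_open => // x _; rewrite summxE.
Qed.

End VectorSmoothness.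

Section DualBasis.
Context {R : realType}.
Variable T : 'I_3 -> quat R.
Hypothesis hT : standard_basis T.

Lemma dual_basis : exists L : 'I_3 -> 'I_4 -> R,
  (forall i j, \sum_l L i l * T j 0 l = (i == j)%:R) /\ (forall i, L i 0 = 0).
Proof.
have [T0 rf _] := hT; pose M := \matrix_(i < 3) T i; pose P := pinvmx M.
have MP : M *m P = 1%:M by exact: mulmxVp.
(* Setting the real coordinate to 0 does not affect the pairing with the imaginary [T_j], and makes
   the functionals annihilate real quaternions. *)
exists (fun i l => if l == 0 then 0 else P l i); split=> [i j|i]; last by rewrite eqxx.
transitivity ((M *m P) j i); last by rewrite MP mxE eq_sym.
have Mj l : M j l = T j 0 l by rewrite mxE.
rewrite mxE; apply: eq_bigr => l _; rewrite Mj mulrC; case: eqP => [->|//].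
by have := T0 j; rewrite /su2 /= => ->; rewrite !mul0r.
Qed.

End DualBasis.

Section Extension.
Context {R : realType}.
Local Notation H := (quat R).
Local Notation P := (H * H * H)%type.
Local Notation symI r := [set s : R | `|s| < r].

Definition qnorm2 (x : H) : R := \sum_(l < 4) x 0 l ^+ 2.

Lemma qconj_mull (x : H) : qmul (qconj x) x = qnorm2 x *: qone.
Proof.
rewrite /qnorm2 !big_ord_recl big_ord0 /qone.
have E1 : lift ord0 ord0 = 1 :> 'I_4 by exact: val_inj.
have E2 : lift ord0 (lift ord0 ord0) = 2%:R :> 'I_4 by exact: val_inj.
have E3 : lift ord0 (lift ord0 (lift ord0 ord0)) = 3%:R :> 'I_4 by exact: val_inj.
by rewrite E1 E2 E3; apply: quatP; split; rewrite !mxE /= ?mxE /=; ring.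
Qed.

Lemma SU2_conj_mull (x : H) : SU2 x -> qmul (qconj x) x = qone.
Proof. by move=> x1; rewrite qconj_mull (x1 : qnorm2 x = 1) scale1r. Qed.

Lemma qnorm2_scale (t : R) (x : H) : SU2 x -> qnorm2 (t *: x) = t ^+ 2.
Proof.
rewrite /SU2 /= => x1; rewrite /qnorm2.
under eq_bigr do rewrite mxE exprMn.
by rewrite -big_distrr /= x1 mulr1.
Qed.

Lemma qconj_conjugation_re (g x : H) : (qmul (qmul (qconj g) x) g) 0 0 = qnorm2 g * x 0 0.
Proof.
rewrite /qnorm2 !big_ord_recl big_ord0.
have E1 : lift ord0 ord0 = 1 :> 'I_4 by exact: val_inj.
have E2 : lift ord0 (lift ord0 ord0) = 2%:R :> 'I_4 by exact: val_inj.
have E3 : lift ord0 (lift ord0 (lift ord0 ord0)) = 3%:R :> 'I_4 by exact: val_inj.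
by rewrite E1 E2 E3 !mxE /= ?mxE /=; ring.
Qed.

Variables (T : 'I_3 -> H) (L : 'I_3 -> 'I_4 -> R) (h : 'I_3 -> R -> R) (e : R).
Hypothesis hT : standard_basis T.
Hypothesis LT : forall i j, \sum_l L i l * T j 0 l = (i == j)%:R.
Hypothesis L0 : forall i, L i 0 = 0.
Hypothesis e0 : 0 < e.
Hypothesis sh : forall i, smooth (symI e) (h i).
Hypothesis eh : forall i (s : R), symI e s -> h i (- s) = h i s.

Definition lam (i : 'I_3) (u : H) : R := \sum_l L i l * u 0 l.

Lemma lamD i (c : R) (u v : H) : lam i (c *: u + v) = c * lam i u + lam i v.
Proof.
rewrite /lam mulr_sumr -big_split; apply: eq_bigr => l _ /=.
by rewrite !mxE mulrDr mulrCA.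
Qed.

Definition sqdist (x : P) : R := qnorm2 x.1.1.
Definition sqdist_polar (v x : P) : R := \sum_(l < 4) x.1.1 0 l * v.1.1 0 l.

(* Its value is [t^2 T_i] on [T_i^+], zero on [T_i^-], and the real quaternion
   [t], which [lam] annihilates, on [d/dt]. *)
Definition horizontal_part (x v : P) : H :=
  qmul (qconj x.1.1) v.1.1
  - 2^-1 *: qmul (qmul (qconj x.1.1) v.1.2) (qmul (qconj x.1.2) x.1.1).

Definition base_form (x v : P) : H :=
  \sum_i (h i (Num.sqrt (sqdist x)) * lam i (horizontal_part x v)) *: T i.

Definition connection_form (x v : P) : H :=
  qmul (qmul (qconj x.2) (base_form x v)) x.2 + qmul (qconj x.2) v.2.

Definition tube : set P := [set x | sqdist x < e ^+ 2].

Lemma coord_proj_smooth (f : P -> H) : (forall (c : R) u v, f (c *: u + v) = c *: f u + f v) ->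
  continuous f -> forall l, smooth (setT : set P) (fun x => f x 0 l).
Proof.
move=> lf cf l; apply: smooth_functional.
  by move=> c u v; rewrite lf !mxE.
move=> x; apply: (@continuous_comp _ _ _ f (fun y : H => y 0 l)); first exact: cf.
exact: coord_continuous.
Qed.

Lemma smooth_p l : smooth (setT : set P) (fun x : P => x.1.1 0 l).
Proof.
apply: coord_proj_smooth => // x.
by apply: (@continuous_comp _ _ _ (fun x : P => x.1) fst); exact: cvg_fst.
Qed.

Lemma smooth_q l : smooth (setT : set P) (fun x : P => x.1.2 0 l).
Proof.
apply: coord_proj_smooth => // x.
by apply: (@continuous_comp _ _ _ (fun x : P => x.1) snd); [exact: cvg_fst|exact: cvg_snd].
Qed.

Lemma smooth_g l : smooth (setT : set P) (fun x : P => x.2 0 l).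
Proof. by apply: coord_proj_smooth => // x; exact: cvg_snd. Qed.

Lemma sqdist_ge0 x : 0 <= sqdist x.
Proof. by apply: sumr_ge0 => l _; exact: sqr_ge0. Qed.

Lemma sqdist_line (x v : P) (s : R) :
  sqdist (s *: v + x) = sqdist x + 2 * s * sqdist_polar v x + s ^+ 2 * sqdist v.
Proof.
rewrite /sqdist /qnorm2 /sqdist_polar !mulr_sumr -!big_split; apply: eq_bigr => l _ /=.
by rewrite !mxE; ring.
Qed.

Lemma smooth_sqdist : smooth (setT : set P) sqdist.
Proof.
by apply: (smooth_sum openT) => l; apply: (smoothX openT); exact: smooth_p.
Qed.

Lemma smooth_sqdist_polar v : smooth (setT : set P) (sqdist_polar v).
Proof.
apply: (smooth_sum openT) => l; apply: (smoothM openT); first exact: smooth_p.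
exact: (smooth_cst openT).
Qed.

Lemma open_tube : open tube.
Proof. exact: open_radial_ball smooth_sqdist. Qed.

Lemma smooth_connection_form v : smooth tube (fun x => connection_form x v).
Proof.
have oU := open_tube.
have sp : csmooth tube (fun x : P => x.1.1) by move=> l; apply: smooth_sub (smooth_p l).
have sq : csmooth tube (fun x : P => x.1.2) by move=> l; apply: smooth_sub (smooth_q l).
have sg : csmooth tube (fun x : P => x.2) by move=> l; apply: smooth_sub (smooth_g l).
have sc (c : H) : csmooth tube (fun=> c) by exact: csmooth_cst.
have sH : csmooth tube (fun x => horizontal_part x v).
  rewrite /horizontal_part; apply: csmoothD => //.
    by apply: csmooth_qmul => //; exact: csmooth_qconj.
  have S : csmooth tube (fun x : P => - 2^-1 *: qmul (qmul (qconj x.1.1) v.1.2) (qmul (qconj x.1.2) x.1.1)).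
    apply: csmooth_scale => //; first exact: smooth_cst.
    by do ![apply: csmooth_qmul => //|apply: csmooth_qconj => //].
  by move=> l; apply: (smooth_ext_open oU _ (S l)) => x _; rewrite scaleNr.
apply: (smooth_row oU) => l; move: l.
apply: csmoothD => //; last by apply: csmooth_qmul => //; exact: csmooth_qconj.
apply: csmooth_qmul => //; apply: csmooth_qmul => //; first exact: csmooth_qconj.
apply: csmooth_sum => // i; apply: csmooth_scale => //; apply: smoothM => //.
  exact: (smooth_radial e0 sqdist_ge0 sqdist_line smooth_sqdist smooth_sqdist_polar (sh i) (eh i)).
by apply: smooth_sum => // l; apply: smoothM => //; exact: smooth_cst.
Qed.

Lemma horizontal_part_linear x (c : R) (u v : P) :
  horizontal_part x (c *: u + v) = c *: horizontal_part x u + horizontal_part x v.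
Proof.
rewrite /horizontal_part /= !(qmulDr, qmulDl, qmulZl, qmulZr) !scalerDr !scalerN !scalerA (mulrC c).
by rewrite opprD addrACA.
Qed.

Lemma base_form_linear x : linear (base_form x).
Proof.
move=> c u v; rewrite /base_form scaler_sumr -big_split; apply: eq_bigr => i _ /=.
by rewrite horizontal_part_linear lamD mulrDr scalerDl scalerA mulrCA.
Qed.

Lemma connection_form_linear x : linear (connection_form x).
Proof.
move=> c u v; rewrite /connection_form base_form_linear /= !(qmulDr, qmulDl, qmulZl, qmulZr).
by rewrite scalerDr addrACA.
Qed.

Lemma su2_base_form x v : su2 (base_form x v).
Proof.
rewrite /su2 /= /base_form summxE big1 // => i _; have [/(_ i) Ti _ _] := hT.
by rewrite mxE Ti mulr0.
Qed.

Lemma smooth_connection_tube : smooth_connection tube connection_form.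
Proof.
split.
- exact: smooth_connection_form.
- by move=> x _; exact: connection_form_linear.
- move=> x v _ _ [_ xv]; rewrite /su2 /= /connection_form mxE qconj_conjugation_re.
  by have := su2_base_form x v; rewrite /su2 /= => ->; rewrite mulr0 add0r; exact: xv.
- move=> p q g xi _ [_ /= g1] _; rewrite /connection_form /=.
  have -> : base_form (p, q, g) (0, 0, qmul g xi) = 0.
    rewrite /base_form big1 // => i _; rewrite /horizontal_part /= !qmul0r qmul0l scaler0 subr0.
    by rewrite /lam big1 ?mulr0 ?scale0r // => l _; rewrite mxE mulr0.
  by rewrite qmul0r qmul0l add0r qmulA SU2_conj_mull // qmul1l.
- move=> p q g v1 v2 v3 k _ _ _ _ _; rewrite /connection_form /= qconjM.
  have -> : base_form (p, q, qmul g k) (v1, v2, qmul v3 k) = base_form (p, q, g) (v1, v2, v3) by [].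
  by rewrite qmulDr qmulDl !qmulA.
Qed.

Lemma lam0 i : lam i 0 = 0.
Proof. by rewrite /lam big1 // => l _; rewrite mxE mulr0. Qed.

Lemma lamZ i (c : R) (u : H) : lam i (c *: u) = c * lam i u.
Proof. by rewrite -[c *: u]addr0 lamD lam0 addr0. Qed.

Lemma base_form_basis x v (c : R) i : horizontal_part x v = c *: T i ->
  base_form x v = (h i (Num.sqrt (sqdist x)) * c) *: T i.
Proof.
move=> E; have lamT j : lam j (T i) = (j == i)%:R by exact: LT.
rewrite /base_form E (bigD1 i) //= lamZ lamT eqxx mulr1 big1 ?addr0 // => j ji.
by rewrite lamZ lamT (negbTE ji) !mulr0 scale0r.
Qed.

Lemma connection_form_frame (A B fp fm : 'I_3 -> R -> R) (t : R) (a1 a2 g : H) (a : frame) :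
  0 < t < e -> SU2 a1 -> SU2 a2 ->
  (forall i, A i t * fp i t = t ^+ 2 * h i t) -> (forall i, fm i t = 0) ->
  let x := (t, a1, a2, g) in
  connection_form (chart x) ('D_(frame_field T a x) chart x) =
  qmul (qmul (qconj g) (on_frame (theta_of A B T fp fm t) a)) g.
Proof.
move=> /andP[t0 te] u1 u2 Ah f0 x.
have Ti i : su2 (T i) by have [+ _ _] := hT; exact.
have n1 : Num.sqrt (sqdist (chart x)) = t.
  by rewrite /sqdist /= qnorm2_scale // sqrtr_sqr gtr0_norm.
have C1 (v : H) : qmul (qmul (qconj a1) a1) v = v by rewrite SU2_conj_mull // qmul1l.
have [D2 bf] : ('D_(frame_field T a x) chart x).2 = 0 /\
    base_form (chart x) ('D_(frame_field T a x) chart x) =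
    if a is Some (s, i) then coef_of A B fp fm s i t *: T i else 0.
  case: a => [[[] i]|].
  - rewrite derive_chart_p //; split=> //; rewrite (@base_form_basis _ _ (t ^+ 2) i).
      by rewrite n1 /coef_of Ah mulrC.
    rewrite /horizontal_part /= qmul0r qmul0l scaler0 subr0.
    by rewrite qconjZ qmulZl qmulZr scalerA qmulA C1 expr2.
  - rewrite derive_chart_m //; split=> //; rewrite (@base_form_basis _ _ 0 i).
      by rewrite /coef_of f0 !mulr0.
    (* Along [T_i^-] the [q] component is twice [a1 T_i conj a2]; with the factor [1/2] the second
       term equals the first. *)
    rewrite /horizontal_part /= scale0r; apply/eqP; rewrite subr_eq0; apply/eqP.
    rewrite qconjZ qmulZl qmulZr scalerA qmulA C1.
    have -> : qmul (qconj (qmul a1 (qconj a2))) (t *: a1) = t *: a2.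
      by rewrite qconjM qconjK qmulZr -qmulA SU2_conj_mull // qmul1r.
    rewrite !qmulZl !qmulZr !qmulZl !scalerA -!qmulA SU2_conj_mull // qmul1r qmulA C1.
    by congr (_ *: _); field.
  - rewrite derive_chart_dt; split=> //; rewrite /base_form big1 // => i _.
    rewrite /horizontal_part /= qmul0r qmul0l scaler0 subr0.
    rewrite qconjZ qmulZl SU2_conj_mull // lamZ /lam big_ord_recl big1 => [|l _].
      by rewrite L0 mul0r addr0 !mulr0 scale0r.
    by rewrite /qone mxE; case: l => -[|[|[|//]]] /= ?; rewrite mulr0.
by rewrite on_frame_theta /connection_form bf D2 qmul0r addr0.
Qed.

End Extension.

(** * Extending family members over the singular orbit *)

Section FamilyIsInstanton.
Context {R : realType}.
Variables (A B : 'I_3 -> R -> R) (a3 : 'I_3 -> R) (b0 : R) (a be al : 'I_3 -> R -> R).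
Hypothesis cd : coef_data A B a3 b0 a be al.
Variable T : 'I_3 -> quat R.
Hypothesis hT : standard_basis T.
Variables (e : R) (fp fm : 'I_3 -> R -> R).
Hypothesis e0 : 0 < e.

Lemma instanton_of_family (c : 'I_3 -> R) : family_member A B b0 a3 e c fp ->
  (forall i (t : R), 0 < t < e -> fm i t = 0) -> instanton_on_P1 A B T e fp fm.
Proof.
move=> fam fm0; have [ode _] := fam; have [V HV fV] := reduced_of_family cd e0 fam.
have [_ eV _] := HV; have sV i := reduced_sol_smooth (cd_sal cd) HV i.
have oI : open [set s : R | `|s| < e] by exact: open_norm_lt.
have oJ : open `]0, e[%classic by exact: itv_open.
have JI : `]0, e[%classic `<=` [set s : R | `|s| < e].
  by move=> t; rewrite /= in_itv /= => /andP[t0 te]; rewrite gtr0_norm.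
have inJ (t : R) : 0 < t < e -> `]0, e[%classic t by rewrite /= in_itv.
have sfp i : smooth (`]0, e[%classic : set R) (fp i).
  apply: (smooth_ext_open oJ _ (smoothM oJ (smooth_id oJ) (smooth_sub JI (sV i)))).
  by move=> t; rewrite /= in_itv /= => te; rewrite fV.
have sfm i : smooth (`]0, e[%classic : set R) (fm i).
  apply: (smooth_ext_open oJ _ (smooth_cst oJ (0 : R))) => t.
  by rewrite /= in_itv /= => te; rewrite fm0.
split=> [i //|t te|].
  have t0 : 0 < t by case/andP: te.
  apply/(instanton_at cd hT t0) => [i|i|].
  - exact: smooth1_derivable (sfp i) (inJ t te).
  - exact: smooth1_derivable (sfm i) (inJ t te).
  split=> i.
    by rewrite /= (ode i t te) !fm0 // mul0r sub0r.
  rewrite /= (derive1_ext_open oJ (inJ t te) (g := fun=> 0)); last first.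
    by move=> s; rewrite /= in_itv /= => se; rewrite /coef_of fm0 // mulr0.
  by rewrite (is_derive1P (isd_cst t 0)) /coef_of !fm0 // !mulr0 !addr0.
have [L [LT L0]] := dual_basis hT.
(* This is the radial profile: [A_i f_i^+ = (t a_i) (t V_i) = t^2 h_i], matching the value [t^2 T_i]
   of the horizontal part on [T_i^+]. *)
pose h i s := a i s * V i s.
have sh i : smooth [set s : R | `|s| < e] (h i).
  by apply: smoothM => //; apply: smooth_sub (cd_sa cd i).
have eh i (s : R) : `|s| < e -> h i (- s) = h i s by rewrite /h (cd_ea cd) eV.
exists (tube e), (connection_form T L h); split.
- exact: open_tube.
- by move=> q g _ _; rewrite /tube /sqdist /qnorm2 /= big1 ?exprn_gt0 // => l _; rewrite mxE expr0n.
- by apply: smooth_connection_tube.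
move=> t a1 a2 g te u1 u2 _ x _ b.
apply: (connection_form_frame (e := e)) => // i; last exact: fm0.
have t0 : 0 <= t by case/andP: te => /ltW.
by rewrite fV // (cd_A cd) // /h; ring.
Qed.

End FamilyIsInstanton.

Theorem proposition5p3 (R : realType) (T : 'I_3 -> quat R)
  (A B : 'I_3 -> R -> R) (a3 : 'I_3 -> R) (b0 : R)
  (hT : standard_basis T)
  (hA : forall i, smooth_odd (A i))
  (hApos : forall i t, 0 < t -> 0 < A i t)
  (hAdot : forall i, (fun t => A i t / t) @ 0^'+ --> (2^-1 : R))
  (hA3 : forall i, exists C : R, \forall t \near 0^'+,
           `|A i t - (t / 2 + a3 i * t ^+ 3)| <= C * t ^+ 5)
  (hb0 : 0 < b0)
  (hB : forall i, smooth_even (B i))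
  (hBpos : forall i t, 0 <= t -> 0 < B i t)
  (hB0 : forall i, B i 0 = b0)
  (hAB : coclosed_equations A B) :
  [/\ forall c : 'I_3 -> R, exists2 e : R, 0 < e &
        exists fp : 'I_3 -> R -> R, family_member A B b0 a3 e c fp,
      forall (e : R) (c c' : 'I_3 -> R) (fp fp' : 'I_3 -> R -> R), 0 < e ->
        family_member A B b0 a3 e c fp -> family_member A B b0 a3 e c' fp' ->
        ((forall i, c i = c' i) <->
         (forall i t, 0 < t < e -> fp i t = fp' i t))
    & forall (e : R) (fp fm : 'I_3 -> R -> R), 0 < e ->
        instanton_on_P1 A B T e fp fm <->
        (forall i t, 0 < t < e -> fm i t = 0) /\
        exists c : 'I_3 -> R, family_member A B b0 a3 e c fp].
Proof.
have [a [be [al cd]]] := coef_data_ex hA hApos hAdot hA3 hb0 hB hBpos hB0 hAB.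
have sal := cd_sal cd; have eal := cd_eal cd; split.
- move=> c; have [e e0 [V HV]] := reduced_sol_ex sal eal c; exists e => //.
  by exists (fun i t => t * V i t); exact: (family_of_reduced hb0 cd e0 HV).
- move=> e c c' fp fp' e0 F F'.
  have [V HV fV] := reduced_of_family cd e0 F.
  have [V' HV' fV'] := reduced_of_family cd e0 F'.
  split=> [cc' i t te|ff' i].
    have /funext cE : c =1 c' by [].
    rewrite -cE in HV'; rewrite fV // fV' //.
    by rewrite (reduced_sol_unique sal HV HV') //; case/andP: te => /ltW ->.
  have [V0 _ _] := HV; have [V'0 _ _] := HV'; rewrite -V0 -V'0.
  have I0 : [set t : R | `|t| < e] 0 by rewrite /= normr0.
  (* The parameters are recovered as the limits of [f_i^+ / t] at 0. *)
  apply: (eq_at0 e0).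
  - exact: smooth_continuous (reduced_sol_smooth sal HV i) I0.
  - exact: smooth_continuous (reduced_sol_smooth sal HV' i) I0.
  move=> t te; have t0 : t != 0 by case/andP: te => /lt0r_neq0.
  by apply: (mulfI t0); rewrite -fV // -fV' // ff'.
move=> e fp fm e0; split; first exact: (family_of_instanton hb0 cd hT e0).
by move=> [fm0 [c F]]; exact: (instanton_of_family cd hT e0 F fm0).
Qed.
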